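(* Let $c_1,c_2,m\in\mathbb R$ with $0<\sqrt{c_1^2+c_2^2}\le m$, and let $L_S$ be the operator on $\mathbb H_2$ given by $$L_S=(m+c_1)Y_1^2+(m-c_1)Y_2^2+2c_2Y_1Y_2+2i(X_1Y_2-X_2Y_1).$$ Then $L_S+i\alpha U$ is locally solvable for every $\alpha\in\mathbb C$, even though the semisimple part $D=D_1+iD_2$ (with $D_1=\Re D$, $D_2=\Im D$) of the associated matrix $S$ does not satisfy $[D_1,D_2]=0$.
   Context: The Heisenberg group $\mathbb H_2$ is $\mathbb R^4\times\mathbb R$ with coordinates $(x,y,u)\in\mathbb R^2\times\mathbb R^2\times\mathbb R$ and left-invariant vector fields $X_j=\partial_{x_j}-\tfrac12y_j\partial_u$, $Y_j=\partial_{y_j}+\tfrac12x_j\partial_u$ ($j=1,2$), $U=\partial_u$. Write $V_1,\dots,V_4$ for $X_1,X_2,Y_1,Y_2$. If $L=\sum_{j,k}a_{jk}V_jV_k$ with a complex symmetric matrix $A=(a_{jk})$, then the associated matrix is $S=-AJ$, where $J=\begin{pmatrix}0&I_2\\-I_2&0\end{pmatrix}$, and $L$ is denoted $L_S$. The semisimple part $D$ of $S$ is the one in the Jordan decomposition $S=D+N$ ($D$ semisimple, $N$ nilpotent, $DN=ND$); real and imaginary parts of matrices are taken entrywise. A linear differential operator $L$ with smooth coefficients is locally solvable at a point if this point has an open neighborhood $\Omega$ such that for every $f\in C_0^\infty(\Omega)$ there is a distribution $u$ on $\Omega$ with $Lu=f$ in $\Omega$; for left-invariant operators the point is irrelevant.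 *)

(* Defs.v *)
From HB Require Import structures.
From mathcomp Require Import all_boot all_order all_algebra.
From mathcomp Require Import complex.
From mathcomp Require Import boolp classical_sets reals topology normedtype.
From mathcomp Require Import derive measure lebesgue_measure lebesgue_integral.

Set Implicit Arguments.
Unset Strict Implicit.
Unset Printing Implicit Defensive.

Import Order.TTheory GRing.Theory Num.Theory.
Import numFieldNormedType.Exports.

Local Open Scope classical_set_scope.
Local Open Scope ring_scope.
Local Open Scope complex_scope.

(* R[i] carries no normed R-module structure in the library, so derivatives
   and integrals of complex-valued functions are taken componentwise. *)

Definition partialC (R : realType) (n : nat) (j : 'I_n)
    (f : 'rV[R]_n -> R[i]) : 'rV[R]_n -> R[i] :=
  fun x => 'D_('e_j) (fun z => complex.Re (f z)) x
       +i* 'D_('e_j) (fun z => complex.Im (f z)) x.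

Definition partialsC (R : realType) (n : nat) (s : seq 'I_n)
    (f : 'rV[R]_n -> R[i]) : 'rV[R]_n -> R[i] :=
  foldr (@partialC R n) f s.

Definition continuous_with_partials (R : realType) (n : nat)
    (g : 'rV[R]_n -> R) : Prop :=
  continuous g /\ forall (x : 'rV[R]_n) (j : 'I_n), derivable g x 'e_j.

Definition smooth (R : realType) (n : nat) (f : 'rV[R]_n -> R[i]) : Prop :=
  forall s : seq 'I_n,
    continuous_with_partials (fun z => complex.Re (partialsC s f z)) /\
    continuous_with_partials (fun z => complex.Im (partialsC s f z)).

Definition supp (R : realType) (n : nat) (f : 'rV[R]_n -> R[i]) :
    set 'rV[R]_n :=
  closure [set x | f x != 0].

(* C_0^oo(Omega); its elements are extended by zero to all of R^n. *)
Definition test_function (R : realType) (n : nat) (Omega : set 'rV[R]_n)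
    (f : 'rV[R]_n -> R[i]) : Prop :=
  [/\ smooth f, compact (supp f) & supp f `<=` Omega].

(* Iterated Lebesgue integral; by Fubini this is the integral over R^n for the
   integrands used below, which are smooth with compact support. *)
Fixpoint integral_rV (R : realType) (n : nat) : ('rV[R]_n -> R) -> R :=
  match n return ('rV[R]_n -> R) -> R with
  | 0 => fun g => g 0
  | k.+1 => fun g =>
      \int[@lebesgue_measure R]_t
        integral_rV (fun y : 'rV[R]_k => g (row_mx t%:M y : 'rV[R]_(1 + k)))
  end.

Definition integralC (R : realType) (n : nat) (f : 'rV[R]_n -> R[i]) : R[i] :=
  integral_rV (fun x => complex.Re (f x))
  +i* integral_rV (fun x => complex.Im (f x)).

Definition Ck_norm (R : realType) (n N : nat) (phi : 'rV[R]_n -> R[i]) : R :=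
  sup [set r | exists (s : seq 'I_n) (x : 'rV[R]_n),
         (size s <= N)%N /\ r = Normc.normc (partialsC s phi x)].

(* Only the values of u on test_function Omega are meaningful. *)
Definition is_distribution (R : realType) (n : nat) (Omega : set 'rV[R]_n)
    (u : ('rV[R]_n -> R[i]) -> R[i]) : Prop :=
  (forall (a : R[i]) (phi psi : 'rV[R]_n -> R[i]),
     test_function Omega phi -> test_function Omega psi ->
     u (fun x => a * phi x + psi x) = a * u phi + u psi) /\
  (forall K : set 'rV[R]_n, compact K -> K `<=` Omega ->
     exists (M : R) (N : nat), forall phi : 'rV[R]_n -> R[i],
       test_function Omega phi -> supp phi `<=` K ->
       Normc.normc (u phi) <= M * Ck_norm N phi).

Inductive diffop (R : realType) (n : nat) : Type :=
| OpMul of ('rV[R]_n -> R[i])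
| OpPartial of 'I_n
| OpAdd of diffop R n & diffop R n
| OpComp of diffop R n & diffop R n. (* OpComp P Q is P after Q *)

Arguments OpPartial {R n}.

Declare Scope diffop_scope.
Delimit Scope diffop_scope with DO.
Bind Scope diffop_scope with diffop.
Notation "P + Q" := (OpAdd P Q) : diffop_scope.
Notation "P * Q" := (OpComp P Q) : diffop_scope.

Definition OpScale (R : realType) (n : nat) (a : R[i]) (P : diffop R n) :
    diffop R n :=
  OpComp (OpMul (fun=> a)) P.

Notation "a *: P" := (OpScale a P) : diffop_scope.

Fixpoint smooth_coefficients (R : realType) (n : nat) (P : diffop R n) : Prop :=
  match P with
  | OpMul a => smooth a
  | OpPartial _ => True
  | OpAdd P1 P2 | OpComp P1 P2 =>
      smooth_coefficients P1 /\ smooth_coefficients P2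
  end.

Fixpoint apply_fun (R : realType) (n : nat) (P : diffop R n)
    (f : 'rV[R]_n -> R[i]) : 'rV[R]_n -> R[i] :=
  match P with
  | OpMul a => fun x => a x * f x
  | OpPartial j => partialC j f
  | OpAdd P1 P2 => fun x => apply_fun P1 f x + apply_fun P2 f x
  | OpComp P1 P2 => apply_fun P1 (apply_fun P2 f)
  end.

Fixpoint apply_distr (R : realType) (n : nat) (P : diffop R n)
    (u : ('rV[R]_n -> R[i]) -> R[i]) : ('rV[R]_n -> R[i]) -> R[i] :=
  match P with
  | OpMul a => fun phi => u (fun x => a x * phi x)
  | OpPartial j => fun phi => - u (partialC j phi)
  | OpAdd P1 P2 => fun phi => apply_distr P1 u phi + apply_distr P2 u phi
  | OpComp P1 P2 => apply_distr P1 (apply_distr P2 u)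
  end.

Definition same_operator (R : realType) (n : nat) (P Q : diffop R n) : Prop :=
  forall f : 'rV[R]_n -> R[i], smooth f -> apply_fun P f = apply_fun Q f.

Definition locally_solvable_at (R : realType) (n : nat) (L : diffop R n)
    (p : 'rV[R]_n) : Prop :=
  smooth_coefficients L /\
  exists Omega : set 'rV[R]_n, [/\ open Omega, Omega p &
    forall f, test_function Omega f ->
      exists u, is_distribution Omega u /\
        forall phi, test_function Omega phi ->
          apply_distr L u phi = integralC (fun x => f x * phi x)].

Definition locally_solvable (R : realType) (n : nat) (L : diffop R n) : Prop :=
  forall p : 'rV[R]_n, locally_solvable_at L p.

(* Points of the Heisenberg group H_2 are row vectors (x_1,x_2,y_1,y_2,u). *)
Definition ix (j : 'I_2) : 'I_(2 + 2 + 1) := lshift 1 (lshift 2 j).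
Definition iy (j : 'I_2) : 'I_(2 + 2 + 1) := lshift 1 (rshift 2 j).
Definition iu : 'I_(2 + 2 + 1) := rshift (2 + 2) ord0.

Definition opX (R : realType) (j : 'I_2) : diffop R (2 + 2 + 1) :=
  (OpPartial (ix j) + OpMul (fun p => (- (p ord0 (iy j) / 2))%:C)
                      * OpPartial iu)%DO.
Definition opY (R : realType) (j : 'I_2) : diffop R (2 + 2 + 1) :=
  (OpPartial (iy j) + OpMul (fun p => (p ord0 (ix j) / 2)%:C)
                      * OpPartial iu)%DO.
Definition opU (R : realType) : diffop R (2 + 2 + 1) := OpPartial iu.

Definition opV (R : realType) (k : 'I_(2 + 2)) : diffop R (2 + 2 + 1) :=
  match split k with inl j => opX R j | inr j => opY R j end.

Definition quadratic_op (R : realType) (A : 'M[R[i]]_(2 + 2)) :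
    diffop R (2 + 2 + 1) :=
  \big[@OpAdd R _ / OpMul (fun=> 0)]_(j < 2 + 2)
    \big[@OpAdd R _ / OpMul (fun=> 0)]_(k < 2 + 2)
      (A j k *: (opV R j * opV R k))%DO.

Definition matJ (R : realType) : 'M[R[i]]_(2 + 2) :=
  block_mx 0 1%:M (- 1%:M) 0.

Definition associated_matrix (R : realType) (L : diffop R (2 + 2 + 1))
    (S : 'M[R[i]]_(2 + 2)) : Prop :=
  exists A : 'M[R[i]]_(2 + 2),
    [/\ A^T = A, same_operator L (quadratic_op A) & S = - (A *m matJ R)].

(* R[i] is algebraically closed, so semisimple means diagonalizable. *)
Definition semisimple_part (R : realType) (n : nat) (S D : 'M[R[i]]_n.+1) :
    Prop :=
  exists N : 'M[R[i]]_n.+1,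
    [/\ S = D + N, diagonalizable D, exists k, N ^+ k = 0 & D *m N = N *m D].

Definition Re_mx (R : realType) (n : nat) (M : 'M[R[i]]_n) : 'M[R]_n :=
  map_mx (@complex.Re R) M.
Definition Im_mx (R : realType) (n : nat) (M : 'M[R[i]]_n) : 'M[R]_n :=
  map_mx (@complex.Im R) M.

(* In terms of 0-based indices: X_1 = opX 0, X_2 = opX 1, and likewise Y. *)
Definition example_op (R : realType) (c1 c2 m : R) : diffop R (2 + 2 + 1) :=
  let X1 := opX R 0 in let X2 := opX R 1 in
  let Y1 := opY R 0 in let Y2 := opY R 1 in
  ((m + c1)%:C *: (Y1 * Y1) + (m - c1)%:C *: (Y2 * Y2)
   + (2 * c2)%:C *: (Y1 * Y2)
   + (2 * 'i%C)%R *: (X1 * Y2 + (- 1)%R *: (X2 * Y1)))%DO.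

(* Main.v *)
Require Import Defs.
From HB Require Import structures.
From mathcomp Require Import all_boot all_order all_algebra.
From mathcomp Require Import complex.
From mathcomp Require Import boolp classical_sets functions reals constructive_ereal ereal topology normedtype.
From mathcomp Require Import derive measure lebesgue_measure lebesgue_integral realfun sequences exp trigo ftc.
From mathcomp Require Import ring lra.
Set Implicit Arguments. Unset Strict Implicit. Unset Printing Implicit Defensive.
Import Order.TTheory GRing.Theory Num.Theory.
Import numFieldNormedType.Exports.
Local Open Scope classical_set_scope.
Local Open Scope ring_scope.
Local Open Scope complex_scope.

(** Local solvability.  Let L stand for L_S + i alpha U.  Its transpose is bounded
below: for test functions phi in a cube of width 2, |phi| <= C |L^t phi|_(C^N)
([apriori_estimate]).  The functional L^t phi |-> int f phi is therefore well
defined and continuous for a C^N norm, and its Hahn-Banach extension is a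
distribution u with L u = f ([solvable_of_estimate]).

For the estimate, phi is expanded in a Fourier series in (y, u), twisted so
that the vector fields become simple.  With
   F phi (x) = int exp (- i (eta . y + mu (u + x . y / 2))) phi (x, y, u) dy du,
where eta runs through the integer vectors and mu through the half-integers,
X_j turns into d/dx_j, Y_j into multiplication by i zeta_j, where
zeta = eta + mu x, and U into multiplication by i mu.  Half-integers are used
because the problem degenerates at mu = 0.  The second-order part involving X
becomes the rotation field zeta_2 d_1 - zeta_1 d_2, so in polar coordinates
zeta = rho (sin t, cos t) the equation L^t phi = g is an ordinary differential
equation on each circle ([transport]):
   2 mu V' + (rho^2 q(t) - alpha mu) V = - G,   q = m - c1 cos 2t + c2 sin 2t.
The hypothesis on m says q >= 0.  Hence the integrating factor is bounded,
uniformly in rho and mu, if one goes round the circle in the direction given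
by the sign of mu.  A full turn multiplies it by
z = exp (pi s alpha - pi m rho^2 / |mu|), s the sign of mu, and yields
(z - 1) V = O(sup |G|).  The number z is close to 1 only near at most one
resonant circle.  Comparing V with its values on that circle, where the full
turn gives (z - 1) V = 0, bounds V by G and its first derivative in rho; when the
resonant circle is the centre, the comparison is with the first-order Taylor
polynomial at the centre and costs a second derivative ([circle_bound]).  The
resulting bounds grow at most polynomially in (eta, mu), which is paid for by
the decay of the Fourier coefficients of the smooth function g, and the series
can be summed ([inversion]).

The matrix S.  In blocks, S = [W, 0; Q, W] with W = i [0, 1; -1, 0] and
Q = [m + c1, c2; c2, m - c1].  It is the sum of D = [W, 0; C, W],
C = [c1, c2; c2, - c1], and N = [0, 0; m, 0]; here C anticommutes with W, so
D^2 = 1, while N^2 = 0 and D N = N D.  The real part of D is [0, 0; C, 0] and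
its imaginary part is block diagonal with blocks [0, 1; -1, 0]; they do not
commute because C anticommutes with that block and is not 0.  Uniqueness of S
comes from applying operators to quadratic monomials at the origin
([quadratic_mono]); uniqueness of D from D = (3 S - S^3) / 2, which makes D
commute with every other candidate ([semisimple_unique]). *)

(** * Coordinate calculus on row vectors *)

Section RowCalculus.
Variables (R : realType) (n : nat).
Implicit Types (g : 'rV[R]_n -> R) (p q : 'rV[R]_n) (j : 'I_n).

Definition pd j g : 'rV[R]_n -> R := fun x => 'D_('e_j) g x.
Definition pds (s : seq 'I_n) g := foldr pd g s.
(** Real counterpart of [smooth]; a complex function is smooth iff its real and
    imaginary parts are ([smoothE]). *)
Definition smoothR g := forall s, continuous_with_partials (pds s g).
(** The slices t |-> g (upd p j t) reduce partial derivatives and partial integrals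
    to functions of one real variable. *)
Definition upd p j (t : R) : 'rV[R]_n := \row_i (if i == j then t else p ord0 i).

Lemma smoothR_pd g j : smoothR g -> smoothR (pd j g).
Proof. by move=> sg s; have := sg (rcons s j); rewrite /pds foldr_rcons. Qed.

(** A class of functions with continuous partials that is stable under partial
    derivatives consists of smooth functions; the smoothness proofs below rest on this. *)
Lemma smoothR_coind (C : ('rV[R]_n -> R) -> Prop) :
  (forall g, C g -> continuous_with_partials g) ->
  (forall g j, C g -> C (pd j g)) -> forall g, C g -> smoothR g.
Proof.
move=> C1 C2 g Cg s; apply: C1; elim: s => //= j s ih; exact: C2.
Qed.

Lemma smoothR_continuous g : smoothR g -> continuous g.
Proof. by move=> /(_ [::])[]. Qed.
Lemma smoothR_derivable g p j : smoothR g -> derivable g p 'e_j.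
Proof. by move=> /(_ [::])[_]; apply. Qed.

Lemma rV_norm_le p (c : R) : 0 <= c -> (forall j, `|p ord0 j| <= c) -> `|p| <= c.
Proof.
move=> c0 H; rewrite /Num.Def.normr/= mx_normrE; apply: bigmax_le => // -[i j] _ /=.
by rewrite (ord1 i).
Qed.

Lemma rV_coord_norm p j : `|p ord0 j| <= `|p|.
Proof.
rewrite [leRHS]/Num.Def.normr/= mx_normrE.
exact: (@le_bigmax _ _ _ _ (fun i => `|p i.1 i.2|) (ord0, j)).
Qed.

Lemma updE p j t i : upd p j t ord0 i = if i == j then t else p ord0 i.
Proof. by rewrite mxE. Qed.
Lemma upd_id p j : upd p j (p ord0 j) = p.
Proof. by apply/rowP => i; rewrite mxE; case: eqP => [->|]. Qed.
Lemma upd_upd p j s t : upd (upd p j s) j t = upd p j t.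
Proof. by apply/rowP => i; rewrite !mxE; case: eqP. Qed.
Lemma upd_comm p i j s t : i != j -> upd (upd p i s) j t = upd (upd p j t) i s.
Proof.
move=> ij; apply/rowP => k; rewrite !mxE; case: eqP => [->|//].
by rewrite eq_sym (negbTE ij).
Qed.
Lemma upd_addE p j t h : upd p j (h + t) = h *: 'e_j + upd p j t.
Proof.
apply/rowP => i; rewrite !mxE eqxx /=; case: eqP => _ /=; first by rewrite mulr1.
by rewrite mulr0 add0r.
Qed.
Lemma add_updE p j h : h *: 'e_j + p = upd p j (h + p ord0 j).
Proof. by rewrite upd_addE upd_id. Qed.

Lemma is_derive_upd g p j t : derivable g (upd p j t) 'e_j ->
  is_derive t 1 (fun t => g (upd p j t)) (pd j g (upd p j t)).
Proof.
have E : (fun h : R => h^-1 *: (((fun t => g (upd p j t)) \o shift t) (h *: 1) - g (upd p j t)))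
  = (fun h => h^-1 *: ((g \o shift (upd p j t)) (h *: 'e_j) - g (upd p j t))).
  by apply/funext => h /=; rewrite [h%:A]mulr1 upd_addE.
by move=> H; split; rewrite /derivable /pd /derive E.
Qed.

(** The points mix p q 0 = p, ..., mix p q n = q change one coordinate at a time,
    so that the mean value theorem applies to each step. *)
Definition mix p q (k : nat) : 'rV[R]_n := \row_i (if (i < k)%N then q ord0 i else p ord0 i).
Lemma mix0 p q : mix p q 0 = p. Proof. by apply/rowP => i; rewrite mxE ltn0. Qed.
Lemma mixn p q : mix p q n = q. Proof. by apply/rowP => i; rewrite mxE ltn_ord. Qed.
Lemma mixS p q j : mix p q j.+1 = upd (mix p q j) j (q ord0 j).
Proof.
apply/rowP => i; rewrite !mxE ltnS leq_eqVlt.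
have [->|ij] := eqVneq i j; first by rewrite eqxx.
by rewrite val_eqE (negbTE ij).
Qed.
Lemma mixj p q j : mix p q j ord0 j = p ord0 j.
Proof. by rewrite mxE ltnn. Qed.

Lemma telescope_mix g p q :
  g q - g p = \sum_(j < n) (g (mix p q j.+1) - g (mix p q j)).
Proof.
rewrite -(big_mkord xpredT (fun j : nat => g (mix p q j.+1) - g (mix p q j))).
by rewrite telescope_sumr // mix0 mixn.
Qed.

Lemma MVT_any (f df : R -> R) (a b : R) :
  (forall x : R, is_derive x 1 f (df x)) ->
  exists2 c, (Num.min a b <= c <= Num.max a b) & f b - f a = df c * (b - a).
Proof.
move=> H; have cf : continuous f.
  by move=> x; apply: differentiable_continuous; apply/derivable1_diffP.
wlog ab : a b / a <= b.
  move=> W; have [ab|ba] := orP (le_total a b); first exact: W.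
  have [c c1 c2] := W b a ba; exists c; first by rewrite minC maxC.
  by rewrite -opprB c2 -mulrN opprB.
have [|c c1 c2] := @MVT_segment R f df a b ab (fun x _ => H x).
  exact: continuous_subspaceT.
exists c => //; rewrite in_itv /= in c1.
by rewrite (min_idPl ab) (max_idPr ab).
Qed.

Lemma mix_step g p q j : (forall z, derivable g z 'e_j) ->
  exists z, [/\ g (mix p q j.+1) - g (mix p q j) = pd j g z * (q ord0 j - p ord0 j)
    & forall i, (Num.min (p ord0 i) (q ord0 i) <= z ord0 i <= Num.max (p ord0 i) (q ord0 i))].
Proof.
move=> H.
have [c c1 c2] := @MVT_any (fun t => g (upd (mix p q j) j t)) _ (p ord0 j) (q ord0 j)
   (fun t => is_derive_upd (H _)).
exists (upd (mix p q j) j c); split.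
  by rewrite -c2 mixS; congr (_ - g _); rewrite -(mixj p q j) upd_id.
move=> i; rewrite updE; case: eqP => [->//|_]; rewrite mxE.
by case: ifP => _; rewrite ?ge_min ?le_max !lexx ?orbT.
Qed.

Lemma continuous_bounded g (M : R) : continuous g ->
  exists2 B, 0 <= B & forall p, (forall i, `|p ord0 i| <= M) -> `|g p| <= B.
Proof.
move=> cg; pose A : set 'rV[R]_n := [set p | forall i, `[- M, M]%classic (p ord0 i)].
have cA : compact A by apply: (@rV_compact R n (fun=> `[- M, M]%classic)) => i; exact: segment_compact.
have /compact_bounded[B [Br HB]] : compact (g @` A).
  by apply: continuous_compact => //; exact: continuous_subspaceT.
exists (`|B| + 1); first by rewrite addr_ge0.
move=> p pM; apply: (HB (`|B| + 1)); first by rewrite (le_lt_trans (ler_norm B)) // ltrDl.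
exists p => // i /=; rewrite in_itv /=.
by have := pM i; rewrite ler_norml.
Qed.

Lemma between_bound (a b c M : R) : `|a| <= M -> `|b| <= M ->
  Num.min a b <= c <= Num.max a b -> `|c| <= M.
Proof.
rewrite !ler_norml => /andP[a1 a2] /andP[b1 b2] /andP[c1 c2].
rewrite (le_trans _ c1) ?(le_trans c2) //; first by rewrite ge_max a2.
by rewrite le_min a1.
Qed.
Lemma between_dist (a b c : R) : Num.min a b <= c <= Num.max a b -> `|c - a| <= `|b - a|.
Proof.
have [ab|ba] := leP a b => /andP[c1 c2].
  by rewrite !ger0_norm ?subr_ge0 // lerB.
rewrite distrC (distrC b) !ger0_norm ?subr_ge0 // ?lerB //; exact: ltW.
Qed.

Lemma smoothR_lip g (M : R) : smoothR g ->
  exists2 B, 0 <= B & forall p q, `|p| <= M -> `|q| <= M -> `|g q - g p| <= B * `|q - p|.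
Proof.
move=> sg.
have H j : exists B : R, 0 <= B /\ forall p, (forall i, `|p ord0 i| <= M) -> `|pd j g p| <= B.
  have [B B0 HB] := @continuous_bounded (pd j g) M (smoothR_continuous (smoothR_pd j sg)).
  by exists B.
have /choice[B HB] := H.
exists (\sum_j B j); first by apply: sumr_ge0 => j _; have [] := HB j.
move=> p q pM qM; rewrite telescope_mix; apply: le_trans (ler_norm_sum _ _ _) _.
rewrite mulr_suml; apply: ler_sum => j _.
have [z [-> zb]] := @mix_step g p q j (fun z => smoothR_derivable sg).
have [B0 BB] := HB j; rewrite normrM ler_pM //.
  apply: BB => i; apply: between_bound (zb i); exact: le_trans (rV_coord_norm _ _) _.
by have := rV_coord_norm (q - p) j; rewrite !mxE.
Qed.

(** First-order Taylor formula with quadratic remainder.  It holds because the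
    gradient is itself Lipschitz on bounded sets. *)
Lemma smoothR_taylor g (M : R) : smoothR g ->
  exists2 B, 0 <= B & forall p q, `|p| <= M -> `|q| <= M ->
   `|g q - g p - \sum_j (q ord0 j - p ord0 j) * pd j g p| <= B * `|q - p| ^+ 2.
Proof.
move=> sg.
have H j : exists B : R, 0 <= B /\ forall p q, `|p| <= M -> `|q| <= M ->
    `|pd j g q - pd j g p| <= B * `|q - p|.
  by have [B B0 HB] := smoothR_lip M (smoothR_pd j sg); exists B.
have /choice[B HB] := H.
exists (\sum_j B j); first by apply: sumr_ge0 => j _; have [] := HB j.
move=> p q pM qM; rewrite telescope_mix -sumrB.
apply: le_trans (ler_norm_sum _ _ _) _.
rewrite mulr_suml; apply: ler_sum => j _.
have [z [-> zb]] := @mix_step g p q j (fun z => smoothR_derivable sg).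
have [B0 BB] := HB j.
rewrite mulrC -mulrBr normrM expr2 mulrCA ler_pM //.
  by have := rV_coord_norm (q - p) j; rewrite !mxE.
apply: le_trans (BB _ _ pM _) _.
  apply: rV_norm_le => [|i]; first exact: le_trans pM.
  apply: between_bound (zb i); exact: le_trans (rV_coord_norm _ _) _.
apply: ler_wpM2l => //; apply: rV_norm_le => // i; rewrite !mxE.
apply: le_trans (between_dist (zb i)) _.
by have := rV_coord_norm (q - p) i; rewrite !mxE.
Qed.

End RowCalculus.

(** * The chain rule along curves and closure properties of smoothness *)

Section DerivEps.
Variable R : realType.
Implicit Types f : R -> R.

Lemma is_derive_eps f (x l : R) :
  (forall e, 0 < e -> exists2 d, 0 < d &
     forall h, `|h| < d -> `|f (h + x) - f x - h * l| <= e * `|h|) ->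
  is_derive x 1 f l.
Proof.
move=> H.
have C : (fun h : R => h^-1 *: ((f \o shift x) (h *: 1) - f x)) @ 0^' --> l.
  apply/cvgrPdist_le => e e0; have [d d0 Hd] := H e e0.
  near=> h.
  have h0 : h != 0 by near: h; exact: nbhs_dnbhs_neq.
  have hd : `|h| < d by near: h; exact: dnbhs0_lt.
  rewrite /= [h%:A]mulr1 distrC.
  have -> : h^-1 *: (f (h + x) - f x) - l = h^-1 * (f (h + x) - f x - h * l).
    by rewrite mulrBr mulKf.
  rewrite normrM normfV ler_pdivrMl ?normr_gt0 // [leRHS]mulrC; exact: Hd.
by split; [apply/cvg_ex; exists l | exact: cvg_lim].
Unshelve. all: by end_near. Qed.

Lemma is_derive_epsP f (x l : R) : is_derive x 1 f l ->
  (forall e, 0 < e -> exists2 d, 0 < d &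
     forall h, `|h| < d -> `|f (h + x) - f x - h * l| <= e * `|h|).
Proof.
move=> [df dl] e e0.
have C : (fun h : R => h^-1 *: ((f \o shift x) (h *: 1) - f x)) @ 0^' --> l.
  by rewrite -dl; exact: df.
have /cvgrPdist_le/(_ _ e0)[/= d d0 Hd] := C.
exists d => // h hd; have [->|h0] := eqVneq h 0.
  by rewrite add0r subrr mul0r subrr normr0 mulr0.
have := Hd h; rewrite /ball_ /= sub0r normrN => /(_ hd h0).
rewrite [h%:A]mulr1 distrC.
have -> : h^-1 *: (f (h + x) - f x) - l = h^-1 * (f (h + x) - f x - h * l).
  by rewrite mulrBr mulKf.
by rewrite normrM normfV ler_pdivrMl ?normr_gt0 // [leRHS]mulrC.
Qed.

Lemma is_derive_quad f (x l C d : R) : 0 < d ->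
  (forall h, `|h| < d -> `|f (h + x) - f x - h * l| <= C * `|h| ^+ 2) ->
  is_derive x 1 f l.
Proof.
move=> d0 H; apply: is_derive_eps => e e0.
have C1 : 0 < `|C| + 1 by rewrite ltr_wpDl.
exists (Num.min d (e / (`|C| + 1))); first by rewrite lt_min d0 divr_gt0.
move=> h; rewrite lt_min => /andP[hd he]; apply: le_trans (H h hd) _.
rewrite expr2 mulrA ler_wpM2r // (le_trans (y := (`|C| + 1) * `|h|)) //.
  by rewrite ler_wpM2r // (le_trans (ler_norm C)) // lerDl.
by rewrite mulrC -ler_pdivlMr // ltW.
Qed.

Lemma is_derive_dir n (g : 'rV[R]_n -> R) p v (l : R) :
  is_derive p v g l <-> is_derive (0 : R) 1 (fun h => g (h *: v + p)) l.
Proof.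
pose F h := g (h *: v + p).
have E : (fun h : R => h^-1 *: ((F \o shift 0) (h *: 1) - F 0))
  = (fun h => h^-1 *: ((g \o shift p) (h *: v) - g p)).
  by apply/funext => h /=; rewrite [h%:A]mulr1 /F addr0 scale0r add0r.
by split=> -[d1 d2]; split; move: d1 d2; rewrite /derivable /derive -/F E.
Qed.

Lemma pd_derive n (g : 'rV[R]_n -> R) p j l : is_derive p 'e_j g l -> pd j g p = l.
Proof. by case. Qed.

(** Chain rule for a smooth function along a curve that is only known to have a
    derivative in each coordinate at t. *)
Lemma is_derive_curve n (g : 'rV[R]_n -> R) (q : R -> 'rV[R]_n) (dq : 'I_n -> R) (t : R) :
  smoothR g -> (forall j, is_derive t 1 (fun s => q s ord0 j) (dq j)) ->
  is_derive t 1 (fun s => g (q s)) (\sum_j dq j * pd j g (q t)).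
Proof.
move=> sg dqH; apply: is_derive_eps => e e0.
have [D D1 DH] : exists2 D, 1 <= D & forall j, `|dq j| + 1 <= D.
  exists (1 + \sum_j `|dq j|); first by rewrite lerDl sumr_ge0.
  by move=> j; rewrite addrC lerD2l (bigD1 j) //= lerDl sumr_ge0.
have D0 : 0 < D by exact: lt_le_trans D1.
have [B B0 HB] := smoothR_taylor (`|q t| + D) sg.
(* D bounds the speed of the curve and S the gradient of g at q t *)
pose S := 1 + \sum_j `|pd j g (q t)|.
have S0 : 0 < S by rewrite ltr_pwDl // sumr_ge0.
pose e1 := Num.min 1 (e / 2 / S).
have e10 : 0 < e1 by rewrite lt_min ltr01 !divr_gt0.
have H j : exists d, 0 < d /\ forall h, `|h| < d ->
    `|q (h + t) ord0 j - q t ord0 j - h * dq j| <= e1 * `|h|.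
  by have [d d0 Hd] := is_derive_epsP (dqH j) e10; exists d.
have /choice[d Hd] := H.
pose d1 := \big[Num.min/Num.min 1 (e / 2 / ((B + 1) * D ^+ 2))]_j d j.
have BD0 : 0 < (B + 1) * D ^+ 2 by rewrite mulr_gt0 ?exprn_gt0 // ltr_wpDl.
have d10 : 0 < d1.
  apply: lt_bigmin => [|j _]; last by have [] := Hd j.
  by rewrite lt_min ltr01 !divr_gt0.
exists d1 => // h hd.
have hd0 : `|h| < Num.min 1 (e / 2 / ((B + 1) * D ^+ 2)).
  by apply: lt_le_trans hd _; apply: bigmin_le_id.
move: (hd0); rewrite lt_min => /andP[h1 hB].
have hj j : `|q (h + t) ord0 j - q t ord0 j - h * dq j| <= e1 * `|h|.
  have [_] := Hd j; apply; apply: lt_le_trans hd _; exact: bigmin_le_cond.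
have qd : `|q (h + t) - q t| <= D * `|h|.
  apply: rV_norm_le => [|j]; first by rewrite mulr_ge0 // ltW.
  rewrite !mxE -(subrK (h * dq j) (_ - _)) (le_trans (ler_normD _ _)) //.
  apply: le_trans (lerD (hj j) (lexx _)) _.
  rewrite normrM (mulrC `|h|) -mulrDl ler_wpM2r // (le_trans _ (DH j)) // addrC lerD2l.
  by rewrite ge_min lexx.
have Dh : D * `|h| <= D by rewrite ler_piMr // ltW.
have T : `|g (q (h + t)) - g (q t)
     - \sum_j (q (h + t) ord0 j - q t ord0 j) * pd j g (q t)| <= B * (D * `|h|) ^+ 2.
  apply: le_trans (HB _ _ _ _) _; first by rewrite lerDl ltW.
    rewrite -(subrK (q t) (q (h + t))) addrC (le_trans (ler_normD _ _)) // lerD2l.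
    exact: le_trans qd Dh.
  by rewrite ler_wpM2l // lerXn2r ?nnegrE // mulr_ge0 // ltW.
have -> : g (q (h + t)) - g (q t) - h * (\sum_j dq j * pd j g (q t)) =
  (g (q (h + t)) - g (q t) - \sum_j (q (h + t) ord0 j - q t ord0 j) * pd j g (q t))
  + \sum_j (q (h + t) ord0 j - q t ord0 j - h * dq j) * pd j g (q t).
  have -> : \sum_j (q (h + t) ord0 j - q t ord0 j - h * dq j) * pd j g (q t) =
    \sum_j (q (h + t) ord0 j - q t ord0 j) * pd j g (q t) - h * (\sum_j dq j * pd j g (q t)).
    by rewrite mulr_sumr -sumrB; apply: eq_bigr => j _; ring.
  by rewrite addrA subrK.
apply: le_trans (ler_normD _ _) _; rewrite (splitr e) mulrDl; apply: lerD.
  apply: le_trans T _; rewrite exprMn expr2 mulrA mulrA ler_wpM2r //.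
  move: hB; rewrite ltr_pdivlMr // => /ltW; apply: le_trans.
  by rewrite mulrC ler_wpM2l // -expr2 ler_wpM2r ?exprn_ge0 ?(ltW D0) // lerDl.
apply: le_trans (ler_norm_sum _ _ _) _.
apply: (@le_trans _ _ (\sum_j e1 * `|h| * `|pd j g (q t)|)).
  by apply: ler_sum => j _; rewrite normrM ler_wpM2r.
rewrite -mulr_sumr mulrAC ler_wpM2r //.
apply: (@le_trans _ _ (e1 * S)); first by rewrite ler_wpM2l ?(ltW e10) // lerDr.
by rewrite -ler_pdivlMr // ge_min lexx orbT.
Qed.

(** Expressions in smooth functions built from sums, products, sine and cosine; the
    class is stable under partial derivatives, whence smoothness. *)
Inductive alg n : ('rV[R]_n -> R) -> Prop :=
| alg_smooth g : smoothR g -> alg g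
| alg_add (f g : 'rV[R]_n -> R) : alg f -> alg g -> alg (fun x => f x + g x)
| alg_mul (f g : 'rV[R]_n -> R) : alg f -> alg g -> alg (fun x => f x * g x)
| alg_sin (f : 'rV[R]_n -> R) : alg f -> alg (fun x => sin (f x))
| alg_cos (f : 'rV[R]_n -> R) : alg f -> alg (fun x => cos (f x)).

Lemma cst_smoothR n (c : R) : smoothR (fun _ : 'rV[R]_n => c).
Proof.
apply: (@smoothR_coind _ _ (fun g => exists c, g = fun=> c)); last by exists c.
  by move=> _ [d ->]; split; [exact: cst_continuous | move=> x j; exact: derivable_cst].
move=> _ j [d ->]; exists 0; apply/funext => x; exact: derive_cst.
Qed.

Lemma is_derive_coord n (p : 'rV[R]_n) v j : is_derive p v (fun p : 'rV[R]_n => p ord0 j) (v ord0 j).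
Proof.
apply/is_derive_dir.
have -> : (fun h => (h *: v + p) ord0 j) = (fun h => h * v ord0 j + p ord0 j).
  by apply/funext => h; rewrite !mxE.
by apply: is_derive_eq; rewrite scaler0 add0r addr0 [LHS]mulr1.
Qed.

Lemma coord_smoothR n (j : 'I_n) : smoothR (fun p : 'rV[R]_n => p ord0 j).
Proof.
apply: (@smoothR_coind _ _ (fun g => g = (fun p : 'rV[R]_n => p ord0 j) \/ exists c, g = fun=> c)); last by left.
  move=> _ [->|[d ->]]; split.
  - exact: coord_continuous.
  - by move=> x i; case: (is_derive_coord x 'e_i j).
  - by exact: cst_continuous.
  - by move=> x i; exact: derivable_cst.
move=> _ i [->|[d ->]]; right.
  by exists (('e_i : 'rV[R]_n) ord0 j); apply/funext => x; case: (is_derive_coord x 'e_i j).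
by exists 0; apply/funext => x; exact: derive_cst.
Qed.

Lemma alg_props n (g : 'rV[R]_n -> R) : alg g ->
  continuous_with_partials g /\ forall j, alg (pd j g).
Proof.
elim=> {g} [g sg|f g Af [[cf df] pf] Ag [[cg dg] pg]|f g Af [[cf df] pf] Ag [[cg dg] pg]
  |f Af [[cf df] pf]|f Af [[cf df] pf]].
- by split; [exact: (sg [::]) | move=> j; apply/alg_smooth/smoothR_pd].
- split; first split.
  + by move=> x; apply: (@continuousD _ _ _ f g); [exact: cf|exact: cg].
  + by move=> x j; exact: derivableD.
  + move=> j; rewrite (_ : pd _ _ = fun x => pd j f x + pd j g x); first exact: alg_add.
    by apply/funext => x; exact: deriveD.
- split; first split.
  + by move=> x; apply: (@continuousM _ _ f g); [exact: cf|exact: cg].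
  + by move=> x j; exact: derivableM.
  + move=> j; rewrite (_ : pd _ _ = fun x => f x * pd j g x + g x * pd j f x).
      by apply: alg_add; apply: alg_mul.
    by apply/funext => x; exact: deriveM.
- have D x j : is_derive x 'e_j (fun x => sin (f x)) (cos (f x) * pd j f x).
    apply/is_derive_dir; have := derivableP (df x j) => /is_derive_dir H.
    apply: (is_derive1_comp (f := sin) (g := fun h => f (h *: 'e_j + x)) _ H).
    by rewrite scale0r add0r; exact: is_derive_sin.
  split; first split.
  + by move=> x; apply: continuous_comp; [exact: cf|exact: continuous_sin].
  + by move=> x j; have [] := D x j.
  + move=> j; rewrite (_ : pd _ _ = fun x => cos (f x) * pd j f x).
      by apply: alg_mul => //; exact: alg_cos.
    by apply/funext => x; have [] := D x j.
- have D x j : is_derive x 'e_j (fun x => cos (f x)) (- sin (f x) * pd j f x).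
    apply/is_derive_dir; have := derivableP (df x j) => /is_derive_dir H.
    apply: (is_derive1_comp (f := cos) (g := fun h => f (h *: 'e_j + x)) _ H).
    by rewrite scale0r add0r; exact: is_derive_cos.
  split; first split.
  + by move=> x; apply: continuous_comp; [exact: cf|exact: continuous_cos].
  + by move=> x j; have [] := D x j.
  + move=> j; rewrite (_ : pd _ _ = fun x => (-1 * sin (f x)) * pd j f x).
      apply: alg_mul => //; apply: alg_mul; [exact/alg_smooth/cst_smoothR|exact: alg_sin].
    by apply/funext => x; rewrite mulN1r; have [] := D x j.
Qed.

Lemma smoothR_alg n (g : 'rV[R]_n -> R) : alg g -> smoothR g.
Proof.
apply: (@smoothR_coind _ _ (@alg n)) => {}g; first by move=> /alg_props[].
by move=> j /alg_props[].
Qed.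

End DerivEps.

(** * Smooth complex functions, test functions and transposes *)

Section ComplexCalculus.
Variables (R : realType) (n : nat).
Implicit Types (f g a : 'rV[R]_n -> R[i]) (p q : 'rV[R]_n) (j : 'I_n) (Om : set 'rV[R]_n).
Local Notation normc := Normc.normc.
Local Notation Re := complex.Re.
Local Notation Im := complex.Im.

Lemma cReD (z w : R[i]) : Re (z + w) = Re z + Re w. Proof. by case: z; case: w. Qed.
Lemma cImD (z w : R[i]) : Im (z + w) = Im z + Im w. Proof. by case: z; case: w. Qed.
Lemma cReM (z w : R[i]) : Re (z * w) = Re z * Re w - Im z * Im w. Proof. by case: z; case: w. Qed.
Lemma cImM (z w : R[i]) : Im (z * w) = Re z * Im w + Im z * Re w. Proof. by case: z; case: w. Qed.
Lemma cReN (z : R[i]) : Re (- z) = - Re z. Proof. by case: z. Qed.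
Lemma cImN (z : R[i]) : Im (- z) = - Im z. Proof. by case: z. Qed.
Lemma complexP (z w : R[i]) : Re z = Re w -> Im z = Im w -> z = w.
Proof. by case: z => a b; case: w => c d /= -> ->. Qed.

Lemma normc_ge0 (z : R[i]) : 0 <= normc z.
Proof. by case: z => a b; exact: sqrtr_ge0. Qed.
Lemma normc_Re (z : R[i]) : `|Re z| <= normc z.
Proof. by case: z => a b /=; rewrite -sqrtr_sqr ler_wsqrtr // lerDl sqr_ge0. Qed.
Lemma normc_Im (z : R[i]) : `|Im z| <= normc z.
Proof. by case: z => a b /=; rewrite -sqrtr_sqr ler_wsqrtr // lerDr sqr_ge0. Qed.
Lemma normc_le (z : R[i]) : normc z <= `|Re z| + `|Im z|.
Proof.
case: z => a b /=; rewrite -[leRHS]ger0_norm ?addr_ge0 // -sqrtr_sqr ler_wsqrtr //.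
rewrite sqrrD !real_normK ?num_real // addrAC lerDl mulrn_wge0 // mulr_ge0 //.
Qed.
Lemma normc_real (x : R) : normc x%:C = `|x|.
Proof. by rewrite /= expr0n addr0 sqrtr_sqr. Qed.

Lemma partialsCE (s : seq 'I_n) f z :
  (Re (partialsC s f z) = pds s (fun z => Re (f z)) z) *
  (Im (partialsC s f z) = pds s (fun z => Im (f z)) z).
Proof.
elim: s f z => //= j s ih f z; split.
  by rewrite /pd; congr ('D_('e_j) _ z); apply/funext => w; exact: (ih f w).1.
by rewrite /pd; congr ('D_('e_j) _ z); apply/funext => w; exact: (ih f w).2.
Qed.

Lemma smoothE f : smooth f <->
  smoothR (fun z => Re (f z)) /\ smoothR (fun z => Im (f z)).
Proof.
have E1 s : (fun z => Re (partialsC s f z)) = pds s (fun z => Re (f z)).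
  by apply/funext => z; exact: (partialsCE s f z).1.
have E2 s : (fun z => Im (partialsC s f z)) = pds s (fun z => Im (f z)).
  by apply/funext => z; exact: (partialsCE s f z).2.
split=> [H|[H1 H2] s]; last by rewrite E1 E2.
by split=> s; [rewrite -E1|rewrite -E2]; case: (H s).
Qed.

#[local] Opaque smooth smoothR.

Lemma smooth_partial j f : smooth f -> smooth (partialC j f).
Proof. by move=> /smoothE[H1 H2]; apply/smoothE; split; [exact: (smoothR_pd j H1)|exact: (smoothR_pd j H2)]. Qed.

Lemma smooth_add f g : smooth f -> smooth g -> smooth (fun x => f x + g x).
Proof.
move=> /smoothE[f1 f2] /smoothE[g1 g2]; apply/smoothE; split; apply: smoothR_alg.
  under eq_fun do rewrite cReD; apply: alg_add; exact: alg_smooth.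
under eq_fun do rewrite cImD; apply: alg_add; exact: alg_smooth.
Qed.

Lemma smooth_cst (c : R[i]) : smooth (fun _ : 'rV[R]_n => c).
Proof. by apply/smoothE; split; exact: cst_smoothR. Qed.

Lemma smooth_mul f g : smooth f -> smooth g -> smooth (fun x => f x * g x).
Proof.
move=> /smoothE[f1 f2] /smoothE[g1 g2]; apply/smoothE; split; apply: smoothR_alg.
  have -> : (fun z => Re (f z * g z)) =
     (fun z => Re (f z) * Re (g z) + (-1) * (Im (f z) * Im (g z))).
    by apply/funext => z; rewrite cReM mulN1r.
  apply: alg_add; first by apply: alg_mul; exact: alg_smooth.
  apply: alg_mul; first exact/alg_smooth/cst_smoothR.
  by apply: alg_mul; exact: alg_smooth.
under eq_fun do rewrite cImM.
by apply: alg_add; apply: alg_mul; exact: alg_smooth.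
Qed.

Lemma smooth_real (g : 'rV[R]_n -> R) : smoothR g -> smooth (fun x => (g x)%:C).
Proof. by move=> sg; apply/smoothE; split; [exact: sg|exact: (@cst_smoothR R n 0)]. Qed.

Lemma partialC_add j f g : smooth f -> smooth g ->
  partialC j (fun x => f x + g x) = fun x => partialC j f x + partialC j g x.
Proof.
move=> /smoothE[f1 f2] /smoothE[g1 g2]; apply/funext => x.
apply: complexP; rewrite /partialC ?cReD ?cImD /=.
  under eq_fun do rewrite cReD.
  exact: (deriveD (smoothR_derivable f1) (smoothR_derivable g1)).
under eq_fun do rewrite cImD.
exact: (deriveD (smoothR_derivable f2) (smoothR_derivable g2)).
Qed.

Lemma partialC_mul j f g : smooth f -> smooth g ->
  partialC j (fun x => f x * g x) = fun x => partialC j f x * g x + f x * partialC j g x.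
Proof.
move=> /smoothE[f1 f2] /smoothE[g1 g2]; apply/funext => x.
have D (h k : 'rV[R]_n -> R) : smoothR h -> smoothR k ->
    is_derive x 'e_j (fun z => h z * k z) (h x * pd j k x + k x * pd j h x).
  move=> sh sk; have dh := smoothR_derivable sh; have dk := smoothR_derivable sk.
  by split; [exact: derivableM|exact: deriveM].
apply: complexP; rewrite /partialC ?cReD ?cImD ?cReM ?cImM /=.
  under eq_fun do rewrite cReM.
  have D1 := D _ _ f1 g1; have D2 := D _ _ f2 g2.
  have [_ ->] := is_deriveB D1 D2; rewrite /pd; ring.
under eq_fun do rewrite cImM.
have D1 := D _ _ f1 g2; have D2 := D _ _ f2 g1.
have [_ ->] := is_deriveD D1 D2; rewrite /pd; ring.
Qed.

Lemma partialC_cst j (c : R[i]) : partialC j (fun _ : 'rV[R]_n => c) = fun=> 0.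
Proof. by apply/funext => x; apply: complexP; rewrite /partialC /= derive_cst. Qed.

Lemma partialC_scale j (c : R[i]) f : smooth f ->
  partialC j (fun x => c * f x) = fun x => c * partialC j f x.
Proof.
move=> sf; rewrite (partialC_mul j (smooth_cst c) sf).
by rewrite partialC_cst; apply/funext => x; rewrite mul0r add0r.
Qed.

Lemma partialC_real j (g : 'rV[R]_n -> R) :
  partialC j (fun x => (g x)%:C) = fun x => (pd j g x)%:C.
Proof. by apply/funext => x; apply: complexP; rewrite /partialC //= derive_cst. Qed.

Lemma smooth_partials (s : seq 'I_n) f : smooth f -> smooth (partialsC s f).
Proof. by move=> sf; elim: s => [|j s ih]; [exact: sf|exact: (smooth_partial j ih)]. Qed.

Lemma partialsC_add s f g : smooth f -> smooth g ->
  partialsC s (fun x => f x + g x) = fun x => partialsC s f x + partialsC s g x.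
Proof.
move=> sf sg; elim: s => [//|j s ih].
rewrite [LHS](congr1 (partialC j) ih).
exact: (partialC_add j (smooth_partials s sf) (smooth_partials s sg)).
Qed.

Lemma partialsC_scale s c f : smooth f ->
  partialsC s (fun x => c * f x) = fun x => c * partialsC s f x.
Proof.
move=> sf; elim: s => [//|j s ih].
rewrite [LHS](congr1 (partialC j) ih).
exact: (partialC_scale j c (smooth_partials s sf)).
Qed.

Lemma partialsC_rcons s j f : partialsC (rcons s j) f = partialsC s (partialC j f).
Proof. by rewrite /partialsC foldr_rcons. Qed.

Lemma apply_fun_smooth (P : diffop R n) f :
  smooth_coefficients P -> smooth f -> smooth (apply_fun P f).
Proof.
elim: P f => [a|j|P1 ih1 P2 ih2|P1 ih1 P2 ih2] f /=.
- exact: smooth_mul.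
- by move=> _; exact: smooth_partial.
- by move=> [s1 s2] sf; exact: (smooth_add (ih1 _ s1 sf) (ih2 _ s2 sf)).
- by move=> [s1 s2] sf; exact: (ih1 _ s1 (ih2 _ s2 sf)).
Qed.

Lemma supp0 f p : ~ supp f p -> f p = 0.
Proof.
move=> H; apply/eqP; apply: contrapT => /negP fp; apply: H; exact: subset_closure.
Qed.

Lemma supp_sub f (S : set 'rV[R]_n) : closed S -> (forall x, ~ S x -> f x = 0) -> supp f `<=` S.
Proof.
move=> cS H; rewrite /supp (closure_id S).1 //; apply: closure_subset => x /= fx.
by apply: contrapT => /H /eqP; rewrite (negbTE fx).
Qed.

Lemma supp_partial j f : supp (partialC j f) `<=` supp f.
Proof.
apply: supp_sub; first exact: closed_closure.
move=> x nx.
have ox : \forall y \near x, f y = 0.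
  have : open_nbhs x (~` supp f) by split => //; apply: closed_openC; exact: closed_closure.
  by move=> /open_nbhs_nbhs; apply: filterS => y; exact: supp0.
have v0 : ('e_j : 'rV[R]_n) != 0.
  by apply/eqP => /rowP/(_ j); rewrite !mxE !eqxx => /eqP; rewrite oner_eq0.
apply: complexP; rewrite /partialC /=.
  rewrite (@near_eq_derive _ _ _ _ (cst 0)) ?derive_cst //.
  by apply: filterS ox => y ->.
rewrite (@near_eq_derive _ _ _ _ (cst 0)) ?derive_cst //.
by apply: filterS ox => y ->.
Qed.

Lemma test_sub Om f g : test_function Om f -> smooth g -> supp g `<=` supp f -> test_function Om g.
Proof.
move=> [sf cf fO] sg gf; split => //; last exact: subset_trans fO.
by apply: subclosed_compact cf gf; exact: closed_closure.
Qed.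

Lemma test_partial Om j f : test_function Om f -> test_function Om (partialC j f).
Proof.
move=> tf; case: (tf) => sf _ _; exact: (test_sub tf (smooth_partial j sf) (@supp_partial j f)).
Qed.

Lemma test_mul Om a f : smooth a -> test_function Om f -> test_function Om (fun x => a x * f x).
Proof.
move=> sa tf; case: (tf) => sf _ _; apply: (test_sub tf); first exact: (smooth_mul sa sf).
by apply: supp_sub => [|x /supp0 ->]; [exact: closed_closure|rewrite mulr0].
Qed.

Lemma test_add Om f g : test_function Om f -> test_function Om g ->
  test_function Om (fun x => f x + g x).
Proof.
move=> [sf cf fO] [sg cg gO].
have H : supp (fun x => f x + g x) `<=` supp f `|` supp g.
  apply: supp_sub; first by apply: closedU; exact: closed_closure.
  by move=> x /not_orP[/supp0 -> /supp0 ->]; rewrite addr0.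
split; first exact: (smooth_add sf sg).
  apply: subclosed_compact H; first exact: closed_closure.
  exact: compactU.
by move=> x /H[/fO|/gO].
Qed.

Lemma test_zero Om : test_function Om (fun _ : 'rV[R]_n => 0 : R[i]).
Proof.
have S0 : supp (fun _ : 'rV[R]_n => 0 : R[i]) = set0.
  by apply/seteqP; split => //; apply: supp_sub => //; exact: closed0.
by split; rewrite ?S0 //; [exact: smooth_cst|exact: compact0].
Qed.

Lemma apply_fun_test Om (P : diffop R n) f :
  smooth_coefficients P -> test_function Om f -> test_function Om (apply_fun P f).
Proof.
elim: P f => [a|j|P1 ih1 P2 ih2|P1 ih1 P2 ih2] f /=.
- exact: test_mul.
- by move=> _; exact: test_partial.
- by move=> [s1 s2] sf; exact: (test_add (ih1 _ s1 sf) (ih2 _ s2 sf)).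
- by move=> [s1 s2] sf; exact: (ih1 _ s1 (ih2 _ s2 sf)).
Qed.

(** Formal transpose, with int (P f) phi = int f (tr P phi) in mind; what is used
    is [apply_distr_tr]. *)
Fixpoint tr (P : diffop R n) : diffop R n :=
  match P with
  | OpMul a => OpMul a
  | OpPartial j => OpComp (OpMul (fun=> -1)) (OpPartial j)
  | OpAdd P1 P2 => OpAdd (tr P1) (tr P2)
  | OpComp P1 P2 => OpComp (tr P2) (tr P1)
  end.

Lemma tr_smooth P : smooth_coefficients P -> smooth_coefficients (tr P).
Proof.
elim: P => [a|j|P1 ih1 P2 ih2|P1 ih1 P2 ih2] //=.
- by move=> _; split => //; exact: smooth_cst.
- by move=> [/ih1 ? /ih2 ?].
- by move=> [/ih1 ? /ih2 ?].
Qed.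

Definition lin_on Om (u : ('rV[R]_n -> R[i]) -> R[i]) :=
  forall (c : R[i]) phi psi, test_function Om phi -> test_function Om psi ->
     u (fun x => c * phi x + psi x) = c * u phi + u psi.

Lemma lin_on0 Om u : lin_on Om u -> u (fun=> 0) = 0.
Proof.
move=> H; have := H (-1) _ _ (test_zero Om) (test_zero Om).
under [X in u X = _]eq_fun do rewrite mulr0 addr0.
by rewrite mulN1r addNr.
Qed.
Lemma lin_on_scale Om u c phi : lin_on Om u -> test_function Om phi ->
  u (fun x => c * phi x) = c * u phi.
Proof.
move=> H tp; have := H c _ _ tp (test_zero Om).
by under [X in u X = _]eq_fun do rewrite addr0; rewrite (lin_on0 H) addr0.
Qed.
Lemma lin_on_add Om u phi psi : lin_on Om u -> test_function Om phi ->
  test_function Om psi -> u (fun x => phi x + psi x) = u phi + u psi.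
Proof.
move=> H tp ts; have := H 1 _ _ tp ts.
by under [X in u X = _]eq_fun do rewrite mul1r; rewrite mul1r.
Qed.

Lemma lin_on_distr Om P u : smooth_coefficients P -> lin_on Om u -> lin_on Om (apply_distr P u).
Proof.
elim: P u => [a|j|P1 ih1 P2 ih2|P1 ih1 P2 ih2] u /=.
- move=> sa lu c phi psi tp ts; rewrite -lu; [|exact: test_mul..].
  by congr u; apply/funext => x; rewrite mulrDr mulrCA.
- move=> _ lu c phi psi tp ts.
  have sp : smooth phi by case: tp.
  have ss : smooth psi by case: ts.
  rewrite (partialC_add j (smooth_mul (smooth_cst c) sp) ss) (partialC_scale j c sp).
  rewrite lu; [|exact: (test_partial j tp)|exact: (test_partial j ts)].
  by rewrite opprD mulrN.
- move=> [s1 s2] lu c phi psi tp ts; rewrite ih1 // ih2 //; ring.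
- by move=> [s1 s2] lu; apply: ih1 => //; exact: ih2.
Qed.

(** The action on distributions is by definition the transposed one, applied from
    the outside in; linearity of u is needed for sums and for the sign of derivatives. *)
Lemma apply_distr_tr Om P u phi : smooth_coefficients P -> lin_on Om u ->
  test_function Om phi -> apply_distr P u phi = u (apply_fun (tr P) phi).
Proof.
elim: P u phi => [a|j|P1 ih1 P2 ih2|P1 ih1 P2 ih2] u phi //=.
- move=> _ lu tp; rewrite (lin_on_scale _ lu) ?mulN1r //; exact: test_partial.
- move=> [s1 s2] lu tp; rewrite ih1 // ih2 // -(lin_on_add lu) //.
    by apply: apply_fun_test => //; exact: tr_smooth.
  by apply: apply_fun_test => //; exact: tr_smooth.
- move=> [s1 s2] lu tp; rewrite ih1 //; last exact: lin_on_distr.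
  by rewrite ih2 //; apply: apply_fun_test => //; exact: tr_smooth.
Qed.

End ComplexCalculus.

(** * Bounds on the C^k norms of test functions *)

Section CkNorm.
Variables (R : realType) (n : nat).
Implicit Types (f g a phi psi : 'rV[R]_n -> R[i]) (p q : 'rV[R]_n) (j : 'I_n) (Om : set 'rV[R]_n).
Local Notation normc := Normc.normc.
Local Notation Re := complex.Re.
Local Notation Im := complex.Im.

Lemma smooth_bounded f (M : R) : smooth f ->
  exists2 B, 0 <= B & forall p, `|p| <= M -> normc (f p) <= B.
Proof.
move=> /smoothE[s1 s2].
have [B1 B10 H1] := continuous_bounded M (smoothR_continuous s1).
have [B2 B20 H2] := continuous_bounded M (smoothR_continuous s2).
exists (B1 + B2) => [|p pM]; first exact: addr_ge0.
apply: le_trans (normc_le _) _; apply: lerD; [apply: H1 | apply: H2] => i;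
  exact: le_trans (rV_coord_norm _ _) pM.
Qed.

#[local] Opaque smooth.

Lemma test_bounded Om phi : test_function Om phi -> exists2 B, 0 <= B & forall p, normc (phi p) <= B.
Proof.
move=> [sp cp _].
have [M [_ HM]] := compact_bounded cp.
have [B B0 HB] := smooth_bounded (`|M| + 1) sp.
exists B => // p; have [ps|ps] := pselect (supp phi p); last by rewrite supp0 // Normc.normc0.
apply: HB; apply: HM ps; rewrite (le_lt_trans (ler_norm M)) // ltrDl //.
Qed.

Lemma test_partials_bounded Om (N : nat) phi : test_function Om phi ->
  exists2 B, 0 <= B & forall (s : seq 'I_n) p, (size s <= N)%N -> normc (partialsC s phi p) <= B.
Proof.
elim: N phi => [|N ih] phi tp.
  have [B B0 HB] := test_bounded tp; exists B => // s p.
  by rewrite leqn0 size_eq0 => /eqP ->; exact: HB.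
have [B0 B00 HB0] := test_bounded tp.
have H j : exists B : R, 0 <= B /\ forall (s : seq 'I_n) p, (size s <= N)%N ->
    normc (partialsC s (partialC j phi) p) <= B.
  by have [B B1 HB] := ih _ (test_partial j tp); exists B.
have /choice[B HB] := H.
exists (B0 + \sum_j B j).
  by rewrite addr_ge0 // sumr_ge0 // => j _; have [] := HB j.
move=> s p; case/lastP: s => [_|s j].
  rewrite (le_trans (HB0 p)) // lerDl sumr_ge0 // => j _; by have [] := HB j.
rewrite size_rcons ltnS partialsC_rcons => sN.
have [_ HBj] := HB j; apply: le_trans (HBj _ _ sN) _.
rewrite (bigD1 j) //= addrCA lerDl addr_ge0 // sumr_ge0 // => i _; by have [] := HB i.
Qed.

Lemma Ck_norm_has_sup Om N phi : test_function Om phi ->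
  has_sup [set r | exists (s : seq 'I_n) (x : 'rV[R]_n),
         (size s <= N)%N /\ r = normc (partialsC s phi x)].
Proof.
move=> tp; split; first by exists (normc (phi 0)); exists [::], 0.
have [B _ HB] := test_partials_bounded N tp.
by exists B => _ [s [x [sN ->]]]; exact: HB.
Qed.

Lemma Ck_norm_ub Om N phi (s : seq 'I_n) p : test_function Om phi -> (size s <= N)%N ->
  normc (partialsC s phi p) <= Ck_norm N phi.
Proof.
move=> tp sN; have [_ hu] := Ck_norm_has_sup N tp.
by apply: ub_le_sup => //; exists s, p.
Qed.

Lemma Ck_norm_le N phi (C : R) :
  (forall (s : seq 'I_n) p, (size s <= N)%N -> normc (partialsC s phi p) <= C) -> Ck_norm N phi <= C.
Proof.
move=> H; apply: ge_sup; first by exists (normc (phi 0)); exists [::], 0.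
by move=> _ [s [x [sN ->]]]; exact: H.
Qed.

Lemma Ck_norm_ge0 Om N phi : test_function Om phi -> 0 <= Ck_norm N phi.
Proof. by move=> tp; apply: le_trans (Ck_norm_ub (s := [::]) 0 tp _); rewrite ?normc_ge0. Qed.

Lemma Ck_norm_val Om N phi p : test_function Om phi -> normc (phi p) <= Ck_norm N phi.
Proof. by move=> tp; exact: (Ck_norm_ub (s := [::]) p tp). Qed.

Lemma Ck_norm_mono Om N N' phi : test_function Om phi -> (N <= N')%N -> Ck_norm N phi <= Ck_norm N' phi.
Proof.
by move=> tp NN; apply: Ck_norm_le => s p sN; apply: (Ck_norm_ub _ tp); exact: leq_trans NN.
Qed.

Lemma Ck_norm_add Om N phi psi : test_function Om phi -> test_function Om psi ->
  Ck_norm N (fun x => phi x + psi x) <= Ck_norm N phi + Ck_norm N psi.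
Proof.
move=> tp ts; have [sp _ _] := tp; have [ss _ _] := ts.
apply: Ck_norm_le => s p sN; rewrite (partialsC_add s sp ss).
apply: le_trans (le_normcD _ _) _.
exact: lerD (Ck_norm_ub _ tp sN) (Ck_norm_ub _ ts sN).
Qed.

Lemma Ck_norm_scale Om N c phi : test_function Om phi ->
  Ck_norm N (fun x => c * phi x) <= normc c * Ck_norm N phi.
Proof.
move=> tp; have [sp _ _] := tp.
apply: Ck_norm_le => s p sN; rewrite (partialsC_scale s c sp) Normc.normcM.
by rewrite ler_wpM2l ?normc_ge0 //; exact: (Ck_norm_ub _ tp sN).
Qed.

Lemma Ck_norm_partial Om N j phi : test_function Om phi ->
  Ck_norm N (partialC j phi) <= Ck_norm N.+1 phi.
Proof.
move=> tp; apply: Ck_norm_le => s p sN; rewrite -partialsC_rcons.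
by apply: (Ck_norm_ub _ tp); rewrite size_rcons.
Qed.

(** Outside of Om both sides vanish, so a bound on a over a ball containing Om
    suffices. *)
Lemma mul_val_le Om (M : R) a B phi p : (forall p, Om p -> `|p| <= M) -> 0 <= B ->
  (forall p, `|p| <= M -> normc (a p) <= B) -> test_function Om phi ->
  normc (a p * phi p) <= B * Ck_norm 0 phi.
Proof.
move=> OM B0 HB tp; have [ps|ps] := pselect (supp phi p); last first.
  by rewrite (supp0 ps) mulr0 Normc.normc0 mulr_ge0 // (Ck_norm_ge0 _ tp).
have [_ _ pO] := tp; rewrite Normc.normcM ler_pM ?normc_ge0 //; first exact/HB/OM/pO.
exact: (Ck_norm_val _ _ tp).
Qed.

(** Leibniz rule, one derivative at a time. *)
Lemma Ck_norm_mul Om (M : R) N a : (forall p, Om p -> `|p| <= M) -> smooth a ->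
  exists2 C, 0 <= C & forall phi, test_function Om phi ->
    Ck_norm N (fun x => a x * phi x) <= C * Ck_norm N phi.
Proof.
move=> OM; elim: N a => [|N ih] a sa; have [B B0 HB] := smooth_bounded M sa;
  have V phi p (tp : test_function Om phi) := mul_val_le p OM B0 HB tp.
  exists B => // phi tp; apply: Ck_norm_le => s p.
  by rewrite leqn0 size_eq0 => /eqP ->; exact: V.
have [C1 C10 H1] := ih a sa.
have H j : exists C : R, 0 <= C /\ forall phi, test_function Om phi ->
    Ck_norm N (fun x => partialC j a x * phi x) <= C * Ck_norm N phi.
  by have [C C0 HC] := ih _ (smooth_partial j sa); exists C.
have /choice[C HC] := H.
have S0 : 0 <= \sum_j C j by apply: sumr_ge0 => j _; have [] := HC j.
exists (B + C1 + \sum_j C j) => [|phi tp]; first by rewrite !addr_ge0.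
have [sp _ _] := tp.
have N0 := Ck_norm_ge0 N.+1 tp.
apply: Ck_norm_le => s p; case/lastP: s => [_|s j].
  apply: le_trans (V _ _ tp) _; rewrite -addrA ler_pM //; first exact: (Ck_norm_ge0 _ tp).
    by rewrite lerDl addr_ge0.
  exact: (Ck_norm_mono tp).
rewrite size_rcons ltnS partialsC_rcons => sN.
rewrite (partialC_mul j sa sp) partialsC_add; last first.
- exact: (smooth_mul sa (smooth_partial j sp)).
- exact: (smooth_mul (smooth_partial j sa) sp).
apply: le_trans (le_normcD _ _) _.
have T1 := test_mul (smooth_partial j sa) tp.
have T2 := test_mul sa (test_partial j tp).
apply: le_trans (lerD (Ck_norm_ub p T1 sN) (Ck_norm_ub p T2 sN)) _.
have [Cj0 HCj] := HC j.
apply: le_trans (lerD (HCj _ tp) (H1 _ (test_partial j tp))) _.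
apply: (@le_trans _ _ (C j * Ck_norm N.+1 phi + C1 * Ck_norm N.+1 phi)).
  apply: lerD; apply: ler_wpM2l => //; first exact: (Ck_norm_mono tp).
  exact: (Ck_norm_partial _ _ tp).
rewrite -mulrDl ler_wpM2r // addrC lerD // ?lerDr //.
by rewrite (bigD1 j) //= lerDl sumr_ge0 // => i _; have [] := HC i.
Qed.

(** Continuity of differential operators for the C^k norms, with loss of as many
    derivatives as there are in P. *)
Lemma Ck_norm_apply Om (M : R) (P : diffop R n) : (forall p, Om p -> `|p| <= M) ->
  smooth_coefficients P -> forall k, exists N, exists2 C, 0 <= C &
  forall phi, test_function Om phi -> Ck_norm k (apply_fun P phi) <= C * Ck_norm N phi.
Proof.
move=> OM; elim: P => [a|j|P1 ih1 P2 ih2|P1 ih1 P2 ih2] /=.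
- by move=> sa k; exists k; exact: (Ck_norm_mul k OM sa).
- by move=> _ k; exists k.+1; exists 1 => // phi tp; rewrite mul1r; exact: (Ck_norm_partial _ _ tp).
- move=> [s1 s2] k; have [N1 [C1 C10 H1]] := ih1 s1 k; have [N2 [C2 C20 H2]] := ih2 s2 k.
  exists (maxn N1 N2), (C1 + C2) => [|phi tp]; first exact: addr_ge0.
  apply: le_trans (Ck_norm_add _ (apply_fun_test s1 tp) (apply_fun_test s2 tp)) _.
  rewrite mulrDl; apply: lerD.
    apply: le_trans (H1 _ tp) _; apply: ler_wpM2l => //.
    by apply: (Ck_norm_mono tp); exact: leq_maxl.
  apply: le_trans (H2 _ tp) _; apply: ler_wpM2l => //.
  by apply: (Ck_norm_mono tp); exact: leq_maxr.
- move=> [s1 s2] k; have [N1 [C1 C10 H1]] := ih1 s1 k; have [N2 [C2 C20 H2]] := ih2 s2 N1.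
  exists N2, (C1 * C2) => [|phi tp]; first exact: mulr_ge0.
  apply: le_trans (H1 _ (apply_fun_test s2 tp)) _.
  by rewrite -mulrA; apply: ler_wpM2l => //; exact: H2.
Qed.

End CkNorm.

(** * The Hahn-Banach theorem *)

Section HahnBanach.
Variables (R : realType) (V : lmodType R).
Variables (W : V -> Prop) (p : V -> R).
Hypothesis W0 : W 0.
Hypothesis Wlin : forall (c : R) x y, W x -> W y -> W (c *: x + y).
Hypothesis p_add : forall x y, W x -> W y -> p (x + y) <= p x + p y.
Hypothesis p_scale : forall (c : R) x, 0 <= c -> W x -> p (c *: x) <= c * p x.

(** Partial linear functionals are handled as graphs, so that the union of a chain
    of extensions is again one. *)
Definition graph_lin (G : set (V * R)) :=
  [/\ G (0, 0),
      forall c x y, G x -> G y -> G (c *: x.1 + y.1, c * x.2 + y.2) &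
      forall x, G x -> W x.1 /\ x.2 <= p x.1].

Lemma graph_fun G x a b : graph_lin G -> G (x, a) -> G (x, b) -> a = b.
Proof.
move=> [G0 Gl Gp] Ga Gb.
have p0 : p 0 <= 0 by have := p_scale (lexx 0) W0; rewrite scale0r mul0r.
have H c d : G (x, c) -> G (x, d) -> c <= d.
  move=> Gc Gd; have := Gl (-1) _ _ Gd Gc => /Gp /=.
  by rewrite scaleN1r addNr mulN1r addrC => -[_ h]; rewrite -subr_le0; exact: le_trans p0.
by apply/eqP; rewrite eq_le !H.
Qed.

(** The one-step extension: with g the functional to be extended, its value at v must lie
    between the numbers g x - p (x - v) and p (y + v) - g y, which are ordered by
    subadditivity. *)
Lemma graph_extend G v : graph_lin G -> W v -> exists a, forall x, G x -> forall c : R,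
  x.2 + c * a <= p (x.1 + c *: v).
Proof.
move=> [G0 Gl Gp] Wv.
have Wx x : G x -> W x.1 by move=> /Gp[].
have Wxv x : W x -> W (x - v).
  move=> wx; rewrite addrC -scaleN1r; exact: Wlin.
have Wxv' x : W x -> W (x + v).
  move=> wx; rewrite addrC -{1}(scale1r v); exact: Wlin.
pose A := [set r | exists2 x, G x & r = x.2 - p (x.1 - v)].
have key x y : G x -> G y -> x.2 - p (x.1 - v) <= p (y.1 + v) - y.2.
  move=> Gx Gy; have := Gl 1 _ _ Gx Gy => /Gp[] /=; rewrite scale1r mul1r => _ h.
  rewrite lerBlDr addrAC lerBrDr (le_trans h) //.
  have -> : x.1 + y.1 = (y.1 + v) + (x.1 - v) by rewrite addrC addrACA subrr addr0.
  by apply: p_add; [exact/Wxv'/Wx|exact/Wxv/Wx].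
have A0 : A !=set0 by exists (0 - p (0 - v)); exists (0, 0).
have ubA y : G y -> ubound A (p (y.1 + v) - y.2) by move=> Gy _ [x Gx ->]; exact: key.
have hA : has_sup A by split => //; exists (p (0 + v) - 0); exact: (ubA (0, 0)).
(* any number between sup A and the infimum of p (y + v) - g y would do *)
pose a := sup A.
have H1 x : G x -> x.2 - a <= p (x.1 - v).
  move=> Gx; rewrite lerBlDr -lerBlDl; apply: ub_le_sup; first by case: hA.
  by exists x.
have H2 y : G y -> y.2 + a <= p (y.1 + v).
  move=> Gy; rewrite addrC -lerBrDr; apply: ge_sup => //; exact: ubA.
have sc x c : G x -> G (c *: x.1, c * x.2).
  by move=> Gx; have := Gl c _ _ Gx G0; rewrite /= !addr0.
have psc d x : 0 < d -> W x -> d * p x <= p (d *: x).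
  move=> d0 wx; have wd : W (d *: x) by rewrite -[d *: x]addr0; exact: Wlin.
  have d1 : 0 <= d^-1 by rewrite invr_ge0 ltW.
  rewrite -ler_pdivlMl // (le_trans _ (p_scale d1 wd)) //.
  by rewrite scalerA mulVf ?gt_eqF // scale1r.
exists a => x Gx c; have [c0|c0|->] := ltgtP c 0; last first.
- by rewrite mul0r scale0r !addr0; case: (Gp _ Gx).
- have -> : x.2 + c * a = c * (c^-1 * x.2 + a) by rewrite mulrDr mulVKf ?gt_eqF.
  have -> : x.1 + c *: v = c *: (c^-1 *: x.1 + v).
    by rewrite scalerDr scalerA divff ?gt_eqF // scale1r.
  apply: le_trans (psc _ _ c0 _); last exact/Wxv'/(Wx _ (sc _ _ Gx)).
  rewrite ler_pM2l //; exact: (H2 _ (sc _ c^-1 Gx)).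
- have d0 : 0 < - c by rewrite oppr_gt0.
  have -> : x.2 + c * a = - c * ((- c)^-1 * x.2 - a).
    by rewrite mulrBr mulVKf ?gt_eqF // mulNr opprK.
  have -> : x.1 + c *: v = (- c) *: ((- c)^-1 *: x.1 - v).
    by rewrite scalerBr scalerA divff ?gt_eqF // scale1r scaleNr opprK.
  apply: le_trans (psc _ _ d0 _); last exact/Wxv/(Wx _ (sc _ _ Gx)).
  rewrite ler_pM2l //; exact: (H1 _ (sc _ (- c)^-1 Gx)).
Qed.

(** By [graph_extend], a maximal graph below p has a value at every point of W; the
    functional is 0 off W, where nothing is known about p. *)
Lemma hahn_banach (G0 : set (V * R)) : graph_lin G0 ->
  exists F : V -> R, [/\ forall c x y, W x -> W y -> F (c *: x + y) = c * F x + F y,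
    forall x, W x -> F x <= p x & forall x, G0 x -> F x.1 = x.2].
Proof.
move=> gG0.
(* Zorn on sets A with A `|` G0 a graph, so that the empty chain is bounded *)
pose P (A : set (V * R)) := graph_lin (A `|` G0).
have chain (C : set (set (V * R))) : C `<=` P -> total_on C subset -> P (\bigcup_(X in C) X).
  move=> CP tC.
  have two x y : ((\bigcup_(X in C) X) `|` G0) x -> ((\bigcup_(X in C) X) `|` G0) y ->
      exists X, [/\ graph_lin (X `|` G0), (X `|` G0) x, (X `|` G0) y &
                 X `<=` \bigcup_(X in C) X].
    move=> [[X CX Xx]|Gx] [[Y CY Yy]|Gy].
    - have [XY|YX] := tC _ _ CX CY.
        by exists Y; split; [exact: CP|left; exact: XY|left|exact: bigcup_sup].
      by exists X; split; [exact: CP|left|left; exact: YX|exact: bigcup_sup].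
    - by exists X; split; [exact: CP|left|right|exact: bigcup_sup].
    - by exists Y; split; [exact: CP|right|left|exact: bigcup_sup].
    - by exists set0; split; [rewrite set0U|right|right|exact: sub0set].
  split; first by right; case: gG0.
    move=> c x y Ux Uy; have [X [[_ Xl _] Xx Xy XU]] := two _ _ Ux Uy.
    by case: (Xl c _ _ Xx Xy) => [/XU|]; [left|right].
  move=> x Ux; have [X [[_ _ Xp] Xx _ _]] := two _ _ Ux Ux; exact: Xp.
have [A [PA maxA]] := Zorn_bigcup chain.
pose G := A `|` G0.
have dom v : W v -> exists r, G (v, r).
  move=> Wv; apply: contrapT => nv.
  have [a Ha] := graph_extend PA Wv; have [GG0 GGl GGp] := PA.
  pose G' := [set z | exists x c, G x /\ z = (x.1 + c *: v, x.2 + c * a)].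
  have GG' : G `<=` G'.
    by move=> [x r] Gx; exists (x, r), 0; split => //=; rewrite scale0r mul0r !addr0.
  have gG' : graph_lin G'.
    split; first exact: GG'.
      move=> c _ _ [x [c1 [Gx ->]]] [y [c2 [Gy ->]]] /=.
      exists (c *: x.1 + y.1, c * x.2 + y.2), (c * c1 + c2); split; first exact: GGl.
      by congr (_, _) => /=; [rewrite scalerDr scalerDl scalerA addrACA|ring].
    move=> _ [x [c [Gx ->]]] /=; split; last exact: Ha.
    by rewrite addrC; apply: Wlin => //; case: (GGp _ Gx).
  apply: (maxA G'); last first.
    rewrite /P (_ : G' `|` G0 = G') //; apply/seteqP; split; last by left.
    by move=> x [//|G0x]; apply: GG'; right.
  split; first by move=> x Ax; apply: GG'; left.
  move=> G'A; apply: nv; exists a; left; apply: G'A.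
  by exists (0, 0), 1; split => //=; rewrite scale1r mul1r !add0r.
pose F x := xget 0 [set r | G (x, r)].
have GF x : W x -> G (x, F x).
  by move=> /dom[r Gr]; exact: (@xgetPex _ 0 [set r | G (x, r)] (ex_intro _ r Gr)).
have [_ Gl Gp] := PA.
have FE x r : G (x, r) -> F x = r.
  by move=> Gx; apply: (graph_fun PA _ Gx); apply: GF; case: (Gp _ Gx).
exists F; split.
- move=> c x y Wx Wy; apply: FE; exact: (Gl c _ _ (GF _ Wx) (GF _ Wy)).
- by move=> x Wx; case: (Gp _ (GF _ Wx)).
- by move=> [x r] Gx; apply: FE; right.
Qed.

End HahnBanach.

(** * Integrals over segments and iterated integrals *)

Section SegmentIntegral.
Variable R : realType.
Notation mu := (@lebesgue_measure R).
Implicit Types (F G : R -> R) (a b : R).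

Lemma seg_integrable F a b : continuous F -> mu.-integrable `[a, b]%classic (EFin \o F).
Proof.
move=> cF; apply: continuous_compact_integrable; first exact: segment_compact.
exact: continuous_subspaceT.
Qed.

Lemma seg_intD F G a b : continuous F -> continuous G ->
  \int[mu]_(t in `[a, b]) (F t + G t) = \int[mu]_(t in `[a, b]) F t + \int[mu]_(t in `[a, b]) G t.
Proof.
move=> cF cG; apply: RintegralD; [exact: measurable_itv|exact: seg_integrable|exact: seg_integrable].
Qed.

Lemma seg_intZ (c : R) F a b : continuous F ->
  \int[mu]_(t in `[a, b]) (c * F t) = c * \int[mu]_(t in `[a, b]) F t.
Proof. by move=> cF; apply: RintegralZl; [exact: measurable_itv|exact: seg_integrable]. Qed.

Lemma seg_int_cst (c : R) a b : a <= b -> \int[mu]_(t in `[a, b]) c = c * (b - a).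
Proof.
move=> ab; rewrite Rintegral_cst; last exact: measurable_itv.
suff E : mu `[a, b]%classic = (b - a)%:E by congr (c * _); exact: (congr1 fine E).
apply: etrans (lebesgue_measure_itv _) _; rewrite /= lte_fin.
case: ltP => [//|ba]; suff -> : a = b by rewrite subrr.
by apply/eqP; rewrite eq_le ab.
Qed.

Lemma seg_int_le F G a b : continuous F -> continuous G ->
  (forall t, a <= t <= b -> F t <= G t) ->
  \int[mu]_(t in `[a, b]) F t <= \int[mu]_(t in `[a, b]) G t.
Proof.
move=> cF cG FG; apply: le_Rintegral; [exact: measurable_itv|exact: seg_integrable..|].
by move=> t /=; rewrite in_itv /=; exact: FG.
Qed.

Lemma seg_int_bound F a b S : a <= b -> continuous F -> (forall t, a <= t <= b -> `|F t| <= S) ->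
  `|\int[mu]_(t in `[a, b]) F t| <= S * (b - a).
Proof.
move=> ab cF FS; rewrite -seg_int_cst // ler_norml; apply/andP; split; last first.
  by apply: seg_int_le => [//||t /FS]; [exact: cst_continuous|rewrite ler_norml => /andP[]].
rewrite -mulN1r -seg_intZ; last exact: cst_continuous.
apply: seg_int_le => [||t /FS]; [exact: cst_continuous|exact: cF|].
by rewrite mulN1r ler_norml => /andP[].
Qed.

Lemma eq_seg_int F G a b : (forall t, a <= t <= b -> F t = G t) ->
  \int[mu]_(t in `[a, b]) F t = \int[mu]_(t in `[a, b]) G t.
Proof. by move=> FG; apply: eq_Rintegral => t; rewrite inE /= in_itv /=; exact: FG. Qed.

Lemma lip_continuous F B : (forall s t, `|F t - F s| <= B * `|t - s|) -> continuous F.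
Proof.
move=> H x; apply/cvgrPdist_lt => e e0.
have B1 : 0 < `|B| + 1 by rewrite ltr_wpDl.
near=> t; rewrite (le_lt_trans (H _ _)) //.
apply: (@le_lt_trans _ _ ((`|B| + 1) * `|x - t|)).
  by rewrite ler_wpM2r // (le_trans (ler_norm B)) // lerDl.
rewrite mulrC -ltr_pdivlMr //; near: t.
by apply/nbhs_ballP; exists (e / (`|B| + 1)) => //=; exact: divr_gt0.
Unshelve. all: by end_near. Qed.

Lemma line_int_seg F M : (forall t, M < `|t| -> F t = 0) ->
  \int[mu]_t F t = \int[mu]_(t in `[- M, M]) F t.
Proof.
move=> F0; rewrite [RHS]Rintegral_mkcond; congr (Rintegral _ _ _); apply/funext => t.
rewrite patchE; case: ifPn => // /negP nt; apply: F0; rewrite ltNge; apply/negP => tM.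
by apply: nt; rewrite inE /= in_itv /= -ler_norml.
Qed.

End SegmentIntegral.

Section IteratedIntegral.
Variable R : realType.
Notation mu := (@lebesgue_measure R).

(** The class of integrands for which iterated integrals are handled: it is stable
    under slicing, which is what an induction on the dimension needs. *)
Definition lip_box n (M : R) (g : 'rV[R]_n -> R) :=
  (exists B, forall p q, `|g q - g p| <= B * `|q - p|) /\
  (forall (p : 'rV[R]_n) i, M < `|p ord0 i| -> g p = 0).

Lemma lip_box_lin n M c (g h : 'rV[R]_n -> R) : lip_box M g -> lip_box M h ->
  lip_box M (fun x => c * g x + h x).
Proof.
move=> [[B1 H1] g0] [[B2 H2] h0]; split; last by move=> p i pM; rewrite (g0 _ i) // (h0 _ i) // mulr0 addr0.
exists (`|c| * B1 + B2) => p q.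
have -> : c * g q + h q - (c * g p + h p) = c * (g q - g p) + (h q - h p) by ring.
apply: le_trans (ler_normD _ _) _; rewrite mulrDl -mulrA normrM; apply: lerD => //.
by rewrite ler_wpM2l.
Qed.

Lemma row_mx_coord n (t : R) (y : 'rV[R]_n) i :
  (row_mx t%:M y : 'rV[R]_(1 + n)) ord0 i = if fintype.split i is inr j then y ord0 j else t.
Proof. by rewrite mxE; case: fintype.split => j //; rewrite (ord1 j) mxE eqxx mulr1n. Qed.

Lemma lip_box_slice n M t (g : 'rV[R]_(1 + n) -> R) : lip_box M g ->
  lip_box M (fun y => g (row_mx t%:M y)).
Proof.
move=> [[B H] g0]; split; last first.
  by move=> p i pM; apply: (g0 _ (rshift 1 i)); rewrite row_mx_coord (unsplitK (inr i)).
exists `|B| => p q; apply: le_trans (H _ _) _.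
apply: (@le_trans _ _ (`|B| * `|(row_mx t%:M q : 'rV[R]_(1 + n)) - row_mx t%:M p|)).
  by rewrite ler_wpM2r // ler_norm.
rewrite ler_wpM2l //; apply: rV_norm_le => // i.
rewrite !mxE; case: fintype.split => j; first by rewrite subrr normr0.
by have := rV_coord_norm (q - p) j; rewrite !mxE.
Qed.

(** Linearity and the sup bound are proved together, since integrability of the
    outer integrand (its Lipschitz continuity) needs both for the inner integral. *)
Lemma integral_rV_facts n (M : R) : 0 <= M ->
  (forall c (g h : 'rV[R]_n -> R), lip_box M g -> lip_box M h ->
     integral_rV (fun x => c * g x + h x) = c * integral_rV g + integral_rV h) /\
  (forall (g : 'rV[R]_n -> R) S, lip_box M g -> (forall x, `|g x| <= S) ->
     `|integral_rV g| <= S * (M + M) ^+ n).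
Proof.
move=> M0; elim: n => [|n [ihl ihb]].
  by split => [c g h _ _ //|g S _ gS]; rewrite expr0 mulr1; exact: gS.
pose J (g : 'rV[R]_(1 + n) -> R) t := integral_rV (fun y : 'rV[R]_n => g (row_mx t%:M y)).
have Jc g : lip_box M g -> continuous (J g).
  move=> lg; have [[B H] g0] := lg; apply: (@lip_continuous _ _ (`|B| * (M + M) ^+ n)) => s t.
  have ls := lip_box_slice s lg; have lt := lip_box_slice t lg.
  have -> : J g t - J g s = integral_rV (fun y : 'rV[R]_n => (-1) * g (row_mx s%:M y) + g (row_mx t%:M y)).
    by rewrite ihl // mulN1r addrC.
  rewrite mulrAC; apply: ihb => [|x]; first exact: lip_box_lin.
  rewrite mulN1r addrC (le_trans (H _ _)) //.
  apply: (@le_trans _ _ (`|B| * `|(row_mx t%:M x : 'rV[R]_(1 + n)) - row_mx s%:M x|)).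
    by rewrite ler_wpM2r // ler_norm.
  rewrite ler_wpM2l //; apply: rV_norm_le => // i.
  by rewrite !mxE; case: fintype.split => j; rewrite ?subrr ?normr0 // !mxE (ord1 j) eqxx !mulr1n.
have J0 g : lip_box M g -> forall t, M < `|t| -> J g t = 0.
  move=> lg t tM; have [_ g0] := lg.
  suff H : forall y : 'rV[R]_n, `|g (row_mx t%:M y)| <= 0.
    by have := ihb _ 0 (lip_box_slice t lg) H; rewrite mul0r normr_le0 => /eqP.
  move=> y; rewrite (g0 _ (lshift n (ord0 : 'I_1))) ?normr0 //.
  by rewrite row_mx_coord (unsplitK (inl ord0)).
have E g : lip_box M g -> integral_rV g = \int[mu]_(t in `[- M, M]) J g t.
  by move=> lg; rewrite -(line_int_seg (J0 _ lg)).
split=> [c g h lg lh|g S lg gS].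
  rewrite !E //; last exact: lip_box_lin.
  rewrite -seg_intZ; last exact: Jc.
  rewrite -seg_intD; [|by move=> x; apply: cvgMl_tmp; exact: Jc|exact: Jc].
  by apply: eq_seg_int => t _; rewrite /J ihl //; exact: lip_box_slice.
have JS t : - M <= t <= M -> `|J g t| <= S * (M + M) ^+ n.
  by move=> _; apply: ihb => [|y]; [exact: lip_box_slice|exact: gS].
have MM : - M <= M by rewrite (le_trans (y := 0)) // oppr_le0.
have := seg_int_bound MM (Jc _ lg) JS; rewrite E // exprSr mulrA opprK; exact.
Qed.

End IteratedIntegral.

(** * Solvability from an a-priori estimate for the transpose *)

Section Solvability.
Variables (R : realType) (n : nat).
Local Notation normc := Normc.normc.
Local Notation Re := complex.Re.
Local Notation Im := complex.Im.
Implicit Types (f phi psi : 'rV[R]_n -> R[i]) (Om : set 'rV[R]_n).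

Lemma test_outside Om (M : R) phi (p : 'rV[R]_n) i : (forall p, Om p -> `|p| <= M) -> test_function Om phi ->
  M < `|p ord0 i| -> phi p = 0.
Proof.
move=> OM [_ _ pO] Mp; apply: supp0 => /pO /OM pM.
by have := le_lt_trans (le_trans (rV_coord_norm p i) pM) Mp; rewrite ltxx.
Qed.

Lemma compact_smooth_lip (M : R) (g : 'rV[R]_n -> R) : 0 <= M -> smoothR g ->
  (forall (p : 'rV[R]_n) i, M < `|p ord0 i| -> g p = 0) -> lip_box M g.
Proof.
move=> M0 sg g0; split=> //.
have [B B0 HB] := smoothR_lip (M + 1) sg.
have [S S0 HS] := continuous_bounded M (smoothR_continuous sg).
have gS p : `|g p| <= S.
  have [pM|] := pselect (forall i, `|p ord0 i| <= M); first exact: HS.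
  by move=> /existsNP[i /negP]; rewrite -ltNge => /g0 ->; rewrite normr0.
have g1 p : M < `|p| -> g p = 0.
  move=> Mp; have [pM|] := pselect (forall i, `|p ord0 i| <= M).
    by have := lt_le_trans Mp (rV_norm_le M0 pM); rewrite ltxx.
  by move=> /existsNP[i /negP]; rewrite -ltNge => /g0 ->.
exists (B + S) => p q.
wlog pq : p q / `|p| <= `|q|.
  move=> W; have [h|h] := orP (le_total `|p| `|q|); first exact: W.
  by rewrite distrC (distrC q); exact: W.
have BS : B * `|q - p| <= (B + S) * `|q - p| by rewrite ler_wpM2r // lerDl.
have [qM|qM] := leP `|q| (M + 1).
  by apply: le_trans BS; apply: HB => //; exact: le_trans qM.
rewrite (g1 q); last by rewrite (lt_trans _ qM) // ltrDl.
rewrite sub0r normrN; have [pM|pM] := ltP M `|p|.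
  by rewrite g1 // normr0 mulr_ge0 // addr_ge0.
apply: le_trans (gS p) _; rewrite -[leLHS]mulr1 ler_pM // ?lerDr //.
have := lerB_dist q p; apply: le_trans; rewrite lerBrDl (le_trans _ (ltW qM)) //.
by rewrite addrC [leRHS]addrC lerD2l.
Qed.

Lemma test_lip Om (M : R) phi : 0 <= M -> (forall p, Om p -> `|p| <= M) -> test_function Om phi ->
  lip_box M (fun x => Re (phi x)) /\ lip_box M (fun x => Im (phi x)).
Proof.
move=> M0 OM tp; have [/smoothE[s1 s2] _ _] := tp.
by split; apply: compact_smooth_lip => // p i Mp; rewrite (test_outside OM tp Mp).
Qed.

Lemma integralC_lin Om (M : R) (c : R[i]) phi psi : 0 <= M -> (forall p, Om p -> `|p| <= M) ->
  test_function Om phi -> test_function Om psi ->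
  integralC (fun x => c * phi x + psi x) = c * integralC phi + integralC psi.
Proof.
move=> M0 OM tp ts.
have [p1 p2] := test_lip M0 OM tp; have [s1 s2] := test_lip M0 OM ts.
have [lin _] := integral_rV_facts n M0.
apply: complexP; rewrite /integralC ?cReD ?cImD ?cReM ?cImM /=.
  have -> : (fun x => Re (c * phi x + psi x)) =
    (fun x => Re c * Re (phi x) + ((- Im c) * Im (phi x) + Re (psi x))).
    by apply/funext => x; rewrite cReD cReM; ring.
  rewrite lin // ?lin //; first by ring.
  exact: lip_box_lin.
have -> : (fun x => Im (c * phi x + psi x)) =
    (fun x => Re c * Im (phi x) + (Im c * Re (phi x) + Im (psi x))).
  by apply/funext => x; rewrite cImD cImM; ring.
rewrite lin // ?lin //; first by ring.
exact: lip_box_lin.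
Qed.

Lemma integralC_bound Om (M : R) phi (S : R) : 0 <= M -> (forall p, Om p -> `|p| <= M) ->
  test_function Om phi -> (forall p, normc (phi p) <= S) ->
  normc (integralC phi) <= 2 * S * (M + M) ^+ n.
Proof.
move=> M0 OM tp pS; have [p1 p2] := test_lip M0 OM tp.
have [_ bd] := integral_rV_facts n M0.
rewrite (le_trans (normc_le _)) // -mulrA mulr2n mulrDl mul1r.
by apply: lerD; apply: bd => // x; rewrite (le_trans _ (pS x)) // ?normc_Re ?normc_Im.
Qed.

(** The estimate makes T phi |-> int f phi well defined and bounded by a C^N norm on
    the range of the transpose T.  A Hahn-Banach extension u to all test functions
    satisfies u (T phi) = int f phi, which is L u = f. *)
Lemma solvable_of_estimate (L : diffop R n) Om (M C : R) N :
  smooth_coefficients L -> 0 <= M -> (forall p, Om p -> `|p| <= M) -> 0 <= C ->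
  (forall phi p, test_function Om phi -> normc (phi p) <= C * Ck_norm N (apply_fun (tr L) phi)) ->
  forall f, test_function Om f ->
      exists u, is_distribution Om u /\
        forall phi, test_function Om phi ->
          apply_distr L u phi = integralC (fun x => f x * phi x).
Proof.
move=> sL M0 OM C0 est f tf.
have stL := tr_smooth sL.
have [sf _ _] := tf.
pose T := apply_fun (tr L).
have TT phi : test_function Om phi -> test_function Om (T phi).
  by move=> tp; exact: (apply_fun_test stL tp).
have Tlin c phi psi : smooth phi -> smooth psi ->
   T (fun x => c * phi x + psi x) = fun x => c * T phi x + T psi x.
  rewrite /T; elim: (tr L) stL phi psi => [a|j|P1 ih1 P2 ih2|P1 ih1 P2 ih2] /=.
  - by move=> _ phi psi _ _; apply/funext => x; ring.
  - move=> _ phi psi sp ss.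
    by rewrite (partialC_add j (smooth_mul (smooth_cst c) sp) ss) (partialC_scale j c sp).
  - move=> [s1 s2] phi psi sp ss; rewrite (ih1 s1 _ _ sp ss) (ih2 s2 _ _ sp ss).
    by apply/funext => x; ring.
  - move=> [s1 s2] phi psi sp ss; rewrite (ih2 s2 _ _ sp ss).
    exact: (ih1 s1 _ _ (apply_fun_smooth s2 sp) (apply_fun_smooth s2 ss)).
have T0 : T (fun=> 0) = fun=> 0.
  have := Tlin (-1) _ _ (smooth_cst 0) (smooth_cst 0).
  have -> : (fun _ : 'rV[R]_n => -1 * (0 : R[i]) + 0) = fun=> 0.
    by apply/funext => x; rewrite mulr0 addr0.
  move=> h; apply/funext => x; have := congr1 (fun g => g x) h => /= ->.
  by rewrite mulN1r addNr.
have [S S0 fS] := test_bounded tf.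
pose K := 2 * S * C * (M + M) ^+ n.
have K0 : 0 <= K by rewrite !mulr_ge0 // exprn_ge0 // addr_ge0.
have ftest phi : test_function Om phi -> test_function Om (fun x => f x * phi x).
  by move=> tp; exact: (test_mul sf tp).
have Ibd phi : test_function Om phi ->
    normc (integralC (fun x => f x * phi x)) <= K * Ck_norm N (T phi).
  move=> tp; have -> : K * Ck_norm N (T phi) = 2 * (S * (C * Ck_norm N (T phi))) * (M + M) ^+ n.
    by rewrite /K; ring.
  apply: (integralC_bound M0 OM (ftest _ tp)) => p.
  by rewrite Normc.normcM ler_pM ?normc_ge0 //; exact: est.
have Ilin c phi psi : test_function Om phi -> test_function Om psi ->
    integralC (fun x => f x * (c * phi x + psi x)) =
    c * integralC (fun x => f x * phi x) + integralC (fun x => f x * psi x).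
  move=> tp ts; rewrite -(integralC_lin c M0 OM (ftest _ tp) (ftest _ ts)).
  by congr integralC; apply/funext => x; ring.
(* Hahn-Banach is applied to the real part of the functional, on the real vector
   space of all complex functions; the sublinear bound holds on test functions *)
pose V : lmodType R := ('rV[R]_n -> Rcomplex R)%type.
have scE (c : R) (x : V) : c *: x = (fun p => c%:C * (x p : R[i])) :> V.
  by apply/funext => p /=; rewrite /GRing.scale /=; case: (x p) => a b /=;
     apply: complexP; rewrite /= ?mul0r ?subr0 ?addr0.
pose p (x : V) : R := K * Ck_norm N (x : 'rV[R]_n -> R[i]).
pose W (x : V) := test_function Om (x : 'rV[R]_n -> R[i]).
have W0 : W 0 by exact: (@test_zero R n Om).
have Wl (c : R) x y : W x -> W y -> W (c *: x + y).
  move=> Wx Wy; rewrite scE; exact: (test_add (test_mul (smooth_cst c%:C) Wx) Wy).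
have pD x y : W x -> W y -> p (x + y) <= p x + p y.
  by move=> Wx Wy; rewrite /p -mulrDr ler_wpM2l //; exact: (Ck_norm_add _ Wx Wy).
have pZ (c : R) x : 0 <= c -> W x -> p (c *: x) <= c * p x.
  move=> c0 Wx; rewrite /p mulrCA ler_wpM2l // scE.
  apply: le_trans (Ck_norm_scale _ _ Wx) _.
  by rewrite normc_real ger0_norm.
pose G0 : set (V * R) := [set z | exists2 phi, test_function Om phi &
   z = (T phi : V, Re (integralC (fun x => f x * phi x)))].
have gG0 : graph_lin W p G0.
  split.
  - exists (fun=> 0); first exact: test_zero.
    rewrite T0; congr pair.
    have := Ilin (-1) _ _ (test_zero Om) (test_zero Om).
    have -> : (fun x => f x * (-1 * 0 + 0)) = (fun x => f x * 0).
      by apply/funext => x; rewrite mulr0 addr0.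
    by move=> ->; rewrite mulN1r addNr.
  - move=> c _ _ [phi tp ->] [psi ts ->] /=.
    exists (fun x => c%:C * phi x + psi x); first exact: (test_add (test_mul (smooth_cst c%:C) tp) ts).
    have [sp _ _] := tp; have [ss _ _] := ts.
    by rewrite Tlin // Ilin // scE cReD cReM /= mul0r subr0.
  - move=> _ [phi tp ->] /=; split; first exact: TT.
    have h := normc_Re (integralC (fun x => f x * phi x)).
    exact: le_trans (le_trans (ler_norm _) h) (Ibd _ tp).
have [F [Fl Fp FG]] := hahn_banach W0 Wl pD pZ gG0.
have FG' phi : test_function Om phi -> F (T phi) = Re (integralC (fun x => f x * phi x)).
  by move=> tp; apply: (FG (T phi : V, _)); exists phi.
pose iV (x : V) : V := fun q => 'i%C * (x q : R[i]).
have Wi x : W x -> W (iV x) by move=> Wx; exact: (test_mul (smooth_cst 'i%C) Wx).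
(* the complex functional whose real part is F *)
pose u (phi : 'rV[R]_n -> R[i]) : R[i] := F phi +i* (- F (iV phi)).
have F0 : F 0 = 0 by have := Fl (-1) 0 0 W0 W0; rewrite scaler0 addr0 mulN1r addNr.
have FZ (c : R) x : W x -> F (c *: x) = c * F x.
  by move=> Wx; have := Fl c x 0 Wx W0; rewrite F0 !addr0.
have lu : lin_on Om u.
  move=> [a b] phi psi tp ts.
  have tip := Wi _ tp; have tis := Wi _ ts.
  have E1 : (fun x => (a +i* b) * phi x + psi x) = a *: (phi : V) + (b *: iV phi + psi) :> V.
    rewrite !scE; apply/funext => x; rewrite /iV /=.
    rewrite {1}[_ + _]/GRing.add /= [in RHS]/GRing.add /=.
    by apply: complexP; rewrite ?cReD ?cImD ?cReM ?cImM /= ?cReM ?cImM /=; ring.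
  have E2 : iV (fun x => (a +i* b) * phi x + psi x) = a *: iV phi + ((- b) *: (phi : V) + iV psi) :> V.
    rewrite !scE; apply/funext => x; rewrite /iV /=.
    rewrite [in RHS]/GRing.add /=.
    by apply: complexP; rewrite ?cReD ?cImD ?cReM ?cImM /= ?cReM ?cImM ?cReD ?cImD ?cReM ?cImM /=; ring.
  rewrite /u E2 E1 (Fl _ _ _ tp (Wl _ _ _ tip ts)) (Fl _ _ _ tip ts).
  rewrite (Fl _ _ _ tip (Wl _ _ _ tp tis)) (Fl _ _ _ tp tis).
  by apply: complexP; rewrite ?cReD ?cImD ?cReM ?cImM /=; ring.
(* L u = f holds because the real parts agree at phi and at i phi *)
exists u; split; last first.
  move=> phi tp; have [sp _ _] := tp.
  rewrite (apply_distr_tr sL lu tp) -/T /u.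
  have -> : iV (T phi) = T (fun x => 'i%C * phi x + 0) :> V.
    rewrite (Tlin _ _ _ sp (smooth_cst 0)) T0.
    by apply/funext => x; rewrite addr0.
  have tip : test_function Om (fun x => 'i%C * phi x + 0).
    by apply: test_add; [exact: (test_mul (smooth_cst 'i%C) tp)|exact: test_zero].
  rewrite (FG' _ tp) (FG' _ tip) (Ilin _ _ _ tp (test_zero Om)).
  have -> : integralC (fun x => f x * 0) = 0.
    have := Ilin (-1) _ _ (test_zero Om) (test_zero Om).
    have -> : (fun x => f x * (-1 * 0 + 0)) = (fun x => f x * 0).
      by apply/funext => x; rewrite mulr0 addr0.
    by move=> ->; rewrite mulN1r addNr.
  by rewrite addr0; case: (integralC _) => a b; apply: complexP => /=; ring.
split=> // Q _ _; exists (2 * K), N => phi tp _.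
have Fn x : W x -> `|F x| <= p x.
  move=> Wx; rewrite ler_norml Fp // andbT lerNl -mulN1r -FZ //.
  have WN : W ((-1) *: x) by rewrite -[_ *: _]addr0; exact: Wl.
  apply: le_trans (Fp _ WN) _; rewrite /p ler_wpM2l // scE.
  apply: le_trans (Ck_norm_scale _ _ Wx) _.
  by rewrite normc_real normrN1 mul1r.
rewrite (le_trans (normc_le _)) //= normrN.
rewrite -mulrA mulr2n mulrDl mul1r; apply: lerD; first exact: Fn.
apply: le_trans (Fn _ (Wi _ tp)) _; rewrite /p ler_wpM2l //.
apply: le_trans (Ck_norm_scale _ _ tp) _.
by rewrite /= expr0n /= add0r expr1n sqrtr1 mul1r.
Qed.

End Solvability.

(** * Complex-valued functions of one real variable *)

Section ComplexCurves.
Variable R : realType.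
Local Notation normc := Normc.normc.
Local Notation Re := complex.Re.
Local Notation Im := complex.Im.
Implicit Types (f g : R -> R[i]) (t : R) (z w : R[i]).

Definition is_deriveC f t (d : R[i]) :=
  is_derive t 1 (fun s => Re (f s)) (Re d) /\ is_derive t 1 (fun s => Im (f s)) (Im d).

Lemma is_deriveC_eq f t d d' : is_deriveC f t d -> d = d' -> is_deriveC f t d'.
Proof. by move=> H <-. Qed.

Lemma is_deriveC_cst z t : is_deriveC (fun=> z) t 0.
Proof. by split; exact: is_derive_cst. Qed.

Lemma is_deriveC_add f g t df dg : is_deriveC f t df -> is_deriveC g t dg ->
  is_deriveC (fun s => f s + g s) t (df + dg).
Proof.
move=> [f1 f2] [g1 g2]; split.
  by under eq_fun do rewrite cReD; rewrite cReD; exact: (is_deriveD f1 g1).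
by under eq_fun do rewrite cImD; rewrite cImD; exact: (is_deriveD f2 g2).
Qed.

Lemma is_deriveC_mul f g t df dg : is_deriveC f t df -> is_deriveC g t dg ->
  is_deriveC (fun s => f s * g s) t (df * g t + f t * dg).
Proof.
move=> [f1 f2] [g1 g2]; split.
  under eq_fun do rewrite cReM.
  apply: (is_derive_eq (is_deriveB (is_deriveM f1 g1) (is_deriveM f2 g2))).
  by rewrite cReD !cReM /GRing.scale /=; ring.
under eq_fun do rewrite cImM.
apply: (is_derive_eq (is_deriveD (is_deriveM f1 g2) (is_deriveM f2 g1))).
by rewrite cImD !cImM /GRing.scale /=; ring.
Qed.

Lemma is_deriveC_opp f t df : is_deriveC f t df -> is_deriveC (fun s => - f s) t (- df).
Proof.
move=> H; have := is_deriveC_mul (is_deriveC_cst (-1) t) H.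
rewrite mul0r add0r mulN1r.
by have -> : (fun s => -1 * f s) = (fun s => - f s) by apply/funext => s; rewrite mulN1r.
Qed.

Lemma is_deriveC_real (f : R -> R) t (d : R) : is_derive t 1 f d ->
  is_deriveC (fun s => (f s)%:C) t d%:C.
Proof. by move=> H; split => //=; exact: is_derive_cst. Qed.

Lemma is_deriveC_comp f (q : R -> R) t df (dq : R) : is_deriveC f (q t) df -> is_derive t 1 q dq ->
  is_deriveC (fun s => f (q s)) t (df * dq%:C).
Proof.
move=> [f1 f2] Hq; split.
  apply: (is_derive_eq (is_derive1_comp (f := fun s => Re (f s)) f1 Hq)).
  by rewrite cReM /= mulr0 subr0.
apply: (is_derive_eq (is_derive1_comp (f := fun s => Im (f s)) f2 Hq)).
by rewrite cImM /= mulr0 add0r.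
Qed.

Definition cexp z : R[i] := (expR (Re z))%:C * (cos (Im z) +i* sin (Im z)).

Lemma cexpD z w : cexp (z + w) = cexp z * cexp w.
Proof.
rewrite /cexp cReD cImD expRD cosD sinD; apply: complexP; rewrite ?cReM ?cImM /= ?cReM ?cImM /=; ring.
Qed.
Lemma cexp0 : cexp 0 = 1.
Proof. by rewrite /cexp /= expR0 cos0 sin0 mul1r. Qed.
Lemma normc_cis x : normc (cos x +i* sin x) = 1 :> R.
Proof. by rewrite /= cos2Dsin2 sqrtr1. Qed.
Lemma normc_cexp z : normc (cexp z) = expR (Re z).
Proof. by rewrite /cexp Normc.normcM normc_real normc_cis mulr1 ger0_norm // expR_ge0. Qed.

Lemma is_deriveC_cexp f t df : is_deriveC f t df ->
  is_deriveC (fun s => cexp (f s)) t (cexp (f t) * df).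
Proof.
move=> [f1 f2].
have e : is_derive t 1 (fun s => expR (Re (f s))) (expR (Re (f t)) * Re df).
  exact: (is_derive1_comp (is_derive_expR _) f1).
have c : is_derive t 1 (fun s => cos (Im (f s))) (- sin (Im (f t)) * Im df).
  exact: (is_derive1_comp (is_derive_cos _) f2).
have s : is_derive t 1 (fun s => sin (Im (f s))) (cos (Im (f t)) * Im df).
  exact: (is_derive1_comp (is_derive_sin _) f2).
split.
  have -> : (fun s => Re (cexp (f s))) = (fun s => expR (Re (f s)) * cos (Im (f s))).
    by apply/funext => u; rewrite /cexp cReM /= mul0r subr0.
  apply: (is_derive_eq (is_deriveM e c)).
  by rewrite /cexp !cReM !cImM /GRing.scale /=; ring.
have -> : (fun s => Im (cexp (f s))) = (fun s => expR (Re (f s)) * sin (Im (f s))).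
  by apply/funext => u; rewrite /cexp cImM /= mul0r addr0.
apply: (is_derive_eq (is_deriveM e s)).
by rewrite /cexp cImM cReM cImM /GRing.scale /=; ring.
Qed.

(** The factor 2 comes from treating real and imaginary parts separately; it avoids
    integrals. *)
Lemma mvt_normc f df a b (S : R) : a <= b -> (forall t, is_deriveC f t (df t)) ->
  (forall t, a <= t <= b -> normc (df t) <= S) -> normc (f b - f a) <= 2 * S * (b - a).
Proof.
move=> ab Hf HS; apply: le_trans (normc_le _) _.
have [c1 c1b E1] := MVT_any a b (fun t => (Hf t).1).
have [c2 c2b E2] := MVT_any a b (fun t => (Hf t).2).
rewrite (min_idPl ab) (max_idPr ab) in c1b c2b.
rewrite cReD cReN cImD cImN E1 E2 !normrM (ger0_norm (x := b - a)) ?subr_ge0 //.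
rewrite -mulrDl ler_wpM2r ?subr_ge0 // mulr2n mulrDl mul1r.
by apply: lerD; [apply: le_trans (normc_Re _) (HS _ c1b)|apply: le_trans (normc_Im _) (HS _ c2b)].
Qed.

Lemma expR_lip (u v : R) : u <= 0 -> v <= 0 -> `|expR u - expR v| <= `|u - v|.
Proof.
move=> u0 v0; have [c c1 ->] := MVT_any v u (fun t => is_derive_expR t).
rewrite normrM -[leRHS]mul1r ler_wpM2r // ger0_norm ?expR_ge0 // -expR0 ler_expR.
case/andP: c1 => _ /le_trans; apply; by rewrite ge_max v0.
Qed.

Lemma normc_distD z w : normc (z - w) <= normc z + normc w.
Proof. by apply: le_trans (le_normcD _ _) _; rewrite normcN. Qed.

(** Quantifies how far z = e^v is from 1 when z is real positive. *)
Lemma expR_sub1_lower (v : R) : `|v| / (1 + `|v|) <= `|expR v - 1|.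
Proof.
have [v0|v0] := leP 0 v.
  have h := expR_ge1Dx v.
  have -> : `|expR v - 1| = expR v - 1 by rewrite ger0_norm //; lra.
  rewrite (ger0_norm v0); apply: (@le_trans _ _ v); last by lra.
  rewrite ler_pdivrMr; last by lra.
  by have := mulr_ge0 v0 v0; lra.
have h := expR_ge1Dx (- v); rewrite expRN in h.
have e0 := expR_gt0 v.
have k : expR v * (1 - v) <= 1 by rewrite -ler_pdivlMl // mulr1.
have -> : `|expR v - 1| = 1 - expR v.
  by rewrite ltr0_norm; [ring|nra].
rewrite (ltr0_norm v0) ler_pdivrMr; last by lra.
lra.
Qed.

(** The ray through a point of the unit circle stays away from 1, unless it is the
    positive real axis. *)
Lemma circle_lower (x : R) : exists2 d, 0 < d &
  (forall r : R, 0 <= r -> d <= normc (r%:C * (cos x +i* sin x) - 1)) \/ (cos x = 1 /\ sin x = 0).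
Proof.
have cs := cos2Dsin2 x.
have [c0|c0] := leP (cos x) 0.
  exists 1 => //; left => r r0; rewrite (le_trans _ (normc_Re _)) //.
  rewrite cReD cReM cReN /= mul0r subr0 ler0_norm; last by nra.
  by nra.
have [s0|s0] := eqVneq (sin x) 0.
  exists 1 => //; right; split => //; move: cs; rewrite s0 expr0n addr0 => h.
  by nra.
exists `|sin x|; rewrite ?normr_gt0 //; left => r r0.
rewrite /= -sqrtr_sqr; apply: ler_wsqrtr.
have := sqr_ge0 (r - cos x); rewrite /= ; nra.
Qed.

End ComplexCurves.

(** * The transport equation on a circle *)

Section CircleEstimate.
Variable R : realType.
Local Notation normc := Normc.normc.
Local Notation Re := complex.Re.
Local Notation Im := complex.Im.
Variables (c1 c2 m : R) (alpha : R[i]).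
Hypothesis m0 : 0 < m.
Hypothesis cm : c1 ^+ 2 + c2 ^+ 2 <= m ^+ 2.

(** Angular part of the quadratic form of the symbol of the Y-terms on
    zeta = rho (sin x, cos x); [Qang] is a primitive of it. *)
Definition qang (x : R) := m - c1 * cos (2 * x) + c2 * sin (2 * x).
Definition Qang (x : R) := m * x - c1 / 2 * sin (2 * x) - c2 / 2 * cos (2 * x).

Lemma is_derive_scale2 (x : R) : is_derive x 1 (fun x : R => 2 * x) 2.
Proof. by apply: is_derive_eq (is_deriveZ 2 (is_derive_id x 1)) _; rewrite /GRing.scale /= mulr1. Qed.

Lemma is_derive_Qang (x : R) : is_derive x 1 Qang (qang x).
Proof.
have s := is_derive1_comp (is_derive_sin (2 * x)) (is_derive_scale2 x).
have c := is_derive1_comp (is_derive_cos (2 * x)) (is_derive_scale2 x).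
have D := is_deriveB (is_deriveB (is_deriveZ m (is_derive_id x 1)) (is_deriveZ (c1 / 2) s)) (is_deriveZ (c2 / 2) c).
by apply: (is_derive_eq D); rewrite /qang /GRing.scale /=; field.
Qed.

(** This is where the hypothesis on m enters: the amplitude of the oscillating part
    is the norm of (c1, c2), so q is nonnegative. *)
Lemma qang_bound x : 0 <= qang x <= 2 * m.
Proof.
have cs := cos2Dsin2 (2 * x).
set c := cos (2 * x) in cs *; set s := sin (2 * x) in cs *.
have h : `|c1 * c - c2 * s| <= m.
  rewrite -(ger0_norm (ltW m0)) -[leLHS]ger0_norm // -sqrtr_sqr -[leRHS]sqrtr_sqr.
  apply: ler_wsqrtr; apply: le_trans cm.
  rewrite real_normK ?num_real //.
  have -> : c1 ^+ 2 + c2 ^+ 2 = (c1 * c - c2 * s) ^+ 2 + (c1 * s + c2 * c) ^+ 2.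
    rewrite -[LHS]mulr1 -cs; ring.
  by rewrite lerDl sqr_ge0.
move: h; rewrite ler_norml => /andP[h1 h2].
by rewrite /qang -/c -/s; apply/andP; split; lra.
Qed.

Lemma Qang_mono x y : x <= y -> Qang x <= Qang y.
Proof.
move=> xy; have [c _ E] := MVT_any x y is_derive_Qang.
rewrite -subr_ge0 E mulr_ge0 ?subr_ge0 //; by case/andP: (qang_bound c).
Qed.
Lemma Qang_lip x y : `|Qang y - Qang x| <= 2 * m * `|y - x|.
Proof.
have [c _ ->] := MVT_any x y is_derive_Qang; rewrite normrM ler_wpM2r //.
by have /andP[q0 q1] := qang_bound c; rewrite ger0_norm.
Qed.
Variables (nu sg : R).
Hypothesis nu_ge : 1 / 2 <= nu.
Hypothesis sg1 : sg = 1 \/ sg = -1.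

Lemma nu0 : 0 < nu. Proof. by apply: lt_le_trans nu_ge; rewrite divr_gt0. Qed.
Lemma sg2 : sg * sg = 1. Proof. by case: sg1 => ->; ring. Qed.

Lemma Qang_turn x : Qang (x - sg * (2 * pi)) - Qang x = - (sg * (2 * pi * m)).
Proof.
have E : sin (2 * (x - sg * (2 * pi))) = sin (2 * x) /\ cos (2 * (x - sg * (2 * pi))) = cos (2 * x).
  have s2 y : sin (y + 2 * pi + 2 * pi) = sin y :> R.
    by rewrite (mulr_natl pi 2) !sinD2pi.
  have c2' y : cos (y + 2 * pi + 2 * pi) = cos y :> R.
    by rewrite (mulr_natl pi 2) !cosD2pi.
  case: sg1 => ->.
    split.
      by rewrite -(s2 (2 * (x - 1 * (2 * pi)))); congr sin; ring.
    by rewrite -(c2' (2 * (x - 1 * (2 * pi)))); congr cos; ring.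
  split.
    by rewrite -[RHS]s2; congr sin; ring.
  by rewrite -[RHS]c2'; congr cos; ring.
by rewrite /Qang E.1 E.2; ring.
Qed.

(** Exponent of the integrating factor at time t of the path th - sg t on the circle
    of radius rho.  Its rho-dependent part is nonpositive ([Kexp_nonpos]) because of
    the direction in which the circle is run through. *)
Definition Kexp rho th t : R[i] :=
  (rho ^+ 2 * (sg * (Qang (th - sg * t) - Qang th) / (2 * nu)))%:C + (sg / 2 * t)%:C * alpha.
Definition Kfac rho th t := cexp (Kexp rho th t).
Definition Kmax := expR (pi * `|Re alpha|).

Lemma is_derive_back th (t : R) : is_derive t 1 (fun t => th - sg * t) (- sg).
Proof.
have D := is_deriveB (is_derive_cst th t 1) (is_deriveZ sg (is_derive_id t 1)).
by apply: (is_derive_eq D); rewrite /GRing.scale /= mulr1 sub0r.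
Qed.

Lemma is_deriveC_Kfac rho th t : is_deriveC (Kfac rho th) t
  (Kfac rho th t * ((- (rho ^+ 2 * qang (th - sg * t) / (2 * nu)))%:C + (sg / 2)%:C * alpha)).
Proof.
apply: is_deriveC_cexp.
have nz : nu != 0 by rewrite gt_eqF // nu0.
have D1 := is_derive1_comp (g := fun t => th - sg * t) (is_derive_Qang (th - sg * t)) (is_derive_back th t).
have D2 := is_deriveZ (rho ^+ 2 * sg / (2 * nu)) (is_deriveB D1 (is_derive_cst (Qang th) t 1)).
have D3 : is_derive t 1 (fun t => rho ^+ 2 * (sg * (Qang (th - sg * t) - Qang th) / (2 * nu)))
   (- (rho ^+ 2 * qang (th - sg * t) / (2 * nu))).
  have -> : (fun t => rho ^+ 2 * (sg * (Qang (th - sg * t) - Qang th) / (2 * nu))) =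
     (fun t => rho ^+ 2 * sg / (2 * nu) * (Qang (th - sg * t) - Qang th)).
    by apply/funext => s; field.
  apply: (is_derive_eq D2); rewrite /GRing.scale /= subr0 mulrN -mulNr.
  rewrite (_ : - (rho ^+ 2 * qang (th - sg * t) / (2 * nu)) =
     - (rho ^+ 2 * (sg * sg) * qang (th - sg * t) / (2 * nu))); last by rewrite sg2 mulr1.
  by field.
apply: is_deriveC_add; first exact: is_deriveC_real.
have D4 : is_derive t 1 (fun t => sg / 2 * t) (sg / 2).
  by apply: (is_derive_eq (is_deriveZ (sg / 2) (is_derive_id t 1))); rewrite /GRing.scale /= mulr1.
apply: (is_deriveC_eq (is_deriveC_mul (is_deriveC_real D4) (is_deriveC_cst alpha t))).
by rewrite mulr0 addr0.
Qed.

Lemma Kexp_nonpos th t : 0 <= t -> sg * (Qang (th - sg * t) - Qang th) / (2 * nu) <= 0.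
Proof.
move=> t0; have n0 := nu0; rewrite pmulr_lle0; last by rewrite invr_gt0; lra.
case: sg1 => ->.
  rewrite mul1r subr_le0; apply: Qang_mono; lra.
rewrite mulN1r oppr_le0 subr_ge0; apply: Qang_mono; lra.
Qed.

Lemma ReKexp rho th t : Re (Kexp rho th t) =
  rho ^+ 2 * (sg * (Qang (th - sg * t) - Qang th) / (2 * nu)) + sg / 2 * t * Re alpha.
Proof. by rewrite /Kexp cReD cReM /= mul0r subr0. Qed.

Lemma drift_bound t : 0 <= t <= 2 * pi -> sg / 2 * t * Re alpha <= pi * `|Re alpha|.
Proof.
move=> /andP[t0 t1]; apply: le_trans (ler_norm _) _; rewrite normrM ler_wpM2r //.
rewrite normrM (ger0_norm t0); case: sg1 => ->.
  by rewrite ger0_norm; lra.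
by rewrite ltr0_norm; lra.
Qed.

Lemma normc_Kfac rho th t : 0 <= t <= 2 * pi -> normc (Kfac rho th t) <= Kmax.
Proof.
move=> tt; rewrite normc_cexp ler_expR ReKexp.
have := drift_bound tt; have /andP[t0 _] := tt.
have := mulr_ge0_le0 (sqr_ge0 rho) (Kexp_nonpos th t0); lra.
Qed.

Lemma Kexp_slope th t : 0 <= t <= 2 * pi ->
  `|sg * (Qang (th - sg * t) - Qang th) / (2 * nu)| <= 2 * pi * m / nu.
Proof.
move=> /andP[t0 t1]; have n0 := nu0.
have h := Qang_lip th (th - sg * t).
have sgn : `|sg| = 1 by case: sg1 => ->; rewrite ?normrN normr1.
have E : `|th - sg * t - th| = t by rewrite addrAC subrr sub0r normrN normrM sgn mul1r ger0_norm.
rewrite E in h.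
rewrite !normrM sgn mul1r normfV (ger0_norm (x := 2 * nu)); last by lra.
rewrite ler_pdivrMr; last by lra.
have -> : 2 * pi * m / nu * (2 * nu) = 2 * m * (2 * pi) by field; lra.
by apply: le_trans h _; rewrite ler_wpM2l //; have := m0; lra.
Qed.

(** The dependence on the radius is through exp (rho^2 x) with x <= 0, which is
    Lipschitz in rho^2 with constant |x|, uniformly in rho. *)
Lemma Kfac_lip r r' th t : 0 <= t <= 2 * pi ->
  normc (Kfac r th t - Kfac r' th t) <= Kmax * (2 * pi * m / nu) * `|r ^+ 2 - r' ^+ 2|.
Proof.
move=> tt; have /andP[t0 _] := tt.
rewrite /Kfac /Kexp; set x := sg * _ / _.
have x0 : x <= 0 by exact: Kexp_nonpos.
have E s : cexp ((s ^+ 2 * x)%:C + (sg / 2 * t)%:C * alpha) =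
    cexp ((sg / 2 * t)%:C * alpha) * (expR (s ^+ 2 * x))%:C.
  by rewrite cexpD mulrC; congr (_ * _); rewrite /cexp /= cos0 sin0 mulr1.
rewrite !E -mulrBr Normc.normcM -(mulrA Kmax) ler_pM ?normc_ge0 //.
  rewrite /Kmax normc_cexp ler_expR cReM /= mul0r subr0; exact: drift_bound.
have -> : (expR (r ^+ 2 * x))%:C - (expR (r' ^+ 2 * x))%:C = (expR (r ^+ 2 * x) - expR (r' ^+ 2 * x))%:C.
  by apply: complexP => /=; rewrite ?subrr.
rewrite normc_real.
apply: le_trans (expR_lip _ _) _; try by rewrite mulr_ge0_le0 // sqr_ge0.
rewrite -mulrBl normrM mulrC ler_wpM2r //; exact: Kexp_slope.
Qed.

(** Value of the integrating factor after a full turn; it depends on the radius and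
    not on the starting angle ([Kfac2pi]). *)
Definition zfac rho : R[i] :=
  (expR (pi * sg * Re alpha - pi * m * rho ^+ 2 / nu))%:C *
  (cos (pi * sg * Im alpha) +i* sin (pi * sg * Im alpha)).

Lemma Kfac0 rho th : Kfac rho th 0 = 1.
Proof.
have -> : Kfac rho th 0 = cexp 0; last exact: cexp0.
congr cexp; rewrite /Kexp mulr0 subr0 subrr mulr0 mul0r mulr0 mulr0.
by rewrite mul0r addr0.
Qed.

Lemma Kfac2pi rho th : Kfac rho th (2 * pi) = zfac rho.
Proof.
have n0 := nu0.
rewrite /Kfac /cexp /zfac ReKexp Qang_turn; congr (_%:C * _).
  congr expR; rewrite mulrN -mulrN (_ : sg * - (sg * (2 * pi * m)) = - (2 * pi * m)).
    by field; lra.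
  by rewrite mulrN (mulrA sg sg) sg2 mul1r.
have -> : Im (Kexp rho th (2 * pi)) = pi * sg * Im alpha.
  by rewrite /Kexp cImD cImM /= mul0r addr0 add0r; field.
by [].
Qed.

(** Here mu = sg nu is the frequency in u, with nu > 0 and sg its sign. *)
Definition transport rho (V G : R -> R[i]) := forall x, exists2 dV, is_deriveC V x dV &
  (2 * sg * nu)%:C * dV + ((rho ^+ 2 * qang x)%:C - (sg * nu)%:C * alpha) * V x = - G x.

(** The integrating factor turns the transport equation into a pure derivative. *)
Lemma is_deriveC_KV rho V G th t : transport rho V G ->
  is_deriveC (fun t => Kfac rho th t * V (th - sg * t)) t
    ((1 / (2 * nu))%:C * (Kfac rho th t * G (th - sg * t))).
Proof.
move=> H; have [dV D E] := H (th - sg * t).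
apply: (is_deriveC_eq (is_deriveC_mul (is_deriveC_Kfac rho th t) (@is_deriveC_comp R V (fun t => th - sg * t) t dV _ D (is_derive_back th t)))).
have n0 : nu != 0 by rewrite gt_eqF // nu0.
have s2 := sg2.
have -> : G (th - sg * t) = - ((2 * sg * nu)%:C * dV + ((rho ^+ 2 * qang (th - sg * t))%:C - (sg * nu)%:C * alpha) * V (th - sg * t)).
  by rewrite E opprK.
set K := Kfac _ _ _; set v := V _; set q := qang _.
have S : (- sg)%:C = (1 / (2 * nu))%:C * (- (2 * sg * nu)%:C) :> R[i].
  by apply: complexP; rewrite ?cReM ?cImM ?cReN ?cImN /=; field.
have T : (- (rho ^+ 2 * q / (2 * nu)))%:C = (1 / (2 * nu))%:C * (- (rho ^+ 2 * q)%:C) :> R[i].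
  by apply: complexP; rewrite ?cReM ?cImM ?cReN ?cImN /=; field.
have U : (sg / 2)%:C = (1 / (2 * nu))%:C * ((sg * nu)%:C) :> R[i].
  by apply: complexP; rewrite ?cReM ?cImM ?cReN ?cImN /=; field.
rewrite S T U; ring.
Qed.

(** The difference of the solutions on two circles, integrated over a full turn.
    Taking V' = G' = 0 gives the basic estimate; taking V' on the resonant circle,
    where its contribution vanishes, gives the refined one. *)
Lemma two_turns rho rho' V V' G G' th B : transport rho V G -> transport rho' V' G' ->
  (forall x, V (x - sg * (2 * pi)) = V x) -> (forall x, V' (x - sg * (2 * pi)) = V' x) ->
  (forall t, 0 <= t <= 2 * pi ->
    normc (Kfac rho th t * G (th - sg * t) - Kfac rho' th t * G' (th - sg * t)) <= B) ->
  normc ((zfac rho - 1) * V th - (zfac rho' - 1) * V' th) <= 2 * pi / nu * B.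
Proof.
move=> H H' p p' HB.
pose f t := Kfac rho th t * V (th - sg * t) - Kfac rho' th t * V' (th - sg * t).
have D t := is_deriveC_add (is_deriveC_KV th t H) (is_deriveC_opp (is_deriveC_KV th t H')).
have pi20 : 0 <= 2 * pi :> R by rewrite mulr_ge0 // pi_ge0.
have n0 := nu0.
have bd t : 0 <= t <= 2 * pi ->
  normc ((1 / (2 * nu))%:C * (Kfac rho th t * G (th - sg * t))
    - (1 / (2 * nu))%:C * (Kfac rho' th t * G' (th - sg * t))) <= 1 / (2 * nu) * B.
  move=> /HB h; rewrite -mulrBr Normc.normcM normc_real ger0_norm.
    by rewrite ler_wpM2l // divr_ge0 // mulr_ge0 // ltW.
  by rewrite divr_ge0 // mulr_ge0 // ltW.
have := mvt_normc pi20 D bd.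
rewrite !Kfac2pi !Kfac0 !mulr0 !subr0 p p' !mul1r.
rewrite (_ : 2 * ((2 * nu)^-1 * B) * (2 * pi) = 2 * pi / nu * B); last by field; rewrite gt_eqF.
by congr (normc _ <= _); ring.
Qed.

End CircleEstimate.

(** * A bound on all circles, uniform in the frequency *)

Section CircleBound.
Variable R : realType.
Local Notation normc := Normc.normc.
Local Notation Re := complex.Re.
Local Notation Im := complex.Im.

Lemma le_limit (x y k : R) : (forall e, 0 < e -> e <= 1 -> x <= y + e * k) -> x <= y.
Proof.
move=> H; rewrite leNgt; apply/negP => yx.
have k0 : 0 < `|k| + 1 by rewrite ltr_wpDl.
pose e := Num.min 1 ((x - y) / 2 / (`|k| + 1)).
have e0 : 0 < e by rewrite lt_min ltr01 !divr_gt0 // subr_gt0.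
have := H e e0; rewrite ge_min lexx => /(_ isT) h.
have : e * k <= (x - y) / 2.
  apply: (@le_trans _ _ (e * (`|k| + 1))).
    by rewrite ler_wpM2l ?(ltW e0) // (le_trans (ler_norm k)) // lerDl.
  by rewrite -ler_pdivlMr // ge_min lexx orbT.
by lra.
Qed.

Lemma frac_mono (x y : R) : 0 <= x -> x <= y -> x / (1 + x) <= y / (1 + y).
Proof.
move=> x0 xy; rewrite ler_pdivrMr; last by lra.
by rewrite mulrAC ler_pdivlMr; [nra|lra].
Qed.

(** Write z - 1 for the full-turn defect.  If z is not close to the positive real axis,
    or |z| is not close to 1, then (z - 1) V = O(S) suffices.  Otherwise z = e^v with
    v proportional to rho^2 - rho_0^2, where rho_0 is the resonant radius;
    comparison with the circle rho_0 gives (z - 1) V = O(v S), and |z - 1| is at least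
    |v| / (1 + |v|).  For alpha purely imaginary rho_0 = 0, where a
    first-order bound is too weak: (V1, G1) is the first Taylor coefficient in rho at
    the centre, which again solves the equation, and the error is quadratic.  The
    Lipschitz constant B of V is only used qualitatively, to reach rho = rho_0. *)
Theorem circle_bound (c1 c2 m : R) (alpha : R[i]) : 0 < m -> c1 ^+ 2 + c2 ^+ 2 <= m ^+ 2 ->
  exists2 C, 0 <= C & forall (nu sg : R), 1 / 2 <= nu -> (sg = 1 \/ sg = -1) ->
  forall (V G : R -> R -> R[i]) (S B : R),
  (forall r, transport c1 c2 m alpha nu sg r (V r) (G r)) ->
  (forall r x, V r (x - sg * (2 * pi)) = V r x) ->
  (forall r r' x, normc (V r x - V r' x) <= B * `|r - r'|) ->
  (forall r x, normc (G r x) <= S) ->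
  (forall r r' x, normc (G r x - G r' x) <= S * `|r - r'|) ->
  (exists V1 G1 : R -> R[i], [/\
     (forall r, transport c1 c2 m alpha nu sg 0 (fun x => V 0 x + r%:C * V1 x)
                                                (fun x => G 0 x + r%:C * G1 x)),
     (forall x, V1 (x - sg * (2 * pi)) = V1 x) &
     (forall r x, normc (G r x - (G 0 x + r%:C * G1 x)) <= S * r ^+ 2)]) ->
  forall r x, 0 <= r -> normc (V r x) <= C * (1 + r ^+ 2) * S.
Proof.
move=> m0 cm.
pose a := Re alpha; pose E0 : R := Kmax alpha.
have E00 : 0 < E0 by exact: expR_gt0.
have pp : 0 < pi :> R by exact: pi_gt0.
have low (s : R) : exists d, 0 < d /\ ((forall r : R, 0 <= r -> d <= normc (r%:C * (cos (pi * s * Im alpha) +i* sin (pi * s * Im alpha)) - 1))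
   \/ (cos (pi * s * Im alpha) = 1 /\ sin (pi * s * Im alpha) = 0)).
  by have [d d0 H] := circle_lower (pi * s * Im alpha); exists d.
have [d1 [d10 Hd1]] := low 1; have [d2 [d20 Hd2]] := low (-1).
pose kap := 1 + (Num.sqrt (`|a| / (2 * m)))^-1.
have kap1 : 1 <= kap by rewrite lerDl invr_ge0 sqrtr_ge0.
pose Cr := 2 / m * E0 * (4 * pi * m + kap) * (1 + pi * `|a| + 2 * pi * m).
pose Ca := 4 * pi * E0 * (1 + pi * `|a|) / (pi * `|a|).
pose Cd := 4 * pi * E0 / d1 + 4 * pi * E0 / d2.
have a0 : 0 <= pi * `|a| by rewrite mulr_ge0 // ltW.
have kk : 0 <= 4 * pi * m + kap by rewrite addr_ge0 ?mulr_ge0 // ?(ltW pp) ?(ltW m0) // (le_trans _ kap1).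
have Cr0 : 0 <= Cr.
  by rewrite /Cr !mulr_ge0 ?invr_ge0 ?addr_ge0 ?mulr_ge0 // ?(ltW pp) ?(ltW m0) ?(ltW E00) // (le_trans _ kap1).
have p4E : 0 <= 4 * pi * E0 by rewrite !mulr_ge0 // ltW.
have Ca0 : 0 <= Ca by rewrite /Ca divr_ge0 // mulr_ge0 // addr_ge0.
have Cd0 : 0 <= Cd by rewrite /Cd addr_ge0 // divr_ge0 // ltW.
have CC : 0 <= Cr + Ca + Cd by apply: addr_ge0 => //; apply: addr_ge0.
exists (Cr + Ca + Cd) => [//|nu sg nu12 sg1 V G S B HT Vper VB GS GL HC r x r0].
have n0 : 0 < nu := nu0 nu12.
have S0 : 0 <= S := le_trans (normc_ge0 _) (GS 0 0).
have rr : 1 <= 1 + r ^+ 2 by rewrite lerDl sqr_ge0.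
have iv2 : nu^-1 <= 2 by rewrite invf_ple ?posrE // -div1r.
(* Cd serves when z stays away from the positive real axis, Ca when |z| is bounded
   away from 1, and Cr when there is a resonant circle *)
have suff_r D : 0 <= D -> D <= Cr + Ca + Cd -> normc (V r x) <= D * S -> normc (V r x) <= (Cr + Ca + Cd) * (1 + r ^+ 2) * S.
  move=> D0 DC /le_trans; apply; rewrite ler_wpM2r // (le_trans DC) //; exact: (ler_peMr CC rr).
have KB rho th t : 0 <= t <= 2 * pi -> normc (Kfac c1 c2 m alpha nu sg rho th t) <= E0.
  by move=> tt; exact: normc_Kfac.
have KL rho rho' th t : 0 <= t <= 2 * pi ->
  normc (Kfac c1 c2 m alpha nu sg rho th t - Kfac c1 c2 m alpha nu sg rho' th t)
    <= E0 * (2 * pi * m / nu) * `|rho ^+ 2 - rho' ^+ 2|.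
  by move=> tt; apply: Kfac_lip.
have diff (K K' g g' : R[i]) (X Y : R) : normc (K - K') <= X -> normc g <= S ->
    normc K' <= E0 -> normc (g - g') <= Y -> normc (K * g - K' * g') <= X * S + E0 * Y.
  move=> h1 h2 h3 h4; have -> : K * g - K' * g' = (K - K') * g + K' * (g - g') by ring.
  apply: le_trans (le_normcD _ _) _; rewrite (Normc.normcM (K - K')) (Normc.normcM K').
  by apply: lerD; apply: ler_pM; rewrite ?normc_ge0.
have T0 rho : transport c1 c2 m alpha nu sg rho (fun=> 0) (fun=> 0).
  by move=> y; exists 0; [exact: is_deriveC_cst|rewrite !mulr0 addr0 oppr0].
have basic rho y : normc ((zfac m alpha nu sg rho - 1) * V rho y) <= 4 * pi * E0 * S.
  have bd t : 0 <= t <= 2 * pi ->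
     normc (Kfac c1 c2 m alpha nu sg rho y t * G rho (y - sg * t) - Kfac c1 c2 m alpha nu sg rho y t * 0) <= E0 * S.
    move=> tt; rewrite mulr0 subr0 Normc.normcM ler_pM ?normc_ge0 //.
    exact: KB.
  have := two_turns nu12 sg1 (HT rho) (T0 rho) (Vper rho) (fun=> erefl) bd.
  rewrite mulr0 subr0 => /le_trans; apply.
  have -> : 2 * pi / nu * (E0 * S) = (2 * pi * E0 * S) * nu^-1 by ring.
  have -> : 4 * pi * E0 * S = (2 * pi * E0 * S) * 2 by ring.
  by rewrite ler_wpM2l // !mulr_ge0 // ltW.
have lowerC d : 0 < d -> d <= normc (zfac m alpha nu sg r - 1) -> normc (V r x) <= 4 * pi * E0 / d * S.
  move=> dd0 dz; have := basic r x; rewrite Normc.normcM => h.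
  have : d * normc (V r x) <= 4 * pi * E0 * S.
    by apply: le_trans h; rewrite ler_wpM2r // normc_ge0.
  by rewrite -ler_pdivlMl // => /le_trans; apply; rewrite le_eqVlt; apply/orP; left; apply/eqP; field; rewrite gt_eqF.
have cases : (exists d, [/\ 0 < d, d <= normc (zfac m alpha nu sg r - 1) & 4 * pi * E0 / d <= Cd]) \/
   (cos (pi * sg * Im alpha) = 1 /\ sin (pi * sg * Im alpha) = 0).
  have X1 : 0 <= 4 * pi * E0 / d1 by rewrite divr_ge0 ?mulr_ge0 // ltW.
  have X2 : 0 <= 4 * pi * E0 / d2 by rewrite divr_ge0 ?mulr_ge0 // ltW.
  case: sg1 => ->.
    case: Hd1 => [h|h]; [left|by right].
    by exists d1; split => //; [apply: h; exact: expR_ge0|rewrite lerDl].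
  case: Hd2 => [h|h]; [left|by right].
  by exists d2; split => //; [apply: h; exact: expR_ge0|rewrite lerDr].
case: cases => [[d [dd0 dz dC]]|[cE sE]].
  apply: (suff_r _ _ _ (lowerC _ dd0 dz)); first by rewrite divr_ge0 ?mulr_ge0 // ltW.
  by rewrite (le_trans dC) // lerDr addr_ge0.
pose v (rho : R) := pi * sg * a - pi * m * rho ^+ 2 / nu.
have zE rho : zfac m alpha nu sg rho - 1 = (expR (v rho) - 1)%:C.
  by rewrite /zfac cE sE; apply: complexP; rewrite ?cReD ?cImD ?cReM ?cImM ?cReN ?cImN /=; ring.
have zl rho : `|v rho| / (1 + `|v rho|) <= normc (zfac m alpha nu sg rho - 1).
  by rewrite zE normc_real; exact: expR_sub1_lower.
(* for sg a < 0 the exponent v is bounded away from 0 *)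
have [sa|sa] := ltP (sg * a) 0.
  have pa : 0 < pi * `|a|.
    rewrite mulr_gt0 // normr_gt0; apply/eqP => a00; move: sa; rewrite a00 mulr0 ltxx //.
  have va : pi * `|a| <= `|v r|.
    have q0 : 0 <= pi * m * r ^+ 2 / nu by rewrite divr_ge0 // ?mulr_ge0 ?sqr_ge0 // ltW.
    have E : pi * `|a| = - (pi * sg * a).
      rewrite -mulrA -mulrN; congr (_ * _); case: sg1 sa => ->.
        by rewrite mul1r => /ltr0_norm.
      by rewrite mulN1r opprK oppr_lt0 => /gtr0_norm.
    rewrite E /v; apply: le_trans (ler_norm _) _; rewrite normrN [leRHS]ler0_norm.
      by rewrite ler0_norm; lra.
    by lra.
  have pa1 : 0 < 1 + pi * `|a| by rewrite ltr_wpDr.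
  have pd0 : 0 < pi * `|a| / (1 + pi * `|a|) by rewrite divr_gt0.
  have CaE : 4 * pi * E0 / (pi * `|a| / (1 + pi * `|a|)) = Ca.
    by rewrite invf_div mulrA.
  have := lowerC _ pd0 (le_trans (frac_mono (ltW pa) va) (zl r)); rewrite CaE.
  by apply: suff_r => //; rewrite -addrA addrCA lerDl addr_ge0.
(* the radius at which z = 1 *)
pose rres := Num.sqrt (sg * a * nu / m).
have rres0 : 0 <= rres by exact: sqrtr_ge0.
have rres2 : rres ^+ 2 = sg * a * nu / m.
  by apply: sqr_sqrtr; apply: divr_ge0; [apply: mulr_ge0 => //; exact: ltW|exact: ltW].
have vE rho : v rho = - (pi * m * (rho ^+ 2 - rres ^+ 2) / nu).
  by rewrite rres2 /v; field; rewrite !gt_eqF.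
have vn rho : `|v rho| = pi * m / nu * `|rho ^+ 2 - rres ^+ 2|.
  rewrite vE normrN !normrM (gtr0_norm pp) (gtr0_norm m0) normfV (gtr0_norm n0).
  by ring.
have J rho y : 0 <= rho -> normc ((zfac m alpha nu sg rho - 1) * V rho y) <= 2 / m * E0 * (4 * pi * m + kap) * S * `|v rho|.
  move=> rho0.
  have z1 : zfac m alpha nu sg rres - 1 = 0.
    rewrite zE vE subrr mulr0 mul0r oppr0 expR0 subrr //.
  have mul4 : 2 * pi * m / nu <= 4 * pi * m.
    have -> : 4 * pi * m = 2 * pi * m * 2 by ring.
    by rewrite ler_wpM2l // !mulr_ge0 // ltW.
  have fin W : 0 <= W -> W <= kap * `|rho ^+ 2 - rres ^+ 2| ->
     2 * pi / nu * (E0 * (2 * pi * m / nu) * `|rho ^+ 2 - rres ^+ 2| * S + E0 * (S * W)) <=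
       2 / m * E0 * (4 * pi * m + kap) * S * `|v rho|.
    move=> W0 Wk; rewrite vn; set X := `|_ - _|.
    have X0 : 0 <= X by exact: normr_ge0.
    have -> : 2 / m * E0 * (4 * pi * m + kap) * S * (pi * m / nu * X) =
       2 * pi / nu * (E0 * S * ((4 * pi * m + kap) * X)).
      by field; rewrite !gt_eqF.
    apply: ler_wpM2l; first by rewrite divr_ge0 ?mulr_ge0 // ltW.
    have -> : E0 * (2 * pi * m / nu) * X * S + E0 * (S * W) = E0 * S * (2 * pi * m / nu * X + W).
      by ring.
    apply: ler_wpM2l; first by rewrite mulr_ge0 // ltW.
    have -> : (4 * pi * m + kap) * X = 4 * pi * m * X + kap * X by exact: mulrDl.
    apply: (lerD _ Wk); exact: (ler_wpM2r X0 mul4).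
  (* resonance at the centre: V 0 + rho V1 solves the equation of the circle 0 *)
  have [a00|ane] := eqVneq (sg * a) 0.
    have r00 : rres = 0 by rewrite /rres a00 !mul0r sqrtr0.
    have [V1 [G1 [HT1 V1per HG1]]] := HC.
    have bd t : 0 <= t <= 2 * pi ->
     normc (Kfac c1 c2 m alpha nu sg rho y t * G rho (y - sg * t) - Kfac c1 c2 m alpha nu sg 0 y t *
         (G 0 (y - sg * t) + rho%:C * G1 (y - sg * t))) <= E0 * (2 * pi * m / nu) * `|rho ^+ 2 - rres ^+ 2| * S + E0 * (S * (rho ^+ 2)).
      move=> tt; apply: (diff _ _ _ _ _ _ _ (GS _ _) (KB _ _ _ tt) (HG1 _ _)).
      by rewrite r00; exact: KL.
    have per1 z : (fun z => V 0 z + rho%:C * V1 z) (z - sg * (2 * pi)) = (fun z => V 0 z + rho%:C * V1 z) z.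
      by rewrite /= Vper V1per.
    have := two_turns nu12 sg1 (HT rho) (HT1 rho) (Vper rho) per1 bd.
    rewrite -r00 z1 mul0r subr0 => /le_trans; apply; apply: fin; first exact: sqr_ge0.
    rewrite r00 expr0n subr0 ger0_norm ?sqr_ge0 // -[leLHS]mul1r ler_wpM2r // sqr_ge0 //.
  have rres_ge : Num.sqrt (`|a| / (2 * m)) <= rres.
    apply: ler_wsqrtr; have -> : `|a| = sg * a.
      by case: sg1 sa => ->; rewrite ?mul1r ?mulN1r ?oppr_ge0 => h; [rewrite ger0_norm|rewrite ler0_norm].
    have -> : sg * a * nu / m = sg * a / (2 * m) * (2 * nu) by field; rewrite gt_eqF.
    have h1 : 0 <= sg * a / (2 * m) by apply: divr_ge0 => //; apply: mulr_ge0 => //; exact: ltW.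
    have h2 : 1 <= 2 * nu by lra.
    exact: ler_peMr.
  have sqp : 0 < Num.sqrt (`|a| / (2 * m)).
    rewrite sqrtr_gt0 divr_gt0 ?mulr_gt0 // normr_gt0; apply: contra_neq ane => ->; rewrite mulr0 //.
  have bd t : 0 <= t <= 2 * pi ->
     normc (Kfac c1 c2 m alpha nu sg rho y t * G rho (y - sg * t) - Kfac c1 c2 m alpha nu sg rres y t *
         G rres (y - sg * t)) <= E0 * (2 * pi * m / nu) * `|rho ^+ 2 - rres ^+ 2| * S + E0 * (S * `|rho - rres|).
    by move=> tt; apply: (diff _ _ _ _ _ _ (KL _ _ _ _ tt) (GS _ _) (KB _ _ _ tt) (GL _ _ _)).
  have := two_turns nu12 sg1 (HT rho) (HT rres) (Vper rho) (Vper rres) bd.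
  rewrite z1 mul0r subr0 => /le_trans; apply; apply: fin; first exact: normr_ge0.
  have -> : rho ^+ 2 - rres ^+ 2 = (rho - rres) * (rho + rres) by ring.
  rewrite normrM (ger0_norm (addr_ge0 rho0 rres0)) mulrCA -[leLHS]mulr1 ler_wpM2l //.
  rewrite /kap mulrDl mul1r (le_trans (y := (Num.sqrt (`|a| / (2 * m)))^-1 * (rho + rres))) //.
    by rewrite -ler_pdivrMl ?invr_gt0 // invrK mulr1 (le_trans rres_ge) // lerDr.
  by rewrite lerDr addr_ge0.
have offres rho y : 0 <= rho -> rho != rres -> normc (V rho y) <= Cr * (1 + rho ^+ 2) * S.
  move=> rho0 rne.
  have vpos : 0 < `|v rho|.
    rewrite vn mulr_gt0 ?divr_gt0 ?mulr_gt0 // normr_gt0 subr_eq0.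
    by rewrite eqrXn2.
  have := J rho y rho0; rewrite Normc.normcM => h.
  have h2 : `|v rho| / (1 + `|v rho|) * normc (V rho y) <= 2 / m * E0 * (4 * pi * m + kap) * S * `|v rho|.
    by apply: le_trans h; rewrite ler_wpM2r ?normc_ge0.
  have v1 : 0 < 1 + `|v rho| by lra.
  have h3 : normc (V rho y) <= 2 / m * E0 * (4 * pi * m + kap) * S * (1 + `|v rho|).
    move: h2; rewrite -ler_pdivlMl ?divr_gt0 // => /le_trans; apply.
    by rewrite le_eqVlt; apply/orP; left; apply/eqP; field; rewrite !gt_eqF.
  apply: le_trans h3 _.
  have vle : `|v rho| <= pi * `|a| + 2 * pi * m * rho ^+ 2.
    rewrite /v; apply: le_trans (ler_normB _ _) _; apply: lerD.
      rewrite !normrM (gtr0_norm pp) (_ : `|sg| = 1) ?mulr1 //.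
      by case: sg1 => ->; rewrite ?normrN normr1.
    rewrite ger0_norm; last by rewrite divr_ge0 ?mulr_ge0 ?sqr_ge0 // ltW.
    have -> : 2 * pi * m * rho ^+ 2 = pi * m * rho ^+ 2 * 2 by ring.
    by rewrite ler_wpM2l // !mulr_ge0 ?sqr_ge0 // ltW.
  have -> : Cr * (1 + rho ^+ 2) * S = 2 / m * E0 * (4 * pi * m + kap) * S * ((1 + pi * `|a| + 2 * pi * m) * (1 + rho ^+ 2)).
    by rewrite /Cr; ring.
  apply: ler_wpM2l; first by rewrite !mulr_ge0 ?invr_ge0 ?(ltW m0) ?(ltW E00).
  have := sqr_ge0 rho; have : 0 <= pi * m by rewrite mulr_ge0 // ltW.
  move: a0 vle; set A := pi * `|a|; set q := rho ^+ 2 => A0 vle pm q0.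
  by nra.
apply: (@le_trans _ _ (Cr * (1 + r ^+ 2) * S)); last first.
  rewrite ler_wpM2r // ler_wpM2r ?(le_trans _ rr) // -addrA lerDl addr_ge0 //.
(* on the resonant circle itself, let the radius tend to it *)
have [rE|] := eqVneq r rres; last exact: offres.
apply: (@le_limit _ _ (Cr * (2 * r + 1) * S + `|B|)) => e ee0 e1.
have re : r + e != rres by rewrite -rE addrC -subr_eq0 addrK gt_eqF.
have h := offres (r + e) x (addr_ge0 r0 (ltW ee0)) re.
have hB := VB r (r + e) x.
have -> : V r x = V (r + e) x + (V r x - V (r + e) x) by ring.
apply: le_trans (le_normcD _ _) _.
apply: le_trans (lerD h hB) _.
have -> : `|r - (r + e)| = e by rewrite opprD addNKr normrN gtr0_norm.
have Bn := ler_norm B.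
have : Cr * (1 + (r + e) ^+ 2) * S <= Cr * (1 + r ^+ 2) * S + e * (Cr * (2 * r + 1) * S).
  have -> : Cr * (1 + r ^+ 2) * S + e * (Cr * (2 * r + 1) * S) = Cr * (1 + (r + e) ^+ 2 + (e - e ^+ 2)) * S by ring.
  rewrite ler_wpM2r // ler_wpM2l // lerDl subr_ge0 expr2 ler_piMr // ltW //.
have := ler_wpM2r (ltW ee0) Bn.
lra.
Qed.

End CircleBound.

(** * Bounding a function by its Fourier coefficients *)

Section SegC.
Variable R : realType.
Notation mu := (@lebesgue_measure R).
Local Notation normc := Normc.normc.
Local Notation Re := complex.Re.
Local Notation Im := complex.Im.
Implicit Types (f g : R -> R[i]) (a b : R).

Definition contC f := continuous (fun t => Re (f t)) /\ continuous (fun t => Im (f t)).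
Definition segC a b f : R[i] :=
  (\int[mu]_(t in `[a, b]) Re (f t)) +i* (\int[mu]_(t in `[a, b]) Im (f t)).

Lemma cont_add (F G : R -> R) : continuous F -> continuous G -> continuous (fun t => F t + G t).
Proof. by move=> cF cG x; apply: (@continuousD _ _ _ F G); [exact: cF|exact: cG]. Qed.
Lemma cont_mul (F G : R -> R) : continuous F -> continuous G -> continuous (fun t => F t * G t).
Proof. by move=> cF cG x; apply: (@continuousM _ _ F G); [exact: cF|exact: cG]. Qed.
Lemma cont_opp (F : R -> R) : continuous F -> continuous (fun t => - F t).
Proof. by move=> cF x; apply: (@continuousN _ _ _ F); exact: cF. Qed.
Lemma deriv_continuous (F dF : R -> R) : (forall t : R, is_derive t 1 F (dF t)) -> continuous F.
Proof. by move=> H x; apply: differentiable_continuous; apply/derivable1_diffP; case: (H x). Qed.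

Lemma contC_add f g : contC f -> contC g -> contC (fun t => f t + g t).
Proof.
move=> [f1 f2] [g1 g2]; split.
  by under eq_fun do rewrite cReD; exact: cont_add.
by under eq_fun do rewrite cImD; exact: cont_add.
Qed.
Lemma contC_mul f g : contC f -> contC g -> contC (fun t => f t * g t).
Proof.
move=> [f1 f2] [g1 g2]; split.
  under eq_fun do rewrite cReM; apply: cont_add; first exact: cont_mul.
  by apply: cont_opp; exact: cont_mul.
by under eq_fun do rewrite cImM; apply: cont_add; exact: cont_mul.
Qed.
Lemma contC_cst (z : R[i]) : contC (fun=> z).
Proof. by split; exact: cst_continuous. Qed.
Lemma contC_opp f : contC f -> contC (fun t => - f t).
Proof.
move=> [f1 f2]; split.
  by under eq_fun do rewrite cReN; exact: cont_opp.
by under eq_fun do rewrite cImN; exact: cont_opp.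
Qed.
Lemma contC_sum (I : Type) (r : seq I) (F : I -> R -> R[i]) :
  (forall i, contC (F i)) -> contC (fun t => \sum_(i <- r) F i t).
Proof.
move=> H; elim: r => [|i r ih].
  by under eq_fun do rewrite big_nil; exact: contC_cst.
by under eq_fun do rewrite big_cons; exact: contC_add.
Qed.
Lemma deriveC_contC f df : (forall t, is_deriveC f t (df t)) -> contC f.
Proof.
by move=> H; split; [apply: deriv_continuous (fun t => (H t).1)|apply: deriv_continuous (fun t => (H t).2)].
Qed.

Lemma segC_add a b f g : contC f -> contC g ->
  segC a b (fun t => f t + g t) = segC a b f + segC a b g.
Proof.
move=> [f1 f2] [g1 g2]; apply: complexP; rewrite ?cReD ?cImD /=.
  rewrite (_ : (fun t => Re (f t + g t)) = (fun t => Re (f t) + Re (g t))); first exact: seg_intD.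
  by apply/funext => t; exact: cReD.
rewrite (_ : (fun t => Im (f t + g t)) = (fun t => Im (f t) + Im (g t))); first exact: seg_intD.
by apply/funext => t; exact: cImD.
Qed.
Lemma segC_scale a b (z : R[i]) f : contC f ->
  segC a b (fun t => z * f t) = z * segC a b f.
Proof.
move=> [f1 f2]; apply: complexP; rewrite ?cReM ?cImM /=.
  have -> : (fun t => Re (z * f t)) = (fun t => Re z * Re (f t) + (- Im z) * Im (f t)).
    by apply/funext => t; rewrite cReM mulNr.
  have k (c : R) (F : R -> R) : continuous F -> continuous (fun t => c * F t).
    by move=> cF; apply: cont_mul => //; exact: cst_continuous.
  rewrite seg_intD; [|exact: k|exact: k].
  by rewrite (seg_intZ (Re z)) // (seg_intZ (- Im z)) // mulNr.
have -> : (fun t => Im (z * f t)) = (fun t => Re z * Im (f t) + Im z * Re (f t)).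
  by apply/funext => t; rewrite cImM.
have k (c : R) (F : R -> R) : continuous F -> continuous (fun t => c * F t).
  by move=> cF; apply: cont_mul => //; exact: cst_continuous.
rewrite seg_intD; [|exact: k|exact: k].
by rewrite (seg_intZ (Re z)) // (seg_intZ (Im z)).
Qed.
Lemma segC_sum (I : Type) (r : seq I) a b (F : I -> R -> R[i]) : (forall i, contC (F i)) ->
  segC a b (fun t => \sum_(i <- r) F i t) = \sum_(i <- r) segC a b (F i).
Proof.
move=> H; elim: r => [|i r ih].
  rewrite big_nil; under eq_fun do rewrite big_nil.
  transitivity (0 * segC a b (fun=> 0)); last by rewrite mul0r.
  rewrite -(segC_scale _ _ _ (contC_cst 0)).
  by congr segC; apply/funext => t; rewrite mul0r.
rewrite big_cons -ih -segC_add //; last exact: contC_sum.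
by congr segC; apply/funext => t; rewrite big_cons.
Qed.
Lemma segC_dom a b f (F : R -> R) : contC f -> continuous F ->
  (forall t, a <= t <= b -> normc (f t) <= F t) ->
  normc (segC a b f) <= 2 * \int[mu]_(t in `[a, b]) F t.
Proof.
move=> [f1 f2] cF H; rewrite (le_trans (normc_le _)) //= mulr2n mulrDl mul1r.
have K (G : R -> R) : continuous G -> (forall t, `|G t| <= normc (f t)) ->
    `|\int[mu]_(t in `[a, b]) G t| <= \int[mu]_(t in `[a, b]) F t.
  move=> cG GF; rewrite ler_norml; apply/andP; split; last first.
    by apply: seg_int_le => // t tt; apply: le_trans (H t tt); apply: le_trans (GF t); exact: ler_norm.
  rewrite -mulN1r -seg_intZ //.
  have cN : continuous (fun t => -1 * F t) by apply: cont_mul => //; exact: cst_continuous.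
  apply: seg_int_le => // t tt; rewrite mulN1r lerNl.
  by apply: le_trans (H t tt); apply: le_trans (GF t); rewrite -normrN; exact: ler_norm.
by apply: lerD; apply: K => // t; rewrite ?normc_Re ?normc_Im.
Qed.
Lemma segC_bound a b f S : a <= b -> contC f -> (forall t, a <= t <= b -> normc (f t) <= S) ->
  normc (segC a b f) <= 2 * S * (b - a).
Proof.
move=> ab cf H; rewrite -mulrA -(seg_int_cst S ab); apply: segC_dom => //; exact: cst_continuous.
Qed.

Lemma seg_FTC (F f : R -> R) a b : a < b -> continuous f -> (forall t : R, is_derive t 1 F (f t)) ->
  \int[mu]_(t in `[a, b]) f t = F b - F a.
Proof.
move=> ab cf H; have cF := deriv_continuous H.
rewrite /Rintegral (@continuous_FTC2 _ f F a b ab) //.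
- exact: continuous_subspaceT.
- split.
  + by move=> t _; case: (H t).
  + by apply: cvg_at_right_filter; exact: cF.
  + by apply: cvg_at_left_filter; exact: cF.
- by move=> t _; rewrite derive1E; case: (H t).
Qed.
Lemma segC_FTC f df a b : a < b -> contC df -> (forall t, is_deriveC f t (df t)) ->
  segC a b df = f b - f a.
Proof.
move=> ab [c1 c2] H; apply: complexP; rewrite ?cReD ?cImD ?cReN ?cImN /=.
  exact: (seg_FTC ab c1 (fun t => (H t).1)).
exact: (seg_FTC ab c2 (fun t => (H t).2)).
Qed.

Lemma seg_int_shrink (F : R -> R) a b a' b' : a <= a' -> b' <= b ->
  (forall t, ~~ (a' <= t <= b') -> F t = 0) ->
  \int[mu]_(t in `[a, b]) F t = \int[mu]_(t in `[a', b']) F t.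
Proof.
move=> aa bb F0; rewrite Rintegral_mkcond [RHS]Rintegral_mkcond.
congr (Rintegral _ _ _); apply/funext => t; rewrite !patchE.
case: ifPn => [_|tab]; case: ifPn => [tab'|tab'] //.
  apply: F0; apply/negP => h; move/negP: tab'; apply.
  by rewrite inE /= in_itv.
exfalso; move/negP: tab; apply; move: tab'; rewrite !inE /= !in_itv /= => /andP[h1 h2].
by rewrite (le_trans aa h1) (le_trans h2 bb).
Qed.
Lemma segC_shrink f a b a' b' : a <= a' -> b' <= b ->
  (forall t, ~~ (a' <= t <= b') -> f t = 0) -> segC a b f = segC a' b' f.
Proof.
by move=> aa bb F0; apply: complexP => /=; apply: seg_int_shrink => // t tt; rewrite F0.
Qed.

Definition cis (x : R) : R[i] := cos x +i* sin x.
Lemma cis0 : cis 0 = 1. Proof. by rewrite /cis cos0 sin0. Qed.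
Lemma cisD x y : cis (x + y) = cis x * cis y.
Proof. by rewrite /cis cosD sinD; apply: complexP; rewrite ?cReM ?cImM /=; ring. Qed.
Lemma cisX x n : cis x ^+ n = cis (n%:R * x).
Proof. by elim: n => [|n ih]; rewrite ?expr0 ?mul0r ?cis0 // exprS ih -cisD -natr1 mulrDl mul1r addrC. Qed.
Lemma cisN x : cis (- x) = conjc (cis x).
Proof. by rewrite /cis cosN sinN. Qed.
Lemma is_deriveC_cis (k t0 t : R) : is_deriveC (fun t => cis (k * (t - t0))) t ('i%C * k%:C * cis (k * (t - t0))).
Proof.
have D : is_derive t 1 (fun t => k * (t - t0)) k.
  apply: (is_derive_eq (is_deriveZ k (is_deriveB (is_derive_id t 1) (is_derive_cst t0 t 1)))).
  by rewrite /GRing.scale /= subr0 mulr1.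
split.
  have H := is_derive1_comp (f := cos) (g := fun t => k * (t - t0)) (is_derive_cos _) D.
  apply: (is_derive_eq H).
  by rewrite cReM cReM cImM /=; ring.
have H := is_derive1_comp (f := sin) (g := fun t => k * (t - t0)) (is_derive_sin _) D.
apply: (is_derive_eq H).
by rewrite cImM cReM cImM /=; ring.
Qed.
Lemma contC_cis (k t0 : R) : contC (fun t => cis (k * (t - t0))).
Proof. exact: deriveC_contC (fun t => is_deriveC_cis k t0 t). Qed.

Lemma cis_int_period (k : int) : cis (k%:~R * pi) = cis (- (k%:~R * pi)).
Proof.
rewrite /cis cosN sinN; suff -> : sin (k%:~R * pi) = 0 :> R by rewrite oppr0.
have N n : sin (n%:R * pi) = 0 :> R.
  by elim: n => [|n ih]; rewrite ?mul0r ?sin0 // -natr1 mulrDl mul1r sinDpi ih oppr0.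
case: k => n; first exact: N.
by rewrite NegzE mulrNz mulNr sinN N oppr0.
Qed.
Lemma segC_cis (k : int) t0 : k != 0 ->
  segC (t0 - pi) (t0 + pi) (fun t => cis (k%:~R * (t - t0))) = 0.
Proof.
move=> k0; have pp : t0 - pi < t0 + pi :> R.
  by have := pi_gt0 R; lra.
have kR : k%:~R != 0 :> R by rewrite intr_eq0.
have c := contC_cis k%:~R t0.
have := segC_FTC pp (contC_mul (contC_cst ('i%C * (k%:~R)%:C)) c) (fun t => is_deriveC_cis k%:~R t0 t).
rewrite segC_scale // addrAC subrr add0r addrAC subrr add0r mulrN cis_int_period subrr.
move=> /eqP; rewrite mulf_eq0 => /orP[|/eqP //]; rewrite mulf_eq0 => /orP[] /eqP /(congr1 (fun z => (Re z, Im z))) /=.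
  by case=> /eqP; rewrite oner_eq0.
by case=> /eqP; rewrite (negbTE kR).
Qed.

(** The Fejer kernel below is |dirich|^2 / N: nonnegative by construction, with
    coefficients known from expanding the square. *)
Definition dirich N s : R[i] := \sum_(j < N) cis (j%:R * s).
Definition fejer N s : R := N%:R^-1 * normc (dirich N s) ^+ 2.

Lemma normc_sqr (z : R[i]) : (normc z ^+ 2)%:C = z * conjc z.
Proof.
case: z => a b; rewrite /= sqr_sqrtr ?addr_ge0 ?sqr_ge0 //.
by apply: complexP; rewrite ?cReM ?cImM /=; ring.
Qed.

Lemma fejerE N s : (fejer N s)%:C =
  (N%:R^-1)%:C * \sum_(j < N) \sum_(l < N) cis ((Posz j - Posz l)%:~R * s).
Proof.
rewrite /fejer (_ : (_ * _)%:C = (N%:R^-1)%:C * (normc (dirich N s) ^+ 2)%:C); last first.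
  by apply: complexP; rewrite ?cReM ?cImM /=; ring.
congr (_ * _); rewrite normc_sqr /dirich rmorph_sum mulr_suml; apply: eq_bigr => j _.
rewrite mulr_sumr; apply: eq_bigr => l _.
rewrite -[X in _ * X = _]/(conjc (cis (l%:R * s))) -cisN -cisD.
by congr cis; rewrite intrD intrN /= mulrDl mulNr.
Qed.

Lemma fejer_ge0 N s : 0 <= fejer N s.
Proof. by rewrite mulr_ge0 ?invr_ge0 ?ler0n // sqr_ge0. Qed.

(** Geometric sum: (e^(i s) - 1) dirich is bounded by 2. *)
Lemma fejer_decay N s : (0 < N)%N -> fejer N s * (2 - 2 * cos s) <= 4 / N%:R.
Proof.
move=> N0; have -> : 2 - 2 * cos s = normc (cis s - 1) ^+ 2.
  rewrite /cis /= subr0 sqr_sqrtr ?addr_ge0 ?sqr_ge0 //.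
  have := cos2Dsin2 s; rewrite sqrrB; lra.
have g : (cis s - 1) * dirich N s = cis (N%:R * s) - 1.
  rewrite -cisX subrX1; congr (_ * _); apply: eq_bigr => j _; by rewrite cisX.
have h : normc (cis s - 1) * normc (dirich N s) <= 2.
  rewrite -Normc.normcM g; apply: le_trans (normc_distD _ _) _.
  by rewrite normc_cis Normc.normc1.
rewrite /fejer mulrC mulrCA -exprMn (_ : 4 / N%:R = N%:R^-1 * 2 ^+ 2); last first.
  by rewrite mulrC; congr (_ * _); rewrite -natrX.
apply: ler_wpM2l; first by rewrite invr_ge0 ler0n.
apply: lerXn2r => //; rewrite nnegrE // mulr_ge0 // normc_ge0 //.
Qed.

Lemma contC_fejer N t0 : contC (fun t => (fejer N (t - t0))%:C).
Proof.
under eq_fun do rewrite fejerE; apply: contC_mul; first exact: contC_cst.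
by apply: contC_sum => j; apply: contC_sum => l; exact: contC_cis.
Qed.

Lemma segC_fejer N t0 (h : R -> R[i]) a b : contC h ->
  segC a b (fun t => h t * (fejer N (t - t0))%:C) = (N%:R^-1)%:C *
   \sum_(j < N) \sum_(l < N) segC a b (fun t => h t * cis ((Posz j - Posz l)%:~R * (t - t0))).
Proof.
move=> ch.
have cc (k : int) : contC (fun t => h t * cis (k%:~R * (t - t0))).
  by apply: contC_mul => //; exact: contC_cis.
have -> : (fun t => h t * (fejer N (t - t0))%:C) = (fun t => (N%:R^-1)%:C *
   \sum_(j < N) \sum_(l < N) (h t * cis ((Posz j - Posz l)%:~R * (t - t0)))).
  apply/funext => t; rewrite fejerE mulrCA mulr_sumr; congr (_ * _).
  by apply: eq_bigr => j _; rewrite mulr_sumr.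
rewrite segC_scale; last by apply: contC_sum => j; apply: contC_sum => l; exact: cc.
congr (_ * _); rewrite segC_sum; last by move=> j; apply: contC_sum => l; exact: cc.
by apply: eq_bigr => j _; rewrite segC_sum.
Qed.

Lemma segC_cst (z : R[i]) a b : a <= b -> segC a b (fun=> z) = z * (b - a)%:C.
Proof.
by move=> ab; apply: complexP; rewrite ?cReM ?cImM /= seg_int_cst //; ring.
Qed.

Lemma fejer_mass N t0 : (0 < N)%N ->
  segC (t0 - pi) (t0 + pi) (fun t => (fejer N (t - t0))%:C) = (2 * pi)%:C.
Proof.
move=> N0; have pp := pi_gt0 R.
have -> : (fun t => (fejer N (t - t0))%:C) = (fun t => 1 * (fejer N (t - t0))%:C).
  by apply/funext => t; rewrite mul1r.
rewrite (segC_fejer _ _ _ _ (contC_cst 1)).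
have E (j l : 'I_N) : segC (t0 - pi) (t0 + pi) (fun t => 1 * cis ((Posz j - Posz l)%:~R * (t - t0)))
   = if l == j then (2 * pi)%:C else 0.
  have -> : (fun t => 1 * cis ((Posz j - Posz l)%:~R * (t - t0))) =
            (fun t => cis ((Posz j - Posz l)%:~R * (t - t0))).
    by apply/funext => t; rewrite mul1r.
  case: eqP => [->|ne].
    have -> : (fun t => cis ((Posz j - Posz j)%:~R * (t - t0))) = fun=> 1.
      by apply/funext => t; rewrite subrr mul0r cis0.
    by rewrite segC_cst; [rewrite mul1r; congr (_%:C); ring|lra].
  apply: segC_cis; rewrite subr_eq0; apply/eqP => -[] /val_inj h; exact: ne.
under eq_bigr => j _.
  under eq_bigr => l _ do rewrite E.
  rewrite -big_mkcond big_pred1_eq.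
  over.
have NR : N%:R != 0 :> R by rewrite pnatr_eq0 -lt0n.
have -> : \sum_(j < N) (2 * pi : R)%:C = (N%:R * (2 * pi))%:C :> R[i].
  rewrite sumr_const card_ord; elim: (N) => [|n ih]; first by rewrite mulr0n mul0r.
  rewrite mulrSr ih; apply: complexP; rewrite ?cReD ?cImD /=; last by rewrite addr0.
  by rewrite -natr1; ring.
by apply: complexP; rewrite ?cReM ?cImM /=; [rewrite mulr0 subr0 mulKf|ring].
Qed.

(** Near 0 the factor |s| is small; away from 0 the kernel is O(1/N).  No sharper
    property of an approximate identity is needed for Lipschitz functions. *)
Lemma fejer_moment N s eps eta : (0 < N)%N -> 0 < eps -> eps <= pi -> `|s| <= pi ->
  eta = 2 - 2 * cos eps -> 0 < eta -> `|s| * fejer N s <= eps * fejer N s + pi * (4 / (N%:R * eta)).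
Proof.
move=> N0 e0 epi spi etaE eta0.
have F0 := fejer_ge0 N s; have pp := pi_gt0 R.
have NR : 0 < N%:R :> R by rewrite ltr0n.
have q0 : 0 <= pi * (4 / (N%:R * eta)).
  by rewrite mulr_ge0 ?(ltW pp) // divr_ge0 // mulr_ge0 // ltW.
have [se|se] := leP `|s| eps.
  by rewrite -[leLHS]addr0 lerD // ler_wpM2r.
have cs : cos s <= cos eps.
  rewrite -(cos_norm s) ltW // ltr_cos // in_itv /=; [by rewrite (ltW e0)|by rewrite normr_ge0].
have Fd := fejer_decay s N0.
have : fejer N s * eta <= 4 / N%:R.
  by apply: le_trans Fd; rewrite ler_wpM2l // etaE; lra.
rewrite -ler_pdivlMr // => Fb.
have -> : 4 / (N%:R * eta) = 4 / N%:R / eta by field; rewrite !gt_eqF.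
apply: (@le_trans _ _ (pi * (4 / N%:R / eta))); first by apply: ler_pM.
by rewrite lerDr mulr_ge0 // ltW.
Qed.

(** The integrals of h against the Fejer kernels at t0 tend to 2 pi h t0, and the N-th
    one is an average of sums over windows of N consecutive Fourier coefficients.  The support
    condition makes h fit in a period around t0. *)
Theorem fourier_sup (h : R -> R[i]) (c L B : R) (b : int -> R) : contC h ->
  (forall t, ~~ (c - 1 <= t <= c + 1) -> h t = 0) ->
  (forall s t, normc (h t - h s) <= L * `|t - s|) ->
  (forall k : int, normc (segC (c - 1) (c + 1) (fun t => h t * cis (- (k%:~R * t)))) <= b k) ->
  (forall N j, \sum_(l < N) b (Posz l - Posz j) <= B) ->
  forall t0, normc (h t0) <= B.
Proof.
move=> ch hsupp hL hb hB t0.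
have B0 : 0 <= B by have := hB 0%N 0%N; rewrite big_ord0.
have [t0c|/hsupp ->] := boolP (c - 1 <= t0 <= c + 1); last by rewrite Normc.normc0.
have pp := pi_gt0 R; have p2 := pi_ge2 R.
have I1 : t0 - pi <= c - 1 by move/andP: t0c => [_ ?]; lra.
have I2 : c + 1 <= t0 + pi by move/andP: t0c => [? _]; lra.
have Ile : t0 - pi <= t0 + pi by lra.
have L0 : 0 <= L.
  by have := hL 0 1; rewrite subr0 normr1 mulr1; apply: le_trans; exact: normc_ge0.
have coef (j l : nat) : normc (segC (t0 - pi) (t0 + pi) (fun t => h t * cis ((Posz j - Posz l)%:~R * (t - t0))))
    <= b (Posz l - Posz j).
  have ck : contC (fun t => h t * cis (- ((Posz l - Posz j)%:~R * t))).
    apply: contC_mul => //.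
    have -> : (fun t => cis (- ((Posz l - Posz j)%:~R * t))) = (fun t => cis (- (Posz l - Posz j)%:~R * (t - 0))).
      by apply/funext => t; rewrite subr0 mulNr.
    exact: contC_cis.
  have -> : (fun t => h t * cis ((Posz j - Posz l)%:~R * (t - t0))) =
     (fun t => cis ((Posz l - Posz j)%:~R * t0) * (h t * cis (- ((Posz l - Posz j)%:~R * t)))).
    apply/funext => t; rewrite mulrCA -cisD; congr (_ * cis _).
    by rewrite -(opprB (Posz l)) mulrNz; ring.
  rewrite segC_scale // Normc.normcM normc_cis mul1r.
  rewrite (segC_shrink I1 I2) => [|t /hsupp ->]; last by rewrite mul0r.
  exact: hb.
have main N : (0 < N)%N -> normc (segC (t0 - pi) (t0 + pi) (fun t => h t * (fejer N (t - t0))%:C)) <= B.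
  move=> N0; rewrite (segC_fejer _ _ _ _ ch) Normc.normcM normc_real ger0_norm ?invr_ge0 ?ler0n //.
  rewrite ler_pdivrMl ?ltr0n //.
  have sumle (I : finType) (F : I -> R[i]) : normc (\sum_i F i) <= \sum_i normc (F i).
    elim/big_rec2 : _ => [|i x y _ h1]; first by rewrite Normc.normc0.
    by apply: le_trans (le_normcD _ _) _; rewrite lerD2l.
  apply: le_trans (sumle _ _) _.
  have -> : N%:R * B = \sum_(j < N) B by rewrite sumr_const card_ord mulr_natl.
  apply: ler_sum => j _; apply: le_trans (sumle _ _) _.
  by apply: le_trans (hB N j); apply: ler_sum => l _; exact: coef.
suff H : 2 * pi * normc (h t0) <= B.
  apply: le_trans H; rewrite -[leLHS]mul1r ler_wpM2r ?normc_ge0 //; lra.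
apply: (@le_limit _ _ _ (2 * L * (2 * pi + 1))) => eps e0 e1.
pose eta := 2 - 2 * cos eps.
have epi : eps <= pi by lra.
have eta0 : 0 < eta.
  have : cos eps < cos 0 by rewrite ltr_cos // in_itv /= ?lexx ?(ltW pp) ?(ltW e0).
  rewrite cos0 /eta; lra.
(* N large enough for the part of the Fejer kernel off the eps-neighbourhood of t0
   to contribute at most eps *)
pose X := pi * 4 * (2 * pi) / eta / eps.
have X0 : 0 <= X by rewrite /X !mulr_ge0 ?invr_ge0 // ltW.
pose N := Num.bound X.
have NX : X < N%:R by exact: archi_boundP.
have NR : 0 < N%:R :> R by exact: le_lt_trans NX.
have N0 : (0 < N)%N by rewrite -(ltr0n R).
have cF := contC_fejer N t0.
have cF' : continuous (fun t => fejer N (t - t0)) by have [] := cF.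
have dE : segC (t0 - pi) (t0 + pi) (fun t => h t0 * (fejer N (t - t0))%:C) =
  h t0 * (2 * pi)%:C.
  by rewrite segC_scale // fejer_mass.
have dI : segC (t0 - pi) (t0 + pi) (fun t => h t0 * (fejer N (t - t0))%:C) =
  segC (t0 - pi) (t0 + pi) (fun t => h t * (fejer N (t - t0))%:C) +
  segC (t0 - pi) (t0 + pi) (fun t => (h t0 - h t) * (fejer N (t - t0))%:C).
  rewrite -segC_add; last first.
  - by apply: contC_mul => //; apply: contC_add; [exact: contC_cst|exact: contC_opp].
  - exact: contC_mul.
  by congr segC; apply/funext => t; ring.
pose Gf t := L * (eps * fejer N (t - t0) + pi * (4 / (N%:R * eta))).
have cc (k : R) (F : R -> R) : continuous F -> continuous (fun t => k * F t).
  by move=> cFF; apply: cont_mul => //; exact: cst_continuous.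
have cG1 : continuous (fun t => eps * fejer N (t - t0) + pi * (4 / (N%:R * eta))).
  by apply: cont_add; [exact: cc|exact: cst_continuous].
have cG : continuous Gf by exact: cc.
have errb t : t0 - pi <= t <= t0 + pi -> normc ((h t0 - h t) * (fejer N (t - t0))%:C) <= Gf t.
  move=> tt; rewrite Normc.normcM normc_real ger0_norm ?fejer_ge0 //.
  have tpi : `|t - t0| <= pi by rewrite ler_norml; move/andP: tt => [? ?]; apply/andP; split; lra.
  apply: (@le_trans _ _ (L * `|t - t0| * fejer N (t - t0))).
    by rewrite ler_wpM2r ?fejer_ge0 // -(distrC t0) hL.
  by rewrite -mulrA ler_wpM2l //; exact: (fejer_moment N0 e0 epi tpi erefl eta0).
have err := segC_dom (contC_mul (contC_add (contC_cst (h t0)) (contC_opp ch)) cF) cG errb.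
have massR : \int[mu]_(t in `[(t0 - pi), (t0 + pi)]) fejer N (t - t0) = 2 * pi.
  by have := congr1 (@complex.Re R) (fejer_mass t0 N0).
have GI : \int[mu]_(t in `[(t0 - pi), (t0 + pi)]) Gf t <= L * (eps * (2 * pi + 1)).
  rewrite seg_intZ // ler_wpM2l // seg_intD; [|exact: cc|exact: cst_continuous].
  rewrite (seg_intZ eps _ _ cF') massR seg_int_cst // [leRHS]mulrDr mulr1 lerD2l.
  have -> : pi * (4 / (N%:R * eta)) * (t0 + pi - (t0 - pi)) = X * eps / N%:R.
    by rewrite /X; field; rewrite !gt_eqF.
  by rewrite ler_pdivrMr // mulrC ler_wpM2l ?(ltW e0) // ltW.
have -> : 2 * pi * normc (h t0) = normc (h t0 * (2 * pi)%:C).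
  rewrite Normc.normcM normc_real ger0_norm ?mulr_ge0 // ?(ltW pp) //; ring.
rewrite -dE dI; apply: le_trans (le_normcD _ _) _; apply: lerD; first exact: main.
apply: le_trans err _; have -> : eps * (2 * L * (2 * pi + 1)) = 2 * (L * (eps * (2 * pi + 1))) by ring.
by rewrite ler_wpM2l.
Qed.

End SegC.

(** * Integration in one of the variables *)

Section PartialIntegral.
Variables (R : realType) (n : nat).
Notation mu := (@lebesgue_measure R).
Local Notation normc := Normc.normc.
Local Notation Re := complex.Re.
Local Notation Im := complex.Im.
Implicit Types (g : 'rV[R]_n -> R) (f : 'rV[R]_n -> R[i]) (p q : 'rV[R]_n) (i j : 'I_n).

Variables (j : 'I_n) (a b : R).
Hypothesis ab : a < b.

(** Partial integral in the variable j; the result no longer depends on it. *)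
Definition Jr g p : R := \int[mu]_(t in `[a, b]) g (upd p j t).

Lemma slice_continuous g p : smoothR g -> continuous (fun t => g (upd p j t)).
Proof.
by move=> sg; apply: deriv_continuous (fun t => is_derive_upd (smoothR_derivable sg)).
Qed.

Lemma upd_norm p t : a <= t <= b -> `|upd p j t| <= `|p| + (`|a| + `|b|).
Proof.
move=> tt; apply: rV_norm_le => [|k]; first by rewrite !addr_ge0.
rewrite updE; case: eqP => _; last by rewrite (le_trans (rV_coord_norm p k)) // lerDl addr_ge0.
rewrite (le_trans (y := `|a| + `|b|)) ?lerDr //.
case/andP: tt => t1 t2; rewrite ler_norml; apply/andP; split.
  by have := ler_norm (- a); rewrite normrN; have := normr_ge0 b; lra.
by have := ler_norm b; have := normr_ge0 a; lra.
Qed.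

Lemma Jr_diff g p q : smoothR g -> Jr g q - Jr g p = \int[mu]_(t in `[a, b]) (g (upd q j t) - g (upd p j t)).
Proof.
move=> sg; have cp := @slice_continuous g p sg; have cq := @slice_continuous g q sg.
rewrite /Jr seg_intD //; last exact: cont_opp.
congr (_ + _); rewrite -mulN1r -seg_intZ //.
by apply: eq_seg_int => t _; rewrite mulN1r.
Qed.

Lemma Jr_continuous g : smoothR g -> continuous (Jr g).
Proof.
move=> sg p; pose M := `|p| + 1 + (`|a| + `|b|).
have [B B0 HB] := smoothR_lip M sg.
apply: (@cvgrPdist_lt _ _ _ (nbhs (p : 'rV[R]_n)) (nbhs_filter _) _ _).2 => e e0.
have K0 : 0 < B * (b - a) + 1 by rewrite ltr_wpDl // mulr_ge0 // subr_ge0 ltW.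
apply/nbhs_ballP; exists (Num.min 1 (e / (B * (b - a) + 1))) => /=.
  by rewrite lt_min ltr01 divr_gt0.
move=> q; rewrite -ball_normE /= => pq.
move: pq; rewrite lt_min => /andP[pq1 pq2].
have qM : `|q| <= `|p| + 1.
  have -> : q = p - (p - q) by rewrite opprB addrC subrK.
  by rewrite (le_trans (ler_normB _ _)) // lerD2l ltW.
rewrite Jr_diff //; apply: (@le_lt_trans _ _ (B * `|p - q| * (b - a))).
  apply: seg_int_bound; [exact: ltW|apply: cont_add; [exact: slice_continuous|apply: cont_opp; exact: slice_continuous]|].
  move=> t tt; apply: le_trans (HB _ _ _ _) _.
  - by rewrite (le_trans (upd_norm q tt)) // /M lerD2r.
  - by rewrite (le_trans (upd_norm p tt)) // /M lerD2r lerDl.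
  apply: ler_wpM2l => //; apply: rV_norm_le => // k; rewrite !mxE.
  by case: eqP => _; rewrite ?subrr ?normr0 //; have := rV_coord_norm (p - q) k; rewrite !mxE.
move: pq2; rewrite ltr_pdivlMr // => h; apply: le_lt_trans h.
have -> : B * `|p - q| * (b - a) = `|p - q| * (B * (b - a)) by ring.
by rewrite ler_wpM2l // lerDl.
Qed.

Lemma is_derive_Jr g p i : smoothR g -> i != j -> is_derive p 'e_i (Jr g) (Jr (pd i g) p).
Proof.
move=> sg ij; apply/is_derive_dir.
pose M := `|p| + 1 + (`|a| + `|b|).
have [B B0 HB] := smoothR_taylor M sg.
apply: (@is_derive_quad _ _ _ _ (B * (b - a)) 1 ltr01) => h h1.
rewrite addr0 scale0r add0r.
have E : Jr g (h *: 'e_i + p) - Jr g p - h * Jr (pd i g) p =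
  \int[mu]_(t in `[a, b]) (g (upd (h *: 'e_i + p) j t) - g (upd p j t) - h * pd i g (upd p j t)).
  rewrite Jr_diff //.
  have c1 : continuous (fun t => g (upd (h *: 'e_i + p) j t) - g (upd p j t)).
    by apply: cont_add; [exact: slice_continuous|apply: cont_opp; exact: slice_continuous].
  have c2 : continuous (fun t => pd i g (upd p j t)) by apply: slice_continuous; exact: smoothR_pd.
  rewrite [RHS]seg_intD //; last by apply: cont_opp; apply: cont_mul => //; exact: cst_continuous.
  congr (_ + _); rewrite -mulNr -seg_intZ //.
  by apply: eq_seg_int => t _; rewrite mulNr.
rewrite E [B * _ * _]mulrAC; apply: seg_int_bound.
- exact: ltW.
- apply: cont_add; first by apply: cont_add; [exact: slice_continuous|apply: cont_opp; exact: slice_continuous].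
  by apply: cont_opp; apply: cont_mul; [exact: cst_continuous|apply: slice_continuous; exact: smoothR_pd].
move=> t tt.
have e1 : `|'e_i : 'rV[R]_n| <= 1.
  by apply: rV_norm_le => // k; rewrite mxE eqxx /=; case: eqP => _; rewrite ?normr1 ?normr0.
have hp : `|h *: 'e_i + p| <= `|p| + 1.
  rewrite (le_trans (ler_normD _ _)) // addrC lerD2l normrZ -[leRHS]mulr1 ler_pM //; exact: ltW.
have U : upd (h *: 'e_i + p) j t = h *: 'e_i + upd p j t.
  apply/rowP => k; rewrite !mxE eqxx /=; case: eqP => [->|//].
  by rewrite eq_sym (negbTE ij) mulr0 add0r.
have := HB (upd p j t) (upd (h *: 'e_i + p) j t).
have -> : \sum_j0 (upd (h *: 'e_i + p) j t ord0 j0 - upd p j t ord0 j0) * pd j0 g (upd p j t)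
  = h * pd i g (upd p j t).
  rewrite U (bigD1 i) //= big1 => [|k ki].
    by rewrite addr0 !mxE !eqxx /= mulr1 addrK.
  by rewrite !mxE eqxx /= (negbTE ki) mulr0 add0r subrr mul0r.
move=> H; apply: le_trans (H _ _) _.
- by rewrite (le_trans (upd_norm p tt)) // /M lerD2r lerDl.
- by rewrite (le_trans (upd_norm _ tt)) // /M lerD2r.
apply: ler_wpM2l => //; rewrite U addrK; apply: lerXn2r; rewrite ?nnegrE //.
by rewrite normrZ -[leRHS]mulr1 ler_pM.
Qed.

Lemma Jr_upd g p t : Jr g (upd p j t) = Jr g p.
Proof. by rewrite /Jr; under eq_Rintegral do rewrite upd_upd. Qed.

Lemma is_derive_Jr_self g p : is_derive p 'e_j (Jr g) 0.
Proof.
apply/is_derive_dir.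
have -> : (fun h : R => Jr g (h *: 'e_j + p)) = cst (Jr g p).
  by apply/funext => h; rewrite add_updE Jr_upd.
exact: is_derive_cst.
Qed.

Lemma Jr_cst0 p : Jr (fun=> 0) p = 0.
Proof. by rewrite /Jr seg_int_cst ?mul0r // ltW. Qed.

Lemma pd_Jr g i : smoothR g -> i != j -> pd i (Jr g) = Jr (pd i g).
Proof. by move=> sg ij; apply/funext => p; exact: (pd_derive (is_derive_Jr p sg ij)). Qed.
Lemma pd_Jr_self g : pd j (Jr g) = fun=> 0.
Proof. by apply/funext => p; exact: (pd_derive (is_derive_Jr_self g p)). Qed.

Lemma smoothR_Jr g : smoothR g -> smoothR (Jr g).
Proof.
move=> sg; apply: (@smoothR_coind _ _ (fun G => exists2 g, smoothR g & G = Jr g)); last by exists g.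
  move=> _ [k sk ->]; split; first exact: Jr_continuous.
  move=> x i; have [->|ij] := eqVneq i j; first by case: (is_derive_Jr_self k x).
  by case: (is_derive_Jr x sk ij).
move=> _ i [k sk ->]; have [->|ij] := eqVneq i j.
  exists (fun=> 0); first exact: cst_smoothR.
  by rewrite pd_Jr_self; apply/funext => p; rewrite Jr_cst0.
by exists (pd i k); [exact: smoothR_pd|exact: pd_Jr].
Qed.

Lemma Jr_pd_self g p : smoothR g -> g (upd p j a) = 0 -> g (upd p j b) = 0 -> Jr (pd j g) p = 0.
Proof.
move=> sg ga gb; rewrite /Jr (seg_FTC ab _ (fun t => is_derive_upd (smoothR_derivable sg))).
  by rewrite ga gb subrr.
by apply: slice_continuous; exact: smoothR_pd.
Qed.

Definition JC f p : R[i] := segC a b (fun t => f (upd p j t)).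

Lemma slice_contC f p : smooth f -> contC (fun t => f (upd p j t)).
Proof. by move=> /smoothE[s1 s2]; split; [exact: (@slice_continuous _ p s1)|exact: (@slice_continuous _ p s2)]. Qed.

Lemma smooth_JC f : smooth f -> smooth (JC f).
Proof.
by move=> /smoothE[s1 s2]; apply/smoothE; split; [exact: (smoothR_Jr s1)|exact: (smoothR_Jr s2)].
Qed.

Lemma partialC_JC f i : smooth f -> i != j -> partialC i (JC f) = JC (partialC i f).
Proof.
move=> /smoothE[s1 s2] ij; apply/funext => p; apply: complexP.
  exact: (congr1 (fun G => G p) (pd_Jr s1 ij)).
exact: (congr1 (fun G => G p) (pd_Jr s2 ij)).
Qed.

(** Integration by parts: exact derivatives in the integrated variable drop out
    when f vanishes at both ends. *)
Lemma JC_partial_self f p : smooth f -> f (upd p j a) = 0 -> f (upd p j b) = 0 ->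
  JC (partialC j f) p = 0.
Proof.
move=> /smoothE[s1 s2] fa fb; apply: complexP.
  by apply: (Jr_pd_self s1); rewrite ?fa ?fb.
by apply: (Jr_pd_self s2); rewrite ?fa ?fb.
Qed.

Lemma JC_add f (g : 'rV[R]_n -> R[i]) p : smooth f -> smooth g -> JC (fun q => f q + g q) p = JC f p + JC g p.
Proof. by move=> sf sg; apply: segC_add; exact: slice_contC. Qed.

Lemma JC_mul f (g : 'rV[R]_n -> R[i]) p : smooth g -> (forall q t, f (upd q j t) = f q) ->
  JC (fun q => f q * g q) p = f p * JC g p.
Proof.
move=> sg H; rewrite /JC -segC_scale; last exact: slice_contC.
by congr segC; apply/funext => t; rewrite H.
Qed.

Lemma JC_bound f p S : smooth f -> (forall q, normc (f q) <= S) -> normc (JC f p) <= 2 * S * (b - a).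
Proof. by move=> sf H; apply: segC_bound; [exact: ltW|exact: slice_contC|move=> t _; exact: H]. Qed.

End PartialIntegral.

Section Phase.
Variables (R : realType) (n : nat).
Implicit Types (th : 'rV[R]_n -> R) (f : 'rV[R]_n -> R[i]).

Definition phase th : 'rV[R]_n -> R[i] := fun p => cis (- th p).

Lemma smooth_phase th : smoothR th -> smooth (phase th).
Proof.
move=> sth; apply/smoothE; split; apply: smoothR_alg.
  have -> : (fun z => complex.Re (phase th z)) = (fun z => cos (-1 * th z)).
    by apply/funext => z; rewrite mulN1r.
  by apply/alg_cos/alg_mul; apply: alg_smooth; [exact: cst_smoothR|exact: sth].
have -> : (fun z => complex.Im (phase th z)) = (fun z => sin (-1 * th z)).
  by apply/funext => z; rewrite mulN1r.
by apply/alg_sin/alg_mul; apply: alg_smooth; [exact: cst_smoothR|exact: sth].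
Qed.

Lemma normc_phase th p : Normc.normc (phase th p) = 1.
Proof. exact: normc_cis. Qed.

Lemma partialC_phase th i : smoothR th ->
  partialC i (phase th) = fun p => - ('i%C * (pd i th p)%:C) * phase th p.
Proof.
move=> sth; apply/funext => p.
have := derivableP (smoothR_derivable (p := p) (j := i) sth) => /is_derive_dir D.
have DN := is_deriveN D.
have C1 : is_derive p 'e_i (fun z => cos (- th z)) (- sin (- th p) * - pd i th p).
  apply/is_derive_dir.
  apply: (is_derive1_comp (f := cos) (g := fun h => - th (h *: 'e_i + p)) _ DN).
  by rewrite scale0r add0r; exact: is_derive_cos.
have C2 : is_derive p 'e_i (fun z => sin (- th z)) (cos (- th p) * - pd i th p).
  apply/is_derive_dir.
  apply: (is_derive1_comp (f := sin) (g := fun h => - th (h *: 'e_i + p)) _ DN).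
  by rewrite scale0r add0r; exact: is_derive_sin.
apply: complexP; rewrite ?cReM ?cImM ?cReN ?cImN ?cReM ?cImM /=.
  by case: C1 => _ ->; ring.
by case: C2 => _ ->; ring.
Qed.

End Phase.

(** * Twisted Fourier coefficients on the Heisenberg group *)

Section Heis.
Variable R : realType.
Local Notation N5 := (2 + 2 + 1)%N.
Local Notation normc := Normc.normc.
Implicit Types (f g psi chi : 'rV[R]_N5 -> R[i]) (p q : 'rV[R]_N5).

Lemma ix_eq k l : (ix k == ix l) = (k == l). Proof. by rewrite /ix !eq_lshift. Qed.
Lemma iy_eq k l : (iy k == iy l) = (k == l). Proof. by rewrite /iy eq_lshift eq_rshift. Qed.
Lemma ixy_eq k l : (ix k == iy l) = false. Proof. by rewrite /ix /iy eq_lshift eq_lrshift. Qed.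
Lemma iyx_eq k l : (iy k == ix l) = false. Proof. by rewrite eq_sym ixy_eq. Qed.
Lemma ixu_eq k : (ix k == iu) = false. Proof. by rewrite /ix /iu eq_lrshift. Qed.
Lemma iux_eq k : (iu == ix k) = false. Proof. by rewrite eq_sym ixu_eq. Qed.
Lemma iyu_eq k : (iy k == iu) = false. Proof. by rewrite /iy /iu eq_lrshift. Qed.
Lemma iuy_eq k : (iu == iy k) = false. Proof. by rewrite eq_sym iyu_eq. Qed.
Definition ixE := (ix_eq, iy_eq, ixy_eq, iyx_eq, ixu_eq, iux_eq, iyu_eq, iuy_eq).

Definition Xf k psi := apply_fun (opX R k) psi.
Definition Yf k psi := apply_fun (opY R k) psi.
Definition Uf psi := partialC iu psi.
(** Right-invariant counterpart of Y_k: its Fourier symbol is the constant i eta_k,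
    which makes it suitable for producing decay in eta. *)
Definition opRy (k : 'I_2) : diffop R N5 :=
  (OpPartial (iy k) + OpMul (fun p => (- (p ord0 (ix k) / 2))%:C) * OpPartial iu)%DO.
Definition Rf k psi := apply_fun (opRy k) psi.

Lemma smooth_coord i : smooth (fun p : 'rV[R]_N5 => (p ord0 i)%:C).
Proof. exact: (smooth_real (@coord_smoothR R N5 i)). Qed.

Lemma smoothR_half i (s : R) : smoothR (fun p : 'rV[R]_N5 => s * (p ord0 i / 2)).
Proof.
apply: smoothR_alg; apply: alg_mul; first exact: (alg_smooth (@cst_smoothR R N5 s)).
by apply: alg_mul; [exact: (alg_smooth (@coord_smoothR R N5 i))|exact: (alg_smooth (@cst_smoothR R N5 (2^-1)))].
Qed.

Lemma opX_smooth k : smooth_coefficients (opX R k).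
Proof.
split=> //; split=> //=; apply: smooth_real.
have -> : (fun p : 'rV[R]_N5 => - (p ord0 (iy k) / 2)) = (fun p => -1 * (p ord0 (iy k) / 2)).
  by apply/funext => p; rewrite mulN1r.
exact: smoothR_half.
Qed.
Lemma opY_smooth k : smooth_coefficients (opY R k).
Proof.
split=> //; split=> //=; apply: smooth_real.
have -> : (fun p : 'rV[R]_N5 => p ord0 (ix k) / 2) = (fun p => 1 * (p ord0 (ix k) / 2)).
  by apply/funext => p; rewrite mul1r.
exact: smoothR_half.
Qed.
Lemma opRy_smooth k : smooth_coefficients (opRy k).
Proof.
split=> //; split=> //=; apply: smooth_real.
have -> : (fun p : 'rV[R]_N5 => - (p ord0 (ix k) / 2)) = (fun p => -1 * (p ord0 (ix k) / 2)).
  by apply/funext => p; rewrite mulN1r.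
exact: smoothR_half.
Qed.

Definition bilin p : R := p ord0 (ix 0) * p ord0 (iy 0) + p ord0 (ix 1) * p ord0 (iy 1).
(** The twist by x . y / 2 is what makes X_k act as a plain x_k-derivative on the
    Fourier side. *)
Definition theta3 (mu : R) p : R := mu * (p ord0 iu + bilin p / 2).
Definition theta1 (i : 'I_N5) (eta : R) p : R := eta * p ord0 i.

Lemma is_derive_theta1 i eta p j : is_derive p 'e_j (theta1 i eta) (eta * (i == j)%:R).
Proof.
have D := is_deriveZ eta (is_derive_coord p 'e_j i).
by apply: (is_derive_eq D); rewrite mxE eqxx.
Qed.
Lemma smoothR_theta1 i eta : smoothR (theta1 i eta).
Proof.
apply: smoothR_alg; apply: alg_mul; first exact: (alg_smooth (@cst_smoothR R N5 eta)).
exact: (alg_smooth (@coord_smoothR R N5 i)).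
Qed.

Lemma smoothR_theta3 mu : smoothR (theta3 mu).
Proof.
apply: smoothR_alg; apply: alg_mul; first exact: (alg_smooth (@cst_smoothR R N5 mu)).
apply: alg_add; first exact: (alg_smooth (@coord_smoothR R N5 iu)).
apply: alg_mul; last exact: (alg_smooth (@cst_smoothR R N5 2^-1)).
have c i := alg_smooth (@coord_smoothR R N5 i).
by apply: alg_add; apply: alg_mul; exact: c.
Qed.

Lemma ord2_cases (P : 'I_2 -> Prop) : P 0 -> P 1 -> forall k, P k.
Proof.
move=> P0 P1; case=> [[|[|//]]] lt; first by rewrite (_ : Ordinal lt = 0) //; exact: val_inj.
by rewrite (_ : Ordinal lt = 1) //; exact: val_inj.
Qed.

Lemma is_derive_theta3 mu p j : is_derive p 'e_j (theta3 mu)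
  (mu * ((iu == j)%:R + 2^-1 * (p ord0 (ix 0) * (iy 0 == j)%:R + p ord0 (iy 0) * (ix 0 == j)%:R
     + (p ord0 (ix 1) * (iy 1 == j)%:R + p ord0 (iy 1) * (ix 1 == j)%:R)))).
Proof.
have C i := is_derive_coord p 'e_j i.
have D := is_deriveZ mu (is_deriveD (C iu) (is_deriveZ (2^-1)
  (is_deriveD (is_deriveM (C (ix 0)) (C (iy 0))) (is_deriveM (C (ix 1)) (C (iy 1)))))).
have E : theta3 mu = mu \*: ((fun p : 'rV[R]_N5 => p ord0 iu) + 2^-1 \*: (
    (fun p : 'rV[R]_N5 => p ord0 (ix 0)) * (fun p : 'rV[R]_N5 => p ord0 (iy 0))
  + (fun p : 'rV[R]_N5 => p ord0 (ix 1)) * (fun p : 'rV[R]_N5 => p ord0 (iy 1)))).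
  by apply/funext => q; rewrite /theta3 /bilin [_ / 2]mulrC.
by rewrite E; apply: (is_derive_eq D); rewrite !mxE !eqxx.
Qed.

Lemma pd_theta3_u mu p : pd iu (theta3 mu) p = mu.
Proof. by rewrite (pd_derive (is_derive_theta3 mu p iu)) eqxx !iyu_eq !ixu_eq /=; ring. Qed.
Lemma pd_theta3_x mu p k : pd (ix k) (theta3 mu) p = mu * (p ord0 (iy k) / 2).
Proof.
rewrite (pd_derive (is_derive_theta3 mu p (ix k))) iux_eq !iyx_eq !ix_eq.
by elim/ord2_cases: k; rewrite /= mulr0n !mulr1n; ring.
Qed.
Lemma pd_theta3_y mu p k : pd (iy k) (theta3 mu) p = mu * (p ord0 (ix k) / 2).
Proof.
rewrite (pd_derive (is_derive_theta3 mu p (iy k))) iuy_eq !ixy_eq !iy_eq.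
by elim/ord2_cases: k; rewrite /= mulr0n !mulr1n; ring.
Qed.

Variable c : 'rV[R]_N5.
(** The neighborhood on which solvability is shown; its width 2 is less than the
    period 2 pi of the Fourier series. *)
Definition unit_cube : set 'rV[R]_N5 := [set p | forall i, `|p ord0 i - c ord0 i| < 1].

(** Vanishing outside of the slab |p_j - c_j| < 1.  Unlike compact support, it passes
    to the partial integrals. *)
Definition vanish j f := forall p, 1 <= `|p ord0 j - c ord0 j| -> f p = 0.

Lemma test_vanish j f : test_function unit_cube f -> vanish j f.
Proof.
move=> [_ _ fO] p pj; apply: supp0 => /fO /(_ j) h.
by have := lt_le_trans h pj; rewrite ltxx.
Qed.

Lemma Jlt j : c ord0 j - 1 < c ord0 j + 1.
Proof. lra. Qed.

Definition J j f : 'rV[R]_N5 -> R[i] := JC j (c ord0 j - 1) (c ord0 j + 1) f.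

Lemma smooth_J j f : smooth f -> smooth (J j f).
Proof. exact: (smooth_JC j (Jlt j)). Qed.
Lemma vanish_J i j f : i != j -> vanish j f -> vanish j (J i f).
Proof.
move=> ij v p pj; rewrite /J /JC.
have -> : (fun t => f (upd p i t)) = fun=> 0.
  by apply/funext => t; apply: v; rewrite updE eq_sym (negbTE ij).
by rewrite segC_cst ?mul0r // ltW // Jlt.
Qed.
Lemma vanish_mul j f g : vanish j g -> vanish j (fun p => f p * g p).
Proof. by move=> v p pj; rewrite v // mulr0. Qed.
Lemma J_self j f : smooth f -> vanish j f -> J j (partialC j f) = fun=> 0.
Proof.
move=> sf v; apply/funext => p; apply: (JC_partial_self (Jlt j) sf); apply: v; rewrite updE eqxx.
  by rewrite addrAC subrr sub0r normrN normr1.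
by rewrite addrAC subrr add0r normr1.
Qed.
Lemma J_partial i j f : smooth f -> i != j -> J j (partialC i f) = partialC i (J j f).
Proof. by move=> sf ij; rewrite /J (partialC_JC (Jlt j) sf ij). Qed.
Lemma J_add j f g : smooth f -> smooth g -> J j (fun p => f p + g p) = fun p => J j f p + J j g p.
Proof. by move=> sf sg; apply/funext => p; exact: JC_add. Qed.
Lemma J_mul j f g : smooth g -> (forall q t, f (upd q j t) = f q) ->
  J j (fun q => f q * g q) = fun p => f p * J j g p.
Proof. by move=> sg H; apply/funext => p; exact: JC_mul. Qed.

Variables (mu : R).
Local Notation e3 := (phase (theta3 mu)).
Let se3 : smooth e3 := smooth_phase (smoothR_theta3 mu).

Definition fourier_u psi := J iu (fun p => e3 p * psi p).

Lemma smooth_fourier_u psi : smooth psi -> smooth (fourier_u psi).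
Proof. by move=> s; exact: (smooth_J iu (smooth_mul se3 s)). Qed.

Lemma fourier_u_add psi chi : smooth psi -> smooth chi ->
  fourier_u (fun p => psi p + chi p) = fun p => fourier_u psi p + fourier_u chi p.
Proof.
move=> s1 s2; rewrite -(J_add iu (smooth_mul se3 s1) (smooth_mul se3 s2)).
by congr (J iu _); apply/funext => p; rewrite mulrDr.
Qed.

Lemma fourier_u_mul f psi : smooth psi -> (forall q t, f (upd q iu t) = f q) ->
  fourier_u (fun q => f q * psi q) = fun p => f p * fourier_u psi p.
Proof.
move=> s H; rewrite -(J_mul (smooth_mul se3 s) H).
by congr (J iu _); apply/funext => p; rewrite mulrCA.
Qed.

Lemma fourier_u_U psi : smooth psi -> vanish iu psi -> fourier_u (Uf psi) = fun p => 'i%C * mu%:C * fourier_u psi p.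
Proof.
move=> s v; have sm := smooth_mul se3 s.
have E : (fun p => e3 p * Uf psi p) =
   (fun p => partialC iu (fun p => e3 p * psi p) p + 'i%C * mu%:C * (e3 p * psi p)).
  rewrite (partialC_mul iu se3 s) (partialC_phase iu (smoothR_theta3 mu)).
  by apply/funext => p; rewrite pd_theta3_u /Uf; ring.
have scst : smooth (fun p => 'i%C * mu%:C * (e3 p * psi p)) := smooth_mul (smooth_cst _) sm.
rewrite /fourier_u E (J_add iu (smooth_partial iu sm) scst) (J_self sm (vanish_mul _ v)).
by apply/funext => p; rewrite add0r (J_mul (f := fun=> 'i%C * mu%:C) sm).
Qed.

(** Covers X_k and the right-invariant field: both are of the form
    d_i - (p_j / 2) d_u, and the phase is annihilated by d_i - (p_j / 2) d_u. *)
Lemma fourier_u_field i j psi : iu != i -> iu != j ->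
  (forall p, pd i (theta3 mu) p = mu * (p ord0 j / 2)) -> smooth psi -> vanish iu psi ->
  fourier_u (fun p => partialC i psi p + (- (p ord0 j / 2))%:C * partialC iu psi p) = partialC i (fourier_u psi).
Proof.
move=> ui uj pd_i s v; have sm := smooth_mul se3 s.
have E : (fun p => e3 p * (partialC i psi p + (- (p ord0 j / 2))%:C * partialC iu psi p)) =
   (fun p => partialC i (fun p => e3 p * psi p) p +
    (-1 * (p ord0 j / 2))%:C * partialC iu (fun p => e3 p * psi p) p).
  rewrite !(partialC_mul _ se3 s) !(partialC_phase _ (smoothR_theta3 mu)).
  apply/funext => p; rewrite pd_theta3_u pd_i mulN1r.
  have -> : (mu * (p ord0 j / 2))%:C = mu%:C * (p ord0 j / 2)%:C.
    by apply: complexP; rewrite ?cReM ?cImM /=; ring.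
  have -> : (- (p ord0 j / 2))%:C = - (p ord0 j / 2)%:C.
    by apply: complexP; rewrite ?cReN ?cImN /= ?oppr0.
  ring.
have sh := smooth_mul (smooth_real (smoothR_half j (-1))) (smooth_partial iu sm).
rewrite /fourier_u E (J_add iu (smooth_partial i sm) sh).
rewrite (J_mul (f := fun p => (-1 * (p ord0 j / 2))%:C) (smooth_partial iu sm)); last first.
  by move=> q t; rewrite updE eq_sym (negbTE uj).
rewrite (J_self sm (vanish_mul _ v)) -(J_partial sm); last by rewrite eq_sym.
by apply/funext => p; rewrite mulr0 addr0.
Qed.

Lemma fourier_u_X k psi : smooth psi -> vanish iu psi -> fourier_u (Xf k psi) = partialC (ix k) (fourier_u psi).
Proof.
by apply: fourier_u_field => [||p]; [rewrite iux_eq|rewrite iuy_eq|exact: pd_theta3_x].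
Qed.

Lemma fourier_u_R k psi : smooth psi -> vanish iu psi -> fourier_u (Rf k psi) = partialC (iy k) (fourier_u psi).
Proof.
by apply: fourier_u_field => [||p]; [rewrite iuy_eq|rewrite iux_eq|exact: pd_theta3_y].
Qed.

Definition fourier_y k (eta : R) psi := J (iy k) (fun p => phase (theta1 (iy k) eta) p * psi p).

Section Stage1.
Variables (k : 'I_2) (eta : R).
Local Notation e1 := (phase (theta1 (iy k) eta)).
Let se1 : smooth e1 := smooth_phase (smoothR_theta1 (iy k) eta).

Lemma smooth_fourier_y psi : smooth psi -> smooth (fourier_y k eta psi).
Proof. by move=> s; exact: (smooth_J (iy k) (smooth_mul se1 s)). Qed.
Lemma fourier_y_add psi chi : smooth psi -> smooth chi ->
  fourier_y k eta (fun p => psi p + chi p) = fun p => fourier_y k eta psi p + fourier_y k eta chi p.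
Proof.
move=> s1 s2; rewrite -(J_add (iy k) (smooth_mul se1 s1) (smooth_mul se1 s2)).
by congr (J (iy k) _); apply/funext => p; rewrite mulrDr.
Qed.
Lemma fourier_y_mul f psi : smooth psi -> (forall q t, f (upd q (iy k) t) = f q) ->
  fourier_y k eta (fun q => f q * psi q) = fun p => f p * fourier_y k eta psi p.
Proof.
move=> s H; rewrite -(J_mul (smooth_mul se1 s) H).
by congr (J (iy k) _); apply/funext => p; rewrite mulrCA.
Qed.
Lemma fourier_y_partial i psi : smooth psi -> i != iy k ->
  fourier_y k eta (partialC i psi) = partialC i (fourier_y k eta psi).
Proof.
move=> s ik; have sm := smooth_mul se1 s.
rewrite /fourier_y -(J_partial sm ik); congr (J (iy k) _).
rewrite (partialC_mul i se1 s) (partialC_phase i (smoothR_theta1 (iy k) eta)).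
apply/funext => p; rewrite (pd_derive (is_derive_theta1 (iy k) eta p i)).
by rewrite eq_sym (negbTE ik) mulr0 mulr0 oppr0 mul0r mul0r add0r.
Qed.
Lemma fourier_y_self psi : smooth psi -> vanish (iy k) psi ->
  fourier_y k eta (partialC (iy k) psi) = fun p => 'i%C * eta%:C * fourier_y k eta psi p.
Proof.
move=> s v; have sm := smooth_mul se1 s.
have E : (fun p => e1 p * partialC (iy k) psi p) =
   (fun p => partialC (iy k) (fun p => e1 p * psi p) p + 'i%C * eta%:C * (e1 p * psi p)).
  rewrite (partialC_mul _ se1 s) (partialC_phase _ (smoothR_theta1 (iy k) eta)).
  apply/funext => p; rewrite (pd_derive (is_derive_theta1 (iy k) eta p (iy k))) eqxx mulr1; ring.
have scst : smooth (fun p => 'i%C * eta%:C * (e1 p * psi p)) := smooth_mul (smooth_cst _) sm.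
rewrite /fourier_y E (J_add _ (smooth_partial _ sm) scst) (J_self sm (vanish_mul _ v)).
by apply/funext => p; rewrite add0r (J_mul (f := fun=> 'i%C * eta%:C) sm).
Qed.
End Stage1.

End Heis.

(** * The vector fields on the Fourier side *)

Section Fourier.
Variable R : realType.
Local Notation N5 := (2 + 2 + 1)%N.
Local Notation normc := Normc.normc.
Implicit Types (f g psi chi : 'rV[R]_N5 -> R[i]) (p q : 'rV[R]_N5).
Variables (c : 'rV[R]_N5) (mu : R) (eta : 'I_2 -> R).
Local Notation test := (test_function (unit_cube c)).

Lemma smooth_test psi : test psi -> smooth psi. Proof. by case. Qed.

Lemma J_bound j f (S : R) p : smooth f -> (forall q, normc (f q) <= S) -> normc (J c j f p) <= 4 * S.
Proof.
move=> sf H; have := JC_bound j (Jlt c j) p sf H.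
by rewrite (_ : 2 * S * _ = 4 * S) //; ring.
Qed.

Lemma fourier_u_bound psi (S : R) p : smooth psi -> (forall q, normc (psi q) <= S) -> normc (fourier_u c mu psi p) <= 4 * S.
Proof.
move=> s H; apply: (J_bound iu p (smooth_mul (smooth_phase (smoothR_theta3 mu)) s)) => q.
by rewrite Normc.normcM normc_phase mul1r.
Qed.
Lemma fourier_y_bound k e psi (S : R) p : smooth psi -> (forall q, normc (psi q) <= S) -> normc (fourier_y c k e psi p) <= 4 * S.
Proof.
move=> s H; apply: (J_bound (iy k) p (smooth_mul (smooth_phase (smoothR_theta1 (iy k) e)) s)) => q.
by rewrite Normc.normcM normc_phase mul1r.
Qed.
Lemma vanish_fourier_u j psi : iu != j -> vanish c j psi -> vanish c j (fourier_u c mu psi).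
Proof. by move=> ij v; apply: vanish_J => //; exact: vanish_mul. Qed.
Lemma vanish_fourier_y j k e psi : iy k != j -> vanish c j psi -> vanish c j (fourier_y c k e psi).
Proof. by move=> ij v; apply: vanish_J => //; exact: vanish_mul. Qed.

(** Three successive one-dimensional transforms; only the x-coordinates of the
    argument matter. *)
Definition fourier psi := fourier_y c 0 (eta 0) (fourier_y c 1 (eta 1) (fourier_u c mu psi)).

Lemma smooth_fourier psi : smooth psi -> smooth (fourier psi).
Proof. by move=> s; exact: (smooth_fourier_y c _ _ (smooth_fourier_y c _ _ (smooth_fourier_u c mu s))). Qed.

Lemma fourier_add psi chi : smooth psi -> smooth chi ->
  fourier (fun p => psi p + chi p) = fun p => fourier psi p + fourier chi p.
Proof.
move=> s1 s2; rewrite /fourier (fourier_u_add c mu s1 s2).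
rewrite (fourier_y_add c _ _ (smooth_fourier_u c mu s1) (smooth_fourier_u c mu s2)).
by rewrite (fourier_y_add c _ _ (smooth_fourier_y c _ _ (smooth_fourier_u c mu s1)) (smooth_fourier_y c _ _ (smooth_fourier_u c mu s2))).
Qed.

Lemma fourier_mul f psi : smooth psi -> (forall q t, f (upd q iu t) = f q) ->
  (forall k q t, f (upd q (iy k) t) = f q) -> fourier (fun q => f q * psi q) = fun p => f p * fourier psi p.
Proof.
move=> s Hu Hy; rewrite /fourier (fourier_u_mul c mu s Hu) (fourier_y_mul c _ (smooth_fourier_u c mu s) (Hy 1)).
by rewrite (fourier_y_mul c _ (smooth_fourier_y c _ _ (smooth_fourier_u c mu s)) (Hy 0)).
Qed.

Lemma fourier_scale a psi : smooth psi -> fourier (fun q => a * psi q) = fun p => a * fourier psi p.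
Proof. by move=> s; exact: (fourier_mul (f := fun=> a) s). Qed.

Lemma fourier_bound psi (S : R) p : smooth psi -> (forall q, normc (psi q) <= S) -> normc (fourier psi p) <= 64 * S.
Proof.
move=> s H; have -> : 64 * S = 4 * (4 * (4 * S)) by ring.
apply: (fourier_y_bound _ _ _ (smooth_fourier_y c _ _ (smooth_fourier_u c mu s))) => q.
apply: (fourier_y_bound _ _ _ (smooth_fourier_u c mu s)) => r.
exact: (fourier_u_bound _ s).
Qed.

Lemma fourier_vanish k psi : test psi -> vanish c (ix k) (fourier psi).
Proof.
move=> t; apply: vanish_fourier_y; first by rewrite iyx_eq.
apply: vanish_fourier_y; first by rewrite iyx_eq.
by apply: vanish_fourier_u; [rewrite iux_eq|exact: test_vanish].
Qed.

Lemma fourier_X k psi : test psi -> fourier (Xf k psi) = partialC (ix k) (fourier psi).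
Proof.
move=> t; have s := smooth_test t.
rewrite /fourier (fourier_u_X mu k s (test_vanish (j := iu) t)).
rewrite (fourier_y_partial c _ (smooth_fourier_u c mu s)) ?ixy_eq //.
by rewrite (fourier_y_partial c _ (smooth_fourier_y c _ _ (smooth_fourier_u c mu s))) ?ixy_eq.
Qed.

Lemma fourier_U psi : test psi -> fourier (Uf psi) = fun p => 'i%C * mu%:C * fourier psi p.
Proof.
move=> t; have s := smooth_test t.
rewrite /fourier (fourier_u_U mu s (test_vanish (j := iu) t)).
rewrite (fourier_y_mul c _ (f := fun=> 'i%C * mu%:C) (smooth_fourier_u c mu s)) //.
by rewrite (fourier_y_mul c _ (f := fun=> 'i%C * mu%:C) (smooth_fourier_y c _ _ (smooth_fourier_u c mu s))).
Qed.

Lemma fourier_R k psi : test psi -> fourier (Rf k psi) = fun p => 'i%C * (eta k)%:C * fourier psi p.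
Proof.
move=> t; have s := smooth_test t.
have v l : vanish c (iy l) (fourier_u c mu psi) by apply: vanish_fourier_u; [rewrite iuy_eq|exact: test_vanish].
have s3 := smooth_fourier_u c mu s.
rewrite /fourier (fourier_u_R mu k s (test_vanish (j := iu) t)).
elim/ord2_cases: k.
  rewrite (fourier_y_partial c _ s3) ?iy_eq // (fourier_y_self _ (smooth_fourier_y c _ _ s3)) //.
  by apply: vanish_fourier_y; rewrite ?iy_eq.
rewrite (fourier_y_self _ s3) //.
by rewrite (fourier_y_mul c _ (f := fun=> 'i%C * (eta 1)%:C) (smooth_fourier_y c _ _ s3)).
Qed.

Definition zeta k p : R := eta k + mu * p ord0 (ix k).

Lemma Xf_test k psi : test psi -> test (Xf k psi).
Proof. by move=> t; exact: (apply_fun_test (opX_smooth R k) t). Qed.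
Lemma Yf_test k psi : test psi -> test (Yf k psi).
Proof. by move=> t; exact: (apply_fun_test (opY_smooth R k) t). Qed.
Lemma Rf_test k psi : test psi -> test (Rf k psi).
Proof. by move=> t; exact: (apply_fun_test (opRy_smooth R k) t). Qed.
Lemma Uf_test psi : test psi -> test (Uf psi).
Proof. exact: test_partial. Qed.

(** Y_k = R_k + x_k U with R_k the right-invariant field, whose symbol is i eta_k. *)
Lemma fourier_Y k psi : test psi -> fourier (Yf k psi) = fun p => 'i%C * (zeta k p)%:C * fourier psi p.
Proof.
move=> t; have E : Yf k psi = fun p => Rf k psi p + (p ord0 (ix k))%:C * Uf psi p.
  apply/funext => p; rewrite /Yf /Rf /Uf /=.
  have -> : (p ord0 (ix k))%:C = (p ord0 (ix k) / 2)%:C - (- (p ord0 (ix k) / 2))%:C.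
    by apply: complexP; rewrite ?cReD ?cImD ?cReN ?cImN /=; [field|ring].
  ring.
have sU := smooth_test (Uf_test t).
rewrite E (fourier_add (smooth_test (Rf_test k t)) (smooth_mul (smooth_coord R (ix k)) sU)).
rewrite (fourier_mul (f := fun p => (p ord0 (ix k))%:C) sU).
- rewrite (fourier_R k t) (fourier_U t); apply/funext => p; rewrite /zeta.
  have -> : (eta k + mu * p ord0 (ix k))%:C = (eta k)%:C + mu%:C * (p ord0 (ix k))%:C.
    by apply: complexP; rewrite ?cReD ?cImD ?cReM ?cImM /=; ring.
  ring.
- by move=> q s; rewrite updE ixu_eq.
- by move=> l q s; rewrite updE ixy_eq.
Qed.

(** 1 - P^2, with symbol 1 + a^2 if P has symbol i a. *)
Definition opOne (P : diffop R N5) : diffop R N5 :=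
  (OpMul (fun=> 1) + (- 1)%R *: (P * P))%DO.
(** Its symbol [weight] measures the decay of Fourier coefficients. *)
Definition opWeight : diffop R N5 := (opOne (opU R) * (opOne (opRy R 0) * opOne (opRy R 1)))%DO.

Lemma opOne_smooth P : smooth_coefficients P -> smooth_coefficients (opOne P).
Proof. by move=> s; split; [exact: smooth_cst|split; [exact: smooth_cst|split]]. Qed.
Lemma opWeight_smooth : smooth_coefficients opWeight.
Proof.
split; first by apply: opOne_smooth.
by split; apply: opOne_smooth; exact: opRy_smooth.
Qed.

Lemma fourier_opOne P (a : R) psi : smooth_coefficients P -> test psi ->
  (forall chi, test chi -> fourier (apply_fun P chi) = fun p => 'i%C * a%:C * fourier chi p) ->
  fourier (apply_fun (opOne P) psi) = fun p => (1 + a ^+ 2)%:C * fourier psi p.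
Proof.
move=> sP t H; have tP := apply_fun_test sP t; have tPP := apply_fun_test sP tP.
rewrite /opOne /=.
rewrite (fourier_add (smooth_mul (smooth_cst 1) (smooth_test t)) (smooth_mul (smooth_cst (-1)) (smooth_test tPP))).
rewrite (fourier_scale _ (smooth_test t)) (fourier_scale _ (smooth_test tPP)) (H _ tP) (H _ t).
apply/funext => p; have -> : (1 + a ^+ 2)%:C = 1 - 'i%C * a%:C * ('i%C * a%:C).
  by apply: complexP; rewrite ?cReD ?cImD ?cReN ?cImN ?cReM ?cImM /=; ring.
ring.
Qed.

Definition weight : R := (1 + mu ^+ 2) * ((1 + eta 0 ^+ 2) * (1 + eta 1 ^+ 2)).

Lemma fourier_opWeight psi : test psi -> fourier (apply_fun opWeight psi) = fun p => weight%:C * fourier psi p.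
Proof.
move=> t.
have s0 := opOne_smooth (opRy_smooth R 0); have s1 := opOne_smooth (opRy_smooth R 1).
have t1 := apply_fun_test s1 t; have t0 := apply_fun_test s0 t1.
have -> : apply_fun opWeight psi = apply_fun (opOne (opU R)) (apply_fun (opOne (opRy R 0)) (apply_fun (opOne (opRy R 1)) psi)) by [].
rewrite (fourier_opOne (P := opU R) (a := mu) I t0 fourier_U).
rewrite (fourier_opOne (opRy_smooth R 0) t1 (fourier_R 0)).
rewrite (fourier_opOne (opRy_smooth R 1) t (fourier_R 1)).
apply/funext => p; rewrite /weight; apply: complexP; rewrite !(cReM, cImM) /=; ring.
Qed.

Lemma weight_ge1 : 1 <= weight.
Proof.
rewrite /weight; have h (x : R) : 1 <= 1 + x ^+ 2 by rewrite lerDl sqr_ge0.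
by rewrite !mulr_ege1.
Qed.

End Fourier.

(** * The transposed operator on the Fourier side *)

Section Transposed.
Variable R : realType.
Local Notation N5 := (2 + 2 + 1)%N.
Implicit Types (psi : 'rV[R]_N5 -> R[i]) (p q : 'rV[R]_N5).

(** Each of the fields is divergence free, hence antisymmetric. *)
Lemma tr_field i (a : 'rV[R]_N5 -> R[i]) psi :
  smooth a -> partialC iu a = (fun=> 0) -> smooth psi ->
  apply_fun (tr (OpPartial i + OpMul a * OpPartial iu)%DO) psi =
  fun p => - apply_fun (OpPartial i + OpMul a * OpPartial iu)%DO psi p.
Proof.
move=> sa a0 s; apply/funext => p /=.
by rewrite (partialC_mul iu sa s) a0 mul0r add0r !mulN1r opprD.
Qed.

Lemma partialC_coef j i (s : R) : j != i ->
  partialC j (fun p : 'rV[R]_N5 => (s * (p ord0 i / 2))%:C) = fun=> 0.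
Proof.
move=> ui; apply/funext => p; rewrite partialC_real.
have D := is_deriveZ s (is_deriveZ (2^-1) (is_derive_coord p 'e_j i)).
have -> : pd j (fun p : 'rV[R]_N5 => s * (p ord0 i / 2)) p = 0; last by [].
apply: pd_derive; rewrite (_ : (fun p => _) = s \*: (2^-1 \*: (fun p : 'rV[R]_N5 => p ord0 i))).
  by apply: (is_derive_eq D); rewrite !mxE eqxx eq_sym (negbTE ui) /= !scaler0.
by apply/funext => q; rewrite [_ / 2]mulrC.
Qed.

Lemma tr_X k psi : smooth psi -> apply_fun (tr (opX R k)) psi = fun p => - Xf k psi p.
Proof.
move=> s; have [_ [sa _]] := opX_smooth R k.
apply: (tr_field (ix k) sa _ s).
rewrite -(partialC_coef (j := iu) (i := iy k) (-1)) ?iuy_eq //.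
by congr partialC; apply/funext => q; rewrite mulN1r.
Qed.

Lemma tr_Y k psi : smooth psi -> apply_fun (tr (opY R k)) psi = fun p => - Yf k psi p.
Proof.
move=> s; have [_ [sa _]] := opY_smooth R k.
apply: (tr_field (iy k) sa _ s).
rewrite -(partialC_coef (j := iu) (i := ix k) 1) ?iux_eq //.
by congr partialC; apply/funext => q; rewrite mul1r.
Qed.

Lemma apply_fun_scale (P : diffop R N5) (a : R[i]) psi : smooth_coefficients P -> smooth psi ->
  apply_fun P (fun p => a * psi p) = fun p => a * apply_fun P psi p.
Proof.
elim: P psi => [b|j|P1 ih1 P2 ih2|P1 ih1 P2 ih2] psi /=.
- by move=> _ _; apply/funext => p; rewrite mulrCA.
- by move=> _ s; exact: partialC_scale.
- by move=> [s1 s2] s; apply/funext => p; rewrite ih1 // ih2 // mulrDr.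
- by move=> [s1 s2] s; rewrite (ih2 psi s2 s) (ih1 _ s1 (apply_fun_smooth s2 s)).
Qed.

Lemma smooth_Xf k psi : smooth psi -> smooth (Xf k psi).
Proof. by move=> s; exact: (apply_fun_smooth (opX_smooth R k) s). Qed.
Lemma smooth_Yf k psi : smooth psi -> smooth (Yf k psi).
Proof. by move=> s; exact: (apply_fun_smooth (opY_smooth R k) s). Qed.

Lemma Yf_opp k psi : smooth psi -> Yf k (fun p => - psi p) = fun p => - Yf k psi p.
Proof.
move=> s; have -> : (fun p => - psi p) = (fun p => -1 * psi p) by apply/funext => p; rewrite mulN1r.
by rewrite /Yf (apply_fun_scale _ (opY_smooth R k) s); apply/funext => p; rewrite mulN1r.
Qed.

Lemma smooth_opp psi : smooth psi -> smooth (fun p => - psi p).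
Proof.
move=> s; have -> : (fun p => - psi p) = (fun p => -1 * psi p) by apply/funext => p; rewrite mulN1r.
exact: (smooth_mul (smooth_cst (-1)) s).
Qed.

Lemma tr_YY j k psi : smooth psi -> apply_fun (tr (opY R j * opY R k)%DO) psi = Yf k (Yf j psi).
Proof.
move=> s; rewrite -[LHS]/(apply_fun (tr (opY R k)) (apply_fun (tr (opY R j)) psi)) (tr_Y j s).
rewrite (tr_Y k (smooth_opp (smooth_Yf j s))) (Yf_opp k (smooth_Yf j s)).
by apply/funext => p; rewrite opprK.
Qed.
Lemma tr_XY j k psi : smooth psi -> apply_fun (tr (opX R j * opY R k)%DO) psi = Yf k (Xf j psi).
Proof.
move=> s; rewrite -[LHS]/(apply_fun (tr (opY R k)) (apply_fun (tr (opX R j)) psi)) (tr_X j s).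
rewrite (tr_Y k (smooth_opp (smooth_Xf j s))) (Yf_opp k (smooth_Xf j s)).
by apply/funext => p; rewrite opprK.
Qed.

Lemma tr_scale (a : R[i]) (P : diffop R N5) psi : smooth_coefficients P -> smooth psi ->
  apply_fun (tr (a *: P)%DO) psi = fun p => a * apply_fun (tr P) psi p.
Proof. by move=> sP s; rewrite -(apply_fun_scale a (tr_smooth sP) s). Qed.

Lemma tr_U psi : apply_fun (tr (opU R)) psi = fun p => - Uf psi p.
Proof. by apply/funext => p /=; rewrite mulN1r. Qed.

Variables (c1 c2 m : R) (alpha : R[i]).
Definition perturbed_op : diffop R N5 := (example_op c1 c2 m + ('i%C * alpha)%R *: opU R)%DO.

Lemma smooth_comp (P Q : diffop R N5) : smooth_coefficients P -> smooth_coefficients Q ->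
  smooth_coefficients (P * Q)%DO.
Proof. by []. Qed.
Lemma smooth_scale (a : R[i]) (P : diffop R N5) : smooth_coefficients P -> smooth_coefficients (a *: P)%DO.
Proof. by move=> sP; split => //; exact: smooth_cst. Qed.

Let sX := opX_smooth R.
Let sY := opY_smooth R.

Lemma example_smooth : smooth_coefficients (example_op c1 c2 m).
Proof.
have A j k := smooth_comp (sY j) (sY k); have B j k := smooth_comp (sX j) (sY k).
split; last by apply: smooth_scale; split; [exact: B|apply: smooth_scale; exact: B].
by split; [split|]; apply: smooth_scale; exact: A.
Qed.

Lemma perturbed_op_smooth : smooth_coefficients perturbed_op.
Proof. by split; [exact: example_smooth|exact: smooth_scale]. Qed.

Lemma tr_perturbed_op psi : smooth psi -> apply_fun (tr perturbed_op) psi = fun p =>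
  (m + c1)%:C * Yf 0 (Yf 0 psi) p + (m - c1)%:C * Yf 1 (Yf 1 psi) p
  + (2 * c2)%:C * Yf 1 (Yf 0 psi) p
  + 2 * 'i%C * (Yf 1 (Xf 0 psi) p + -1 * Yf 0 (Xf 1 psi) p) + - ('i%C * alpha) * Uf psi p.
Proof.
move=> s; have A j k := smooth_comp (sY j) (sY k); have B j k := smooth_comp (sX j) (sY k).
rewrite /perturbed_op /example_op; apply/funext => p; set P := (opX R 0 * _ + _)%DO.
have sP : smooth_coefficients P by split; [exact: B|apply: smooth_scale; exact: B].
rewrite -[LHS]/(apply_fun (tr ((m + c1)%:C *: (opY R 0 * opY R 0))%DO) psi p
  + apply_fun (tr ((m - c1)%:C *: (opY R 1 * opY R 1))%DO) psi p
  + apply_fun (tr ((2 * c2)%:C *: (opY R 0 * opY R 1))%DO) psi p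
  + apply_fun (tr ((2 * 'i%C)%R *: P)%DO) psi p + apply_fun (tr ((('i%C * alpha)%R) *: opU R)%DO) psi p).
rewrite (tr_scale _ (A 0 0) s) (tr_scale _ (A 1 1) s) (tr_scale _ (A 0 1) s) (tr_scale _ sP s).
rewrite (tr_scale _ (P := opU R) I s) tr_U !(tr_YY _ _ s).
have HP : apply_fun (tr P) psi p = Yf 1 (Xf 0 psi) p + -1 * Yf 0 (Xf 1 psi) p.
  rewrite -[LHS]/(apply_fun (tr (opX R 0 * opY R 1)%DO) psi p
    + apply_fun (tr ((- 1)%R *: (opX R 1 * opY R 0))%DO) psi p).
  congr (_ + _); first exact: (congr1 (fun f => f p) (tr_XY 0 1 s)).
  exact: (etrans (congr1 (fun f => f p) (tr_scale (-1) (B 1 0) s)) (congr1 (fun f => -1 * f p) (tr_XY 1 0 s))).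
by rewrite HP; congr (_ + _); rewrite mulrN mulNr.
Qed.

Variables (c : 'rV[R]_N5) (mu : R) (eta : 'I_2 -> R).
Local Notation test := (test_function (unit_cube c)).
Local Notation F := (fourier c mu eta).
Local Notation z := (zeta mu eta).

#[local] Opaque Yf Xf Uf fourier.
(** The transposition reverses the order of the factors and changes the sign of
    alpha; on the Fourier side multiplication by zeta ends up to the left of the
    derivatives. *)
Lemma fourier_perturbed_op psi : test psi -> F (apply_fun (tr perturbed_op) psi) = fun p =>
  - ((m + c1) * z 0 p ^+ 2 + (m - c1) * z 1 p ^+ 2 + 2 * c2 * z 0 p * z 1 p)%:C * F psi p
  - 2%:C * ((z 1 p)%:C * partialC (ix 0) (F psi) p - (z 0 p)%:C * partialC (ix 1) (F psi) p)
  + alpha * mu%:C * F psi p.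
Proof.
move=> t; have s := smooth_test t.
have tX k := Xf_test k t; have tY k := Yf_test k t.
have tYY j k := Yf_test k (tY j); have tXY j k := Yf_test k (tX j).
have Sc (a : R[i]) g (tg : test g) : smooth (fun p => a * g p) := smooth_mul (smooth_cst a) (smooth_test tg).
have B4 : smooth (fun p => Yf 1 (Xf 0 psi) p + -1 * Yf 0 (Xf 1 psi) p) :=
  smooth_add (smooth_test (tXY 0 1)) (Sc (-1) _ (tXY 1 0)).
have B1 := smooth_add (Sc (m + c1)%:C _ (tYY 0 0)) (Sc (m - c1)%:C _ (tYY 1 1)).
have B2 := smooth_add B1 (Sc (2 * c2)%:C _ (tYY 0 1)).
have B4' := smooth_mul (smooth_cst (2 * 'i%C)) B4.
have B3 := smooth_add B2 B4'.
rewrite (tr_perturbed_op s).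
rewrite (fourier_add c mu eta B3 (Sc (- ('i%C * alpha)) _ (Uf_test t))).
rewrite (fourier_add c mu eta B2 B4').
rewrite (fourier_add c mu eta B1 (Sc (2 * c2)%:C _ (tYY 0 1))).
rewrite (fourier_add c mu eta (Sc (m + c1)%:C _ (tYY 0 0)) (Sc (m - c1)%:C _ (tYY 1 1))).
rewrite (fourier_scale c mu eta (2 * 'i%C) B4).
rewrite (fourier_add c mu eta (smooth_test (tXY 0 1)) (Sc (-1) _ (tXY 1 0))).
have Fs a g (tg : test g) := fourier_scale c mu eta a (smooth_test tg).
rewrite (Fs (m + c1)%:C _ (tYY 0 0)) (Fs (m - c1)%:C _ (tYY 1 1)) (Fs (2 * c2)%:C _ (tYY 0 1)).
rewrite (Fs (-1) _ (tXY 1 0)) (Fs (- ('i%C * alpha)) _ (Uf_test t)).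
rewrite (fourier_Y mu eta 0 (tY 0)) (fourier_Y mu eta 1 (tY 1)) (fourier_Y mu eta 1 (tY 0)) (fourier_Y mu eta 0 t) (fourier_Y mu eta 1 t).
rewrite (fourier_Y mu eta 1 (tX 0)) (fourier_Y mu eta 0 (tX 1)) (fourier_X mu eta 0 t) (fourier_X mu eta 1 t) (fourier_U mu eta t).
apply/funext => p.
have i2 : 'i%C * 'i%C = -1 :> R[i] by rewrite -expr2 sqr_i.
set z0 := z 0 p; set z1 := z 1 p; set A := F psi p; set B := partialC (ix 0) _ p; set C := partialC (ix 1) _ p.
have -> : ((m + c1) * z0 ^+ 2 + (m - c1) * z1 ^+ 2 + 2 * c2 * z0 * z1)%:C =
  (m + c1)%:C * z0%:C * z0%:C + (m - c1)%:C * z1%:C * z1%:C + (2 * c2)%:C * z0%:C * z1%:C.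
  by apply: complexP; rewrite !(cReD, cImD, cReM, cImM) /=; ring.
have -> : 2%:C = 2 :> R[i] by apply: complexP; rewrite ?cReD ?cImD /= ?addr0.
ring: i2.
Qed.

End Transposed.

(** * Polar coordinates in the frequency plane *)

Section Polar.
Variable R : realType.
Local Notation N5 := (2 + 2 + 1)%N.
Local Notation normc := Normc.normc.
Local Notation Re := complex.Re.
Local Notation Im := complex.Im.
Implicit Types (f g psi chi : 'rV[R]_N5 -> R[i]) (p q : 'rV[R]_N5).

Lemma Re_comb (a b : R) (z w : R[i]) : Re (a%:C * z + b%:C * w) = a * Re z + b * Re w.
Proof. by rewrite cReD !cReM /= !mul0r !subr0. Qed.
Lemma Im_comb (a b : R) (z w : R[i]) : Im (a%:C * z + b%:C * w) = a * Im z + b * Im w.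
Proof. by rewrite cImD !cImM /= !mul0r !addr0. Qed.

Lemma is_deriveC_plane f (c0 : 'rV[R]_N5) (a b : R -> R) (da db t : R) : smooth f ->
  is_derive t 1 a da -> is_derive t 1 b db ->
  is_deriveC (fun s => f (upd (upd c0 (ix 0) (a s)) (ix 1) (b s))) t
   (da%:C * partialC (ix 0) f (upd (upd c0 (ix 0) (a t)) (ix 1) (b t))
    + db%:C * partialC (ix 1) f (upd (upd c0 (ix 0) (a t)) (ix 1) (b t))).
Proof.
move=> /smoothE[s1 s2] Da Db.
pose q s := upd (upd c0 (ix 0) (a s)) (ix 1) (b s).
pose dq j : R := if j == ix 1 then db else if j == ix 0 then da else 0.
have Dq j : is_derive t 1 (fun s => q s ord0 j) (dq j).
  rewrite /q /dq; have [->|j1] := eqVneq j (ix 1).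
    by rewrite (_ : (fun s => _) = b) //; apply/funext => s; rewrite updE eqxx.
  have [->|j0] := eqVneq j (ix 0).
    by rewrite (_ : (fun s => _) = a) //; apply/funext => s; rewrite !updE ix_eq eqxx.
  rewrite (_ : (fun s => _) = cst (c0 ord0 j)); first exact: is_derive_cst.
  by apply/funext => s; rewrite !updE (negbTE j1) (negbTE j0).
have E (g : 'rV[R]_N5 -> R) : \sum_j dq j * pd j g (q t) = da * pd (ix 0) g (q t) + db * pd (ix 1) g (q t).
  have h : ix 1 != ix 0 by rewrite ix_eq.
  rewrite (bigD1 (ix 0) isT) (bigD1 (ix 1) h).
  rewrite big1 => [|j /andP[j0 j1]]; last by rewrite /dq (negbTE j0) (negbTE j1) mul0r.
  by rewrite /= addr0 /dq ix_eq !eqxx.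
split.
  by apply: (is_derive_eq (is_derive_curve s1 Dq)); rewrite E Re_comb.
by apply: (is_derive_eq (is_derive_curve s2 Dq)); rewrite E Im_comb.
Qed.

Variables (c : 'rV[R]_N5) (mu : R) (eta : 'I_2 -> R).
Hypothesis mu0 : mu != 0.

(** The point whose zeta has polar coordinates (r, x), with the y- and
    u-coordinates of c. *)
Definition pt (r x : R) : 'rV[R]_N5 :=
  upd (upd c (ix 0) ((r * sin x - eta 0) / mu)) (ix 1) ((r * cos x - eta 1) / mu).

Lemma zeta_pt r x : zeta mu eta 0 (pt r x) = r * sin x /\ zeta mu eta 1 (pt r x) = r * cos x.
Proof. by rewrite /zeta /pt !updE !ix_eq eqxx /=; split; field. Qed.

Lemma pt0 x : pt 0 x = pt 0 0.
Proof. by rewrite /pt !mul0r. Qed.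

Lemma pt_turn r x (sg : R) : sg = 1 \/ sg = -1 -> pt r (x - sg * (2 * pi)) = pt r x.
Proof.
move=> h; rewrite /pt.
have E (y : R) : sin (y + 2 * pi) = sin y /\ cos (y + 2 * pi) = cos y.
  by rewrite (mulr_natl pi 2) sinD2pi cosD2pi.
case: h => ->; rewrite ?mul1r ?mulN1r ?opprK.
  have [E1 E2] := E (x - 2 * pi); rewrite subrK in E1 E2.
  by rewrite E1 E2.
by have [-> ->] := E x.
Qed.

Lemma is_deriveC_radial f r x : smooth f -> is_deriveC (fun r => f (pt r x)) r
  ((sin x / mu)%:C * partialC (ix 0) f (pt r x) + (cos x / mu)%:C * partialC (ix 1) f (pt r x)).
Proof.
move=> sf; have D (k e : R) : is_derive r 1 (fun r : R => (r * k - e) / mu) (k / mu).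
  have D0 := is_deriveZ (mu^-1) (is_deriveB (is_deriveZ k (is_derive_id r 1)) (is_derive_cst e r 1)).
  rewrite (_ : (fun r => _) = mu^-1 \*: ((k \*: id) - cst e)).
    by apply: (is_derive_eq D0); rewrite /GRing.scale /= subr0 mulr1 mulrC.
  by apply/funext => s; rewrite [LHS]mulrC [s * k]mulrC.
exact: (is_deriveC_plane c sf (D _ _) (D _ _)).
Qed.

Lemma is_deriveC_angular f r x : smooth f -> is_deriveC (fun x => f (pt r x)) x
  ((r * cos x / mu)%:C * partialC (ix 0) f (pt r x) + (- (r * sin x / mu))%:C * partialC (ix 1) f (pt r x)).
Proof.
move=> sf; have D (h : R -> R) (dh e : R) : is_derive x 1 h dh -> is_derive x 1 (fun x : R => (r * h x - e) / mu) (r * dh / mu).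
  move=> H; have D0 := is_deriveZ (mu^-1) (is_deriveB (is_deriveZ r H) (is_derive_cst e x 1)).
  rewrite (_ : (fun r => _) = mu^-1 \*: ((r \*: h) - cst e)).
    by apply: (is_derive_eq D0); rewrite /GRing.scale /= subr0 mulrC.
  by apply/funext => s; rewrite [LHS]mulrC.
have D1 := D _ _ (eta 0) (is_derive_sin x).
have D2 := D _ _ (eta 1) (is_derive_cos x).
apply: (is_deriveC_eq (is_deriveC_plane c sf D1 D2)).
by rewrite mulrN mulNr.
Qed.

Lemma normc_comb (a b : R) (z w : R[i]) (K : R) : `|a| <= 2 -> `|b| <= 2 -> normc z <= K -> normc w <= K ->
  normc (a%:C * z + b%:C * w) <= 4 * K.
Proof.
move=> ha hb hz hw; apply: le_trans (le_normcD _ _) _; rewrite !Normc.normcM !normc_real.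
have -> : 4 * K = 2 * K + 2 * K by ring.
by apply: lerD; apply: ler_pM => //; exact: normc_ge0.
Qed.

Hypothesis mu_ge : 1 / 2 <= `|mu|.

Lemma div_mu_bound (x : R) : `|x| <= 1 -> `|x / mu| <= 2.
Proof.
move=> x1; rewrite normrM normfV ler_pdivrMr ?normr_gt0 //.
by apply: (le_trans x1); have := mu_ge; lra.
Qed.
Lemma sin_mu x : `|sin x / mu| <= 2.
Proof. by apply: div_mu_bound; rewrite ler_norml sin_geN1 sin_le1. Qed.
Lemma cos_mu x : `|cos x / mu| <= 2.
Proof. by apply: div_mu_bound; rewrite ler_norml cos_geN1 cos_le1. Qed.

Lemma mvt_between (f df : R -> R[i]) (K a b : R) : (forall t, is_deriveC f t (df t)) ->
  (forall t, Num.min a b <= t <= Num.max a b -> normc (df t) <= K) ->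
  normc (f b - f a) <= 2 * K * `|b - a|.
Proof.
move=> D H; have [le|/ltW le] := leP a b.
  rewrite ger0_norm ?subr_ge0 //; apply: (mvt_normc le D) => t tt; apply: H.
  by rewrite (min_idPl le) (max_idPr le).
rewrite distrC ger0_norm ?subr_ge0 // -normcN opprB; apply: (mvt_normc le D) => t tt; apply: H.
by rewrite (min_idPr le) (max_idPl le).
Qed.

Lemma radial_lip f K : smooth f -> (forall k p, normc (partialC (ix k) f p) <= K) ->
  forall r r' x, normc (f (pt r x) - f (pt r' x)) <= 8 * K * `|r - r'|.
Proof.
move=> sf H r r' x.
have := @mvt_between (fun r => f (pt r x)) _ (4 * K) r' r (fun t => is_deriveC_radial t x sf).
rewrite mulrA (_ : 2 * 4 = 8 :> R); last by ring.
by apply=> t _; apply: normc_comb => //; [exact: sin_mu|exact: cos_mu].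
Qed.

Definition radial1 f x : R[i] := (sin x / mu)%:C * partialC (ix 0) f (pt 0 x) + (cos x / mu)%:C * partialC (ix 1) f (pt 0 x).

(** The constant 64 is the square of 2 * 4: each of two applications of the mean value
    theorem contributes 2, and each radial derivative 4, because sin / mu and cos / mu
    are at most 2. *)
Lemma radial_taylor f K : smooth f -> (forall k l p, normc (partialC (ix l) (partialC (ix k) f) p) <= K) ->
  forall r x, normc (f (pt r x) - (f (pt 0 x) + r%:C * radial1 f x)) <= 64 * K * r ^+ 2.
Proof.
move=> sf H r x.
pose d t := (sin x / mu)%:C * partialC (ix 0) f (pt t x) + (cos x / mu)%:C * partialC (ix 1) f (pt t x).
have D t : is_deriveC (fun r => f (pt r x) - r%:C * radial1 f x) t (d t - radial1 f x).
  have Dr : is_deriveC (fun r : R => r%:C) t 1 by apply: (@is_deriveC_real R id t 1); exact: is_derive_id.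
  apply: (is_deriveC_eq (is_deriveC_add (is_deriveC_radial t x sf)
     (is_deriveC_opp (is_deriveC_mul Dr (is_deriveC_cst (radial1 f x) t))))).
  by rewrite mulr0 addr0 mul1r.
have Bd t : normc (d t - radial1 f x) <= 32 * K * `|t|.
  have -> : d t - radial1 f x = (sin x / mu)%:C * (partialC (ix 0) f (pt t x) - partialC (ix 0) f (pt 0 x))
    + (cos x / mu)%:C * (partialC (ix 1) f (pt t x) - partialC (ix 1) f (pt 0 x)) by rewrite /d /radial1; ring.
  have -> : 32 * K * `|t| = 4 * (8 * K * `|t - 0|) by rewrite subr0; ring.
  apply: normc_comb; [exact: sin_mu|exact: cos_mu| |];
    by apply: (radial_lip (smooth_partial _ sf)) => l q; exact: H.
have K0 : 0 <= K by apply: le_trans (H 0 0 0); exact: normc_ge0.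
pose f0 r := f (pt r x) - r%:C * radial1 f x.
have -> : f (pt r x) - (f (pt 0 x) + r%:C * radial1 f x) = f0 r - f0 0 by rewrite /f0 mul0r subr0; ring.
have -> : 64 * K * r ^+ 2 = 2 * (32 * K * `|r|) * `|r - 0|.
  by rewrite subr0 -[r ^+ 2]real_normK ?num_real //; ring.
apply: (mvt_between D) => t tt; apply: le_trans (Bd t) _; rewrite ler_wpM2l ?mulr_ge0 //.
by have := between_dist tt; rewrite !subr0.
Qed.

Lemma is_deriveC_unique (f : R -> R[i]) t d d' : is_deriveC f t d -> is_deriveC f t d' -> d = d'.
Proof. by move=> [[_ a] [_ b]] [[_ a'] [_ b']]; apply: complexP; rewrite -?a -?b. Qed.

End Polar.

(** * Bounding one Fourier coefficient *)

Section CircleApplication.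
Variable R : realType.
Local Notation N5 := (2 + 2 + 1)%N.
Local Notation normc := Normc.normc.
Implicit Types (f g psi phi : 'rV[R]_N5 -> R[i]) (p q : 'rV[R]_N5).

Lemma polar (a b : R) : exists r x : R, [/\ 0 <= r, r * sin x = a & r * cos x = b].
Proof.
pose r := Num.sqrt (a ^+ 2 + b ^+ 2).
have ss : 0 <= a ^+ 2 + b ^+ 2 by rewrite addr_ge0 ?sqr_ge0.
have r2 : r ^+ 2 = a ^+ 2 + b ^+ 2 by rewrite sqr_sqrtr.
have [r0|r0] := eqVneq r 0.
  have /eqP : a ^+ 2 + b ^+ 2 = 0 by rewrite -r2 r0 expr2 mul0r.
  rewrite paddr_eq0 ?sqr_ge0 // !sqrf_eq0 => /andP[/eqP -> /eqP ->].
  by exists 0, 0; rewrite !mul0r.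
have rp : 0 < r by rewrite lt_neqAle eq_sym r0 sqrtr_ge0.
have t2 : (b / r) ^+ 2 <= 1.
  by rewrite expr_div_n r2 ler_pdivrMr ?mul1r ?lerDr ?sqr_ge0 // -r2 exprn_gt0.
have tb : -1 <= b / r <= 1.
  by rewrite -ler_norml -(@ler_pXn2r _ 2) ?nnegrE // real_normK ?num_real // expr1n.
have c1 : cos (acos (b / r)) = b / r by rewrite acosK // in_itv.
have s1 : r * sin (acos (b / r)) = `|a|.
  rewrite sin_acos // -sqrtr_sqr.
  have -> : 1 - (b / r) ^+ 2 = (a / r) ^+ 2.
    rewrite !expr_div_n r2; have : a ^+ 2 + b ^+ 2 != 0 by rewrite -r2 expf_neq0.
    by move=> h; field.
  by rewrite !sqrtr_sqr normrM normfV (gtr0_norm rp) mulrC divfK.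
have [a0|/ltW a0] := leP 0 a.
  exists r, (acos (b / r)); split; [exact: ltW|by rewrite s1 ger0_norm|by rewrite c1 mulrC divfK].
exists r, (- acos (b / r)); split; [exact: ltW|by rewrite sinN mulrN s1 ler0_norm ?opprK|].
by rewrite cosN c1 mulrC divfK.
Qed.

Variables (c1 c2 m : R) (alpha : R[i]).
Local Notation L := (perturbed_op c1 c2 m alpha).
Local Notation Lt := (apply_fun (tr L)).

Section Fixed.
Variables (c : 'rV[R]_N5) (mu : R) (eta : 'I_2 -> R).
Hypothesis mu_ge : 1 / 2 <= `|mu|.
Local Notation F := (fourier c mu eta).
Local Notation test := (test_function (unit_cube c)).

Let mu0 : mu != 0.
Proof. by rewrite -normr_gt0; have := mu_ge; lra. Qed.

Lemma cancel_mu (a b : R) (z w : R[i]) :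
  (2 * mu)%:C * ((a / mu)%:C * z + (- (b / mu))%:C * w) = 2%:C * (a%:C * z - b%:C * w).
Proof.
have E (k : R) : (2 * mu)%:C * (k / mu)%:C = 2%:C * k%:C.
  by apply: complexP; rewrite !(cReM, cImM) /=; [field|ring].
have -> : (- (b / mu))%:C = - (b / mu)%:C by apply: complexP; rewrite ?cReN ?cImN /= ?oppr0.
by rewrite mulrDr mulNr mulrN [_ * (_ * z)]mulrA (E a) [_ * (_ * w)]mulrA (E b) -!mulrA -mulrBr.
Qed.

Lemma is_deriveC_trig (u v : R[i]) x :
  is_deriveC (fun s => (sin s / mu)%:C * u + (cos s / mu)%:C * v) x
    ((cos x / mu)%:C * u + (- (sin x / mu))%:C * v).
Proof.
have D (h : R -> R) (dh : R) : is_derive x 1 h dh -> is_deriveC (fun s => (h s / mu)%:C) x (dh / mu)%:C.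
  move=> H; apply: (@is_deriveC_real R (fun s => h s / mu)).
  rewrite (_ : (fun s => _) = mu^-1 \*: h); last by apply/funext => s; rewrite [LHS]mulrC.
  by apply: (is_derive_eq (is_deriveZ (mu^-1) H)); rewrite /GRing.scale /= mulrC.
have H := is_deriveC_add (is_deriveC_mul (D _ _ (is_derive_sin x)) (is_deriveC_cst u x))
  (is_deriveC_mul (D _ _ (is_derive_cos x)) (is_deriveC_cst v x)).
by apply: (is_deriveC_eq H); rewrite !mulr0 !addr0 mulNr.
Qed.

Lemma radial1E p f x : radial1 p mu eta f x =
  (sin x / mu)%:C * partialC (ix 0) f (pt p mu eta 0 0) + (cos x / mu)%:C * partialC (ix 1) f (pt p mu eta 0 0).
Proof. by rewrite /radial1 (pt0 p mu eta x). Qed.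

Lemma qang_polar r x :
  (m + c1) * (r * sin x) ^+ 2 + (m - c1) * (r * cos x) ^+ 2 + 2 * c2 * (r * sin x) * (r * cos x)
  = r ^+ 2 * qang c1 c2 m x.
Proof.
rewrite /qang [2 * x]mulr_natl mulr2n cosD sinD.
have h : m = m * (cos x ^+ 2 + sin x ^+ 2) by rewrite cos2Dsin2 mulr1.
rewrite [in X in _ = _ * (X - _ + _)]h; ring.
Qed.

(** The angular derivative of F phi along the circle is, up to the factor mu, the
    rotation field. *)
Lemma transport_fourier (sg nu : R) phi p r : mu = sg * nu -> test phi ->
  transport c1 c2 m alpha nu sg r (fun x => F phi (pt p mu eta r x)) (fun x => F (Lt phi) (pt p mu eta r x)).
Proof.
move=> mE t x; have sF := smooth_fourier c mu eta (smooth_test t).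
eexists; first exact: (is_deriveC_angular p mu eta r x sF).
rewrite (fourier_perturbed_op c1 c2 m alpha mu eta t).
have [-> ->] := zeta_pt p eta mu0 r x.
rewrite qang_polar (_ : 2 * sg * nu = 2 * mu); last by rewrite mE mulrA.
rewrite -mE.
set A := F phi _; set B0 := partialC (ix 0) _ _; set B1 := partialC (ix 1) _ _.
rewrite cancel_mu; ring.
Qed.

Lemma is_deriveC_id r : is_deriveC (fun r : R => r%:C) r 1.
Proof. by apply: (@is_deriveC_real R id r 1); exact: is_derive_id. Qed.

Lemma centre_algebra (r am q w dw f f1 g0 g1 M z : R[i]) : M = r * (2%:C * w) -> z = 0 ->
  g0 = - (2%:C * (0 * w) + (0 * 0 * q - am) * f) ->
  g1 = - (0 * (0 * w) + 2%:C * (1 * w + 0 * dw) +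
     (((1 * 0 + 0 * 1) * q + 0 * 0 * 0 + 0) * f + (0 * 0 * q + - am) * f1)) ->
  M + (z - am) * (f + r * f1) = - (g0 + r * g1).
Proof. by move=> -> -> -> ->; ring. Qed.

(** At the centre, V has no angular dependence, so the transport equation on circle
    0 is satisfied by V 0; the first Taylor coefficient in the radius satisfies it
    because the equation can be differentiated in rho at 0, where rho^2 q does not
    contribute. *)
Lemma transport_centre (sg nu : R) phi p r : mu = sg * nu -> test phi ->
  transport c1 c2 m alpha nu sg 0
   (fun x => F phi (pt p mu eta 0 x) + r%:C * radial1 p mu eta (F phi) x)
   (fun x => F (Lt phi) (pt p mu eta 0 x) + r%:C * radial1 p mu eta (F (Lt phi)) x).
Proof.
move=> mE t x; have sF := smooth_fourier c mu eta (smooth_test t).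
have tL : test (Lt phi) := apply_fun_test (tr_smooth (perturbed_op_smooth c1 c2 m alpha)) t.
have sG := smooth_fourier c mu eta (smooth_test tL).
pose D k := partialC (ix k) (F phi).
pose P r := pt p mu eta r x.
pose W r := (cos x)%:C * D 0 (P r) - (sin x)%:C * D 1 (P r).
pose q := (qang c1 c2 m x)%:C; pose am := mu%:C * alpha.
have sD k : smooth (D k) := smooth_partial _ sF.
have E s : F (Lt phi) (P s) = - (2%:C * (s%:C * W s) + (s%:C * s%:C * q - am) * F phi (P s)).
  have [dV DV EV] := transport_fourier p s mE t x.
  have dE := is_deriveC_unique DV (is_deriveC_angular p mu eta s x sF).
  rewrite -[LHS]opprK -[in LHS]EV dE /W /P -/(D 0) -/(D 1).
  have -> : (s ^+ 2 * qang c1 c2 m x)%:C = s%:C * s%:C * q.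
    by rewrite /q; apply: complexP; rewrite !(cReM, cImM) /=; ring.
  rewrite -mE -/am (_ : 2 * sg * nu = 2 * mu); last by rewrite mE mulrA.
  congr (- (_ + _)); set B0 := D 0 _; set B1 := D 1 _.
  rewrite cancel_mu.
  have H (k : R) : (s * k)%:C = s%:C * k%:C by apply: complexP; rewrite !(cReM, cImM) /=; ring.
  by rewrite (H (cos x)) (H (sin x)); ring.
have [dW DW] : exists dW, is_deriveC W 0 dW.
  have R0 := is_deriveC_radial p mu eta 0 x (sD 0); have R1 := is_deriveC_radial p mu eta 0 x (sD 1).
  eexists; exact: (is_deriveC_add (is_deriveC_mul (is_deriveC_cst _ 0) R0)
    (is_deriveC_opp (is_deriveC_mul (is_deriveC_cst _ 0) R1))).
have DF := is_deriveC_radial p mu eta 0 x sF.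
have DG := is_deriveC_radial p mu eta 0 x sG.
have Did := is_deriveC_id 0.
have DR := is_deriveC_opp (is_deriveC_add (is_deriveC_mul (is_deriveC_cst 2%:C 0) (is_deriveC_mul Did DW))
   (is_deriveC_mul (is_deriveC_add (is_deriveC_mul (is_deriveC_mul Did Did) (is_deriveC_cst q 0)) (is_deriveC_cst (- am) 0)) DF)).
have DG' : is_deriveC (fun s => F (Lt phi) (P s)) 0 (radial1 p mu eta (F (Lt phi)) x) := DG.
have FE : (fun s => F (Lt phi) (P s)) = (fun s => - (2%:C * (s%:C * W s) + (s%:C * s%:C * q + - am) * F phi (P s))).
  by apply/funext => s; rewrite E.
rewrite FE in DG'.
have EG := is_deriveC_unique DG' DR.
pose dV1 := (cos x / mu)%:C * D 0 (P 0) + (- (sin x / mu))%:C * D 1 (P 0).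
have P0 s : pt p mu eta 0 s = P 0 by rewrite /P (pt0 p mu eta s) (pt0 p mu eta x).
have rE : radial1 p mu eta (F phi) = fun s => (sin s / mu)%:C * D 0 (P 0) + (cos s / mu)%:C * D 1 (P 0).
  by apply/funext => s; rewrite radial1E (P0 0).
exists (r%:C * dV1).
  have fE : (fun s => F phi (pt p mu eta 0 s) + r%:C * radial1 p mu eta (F phi) s) =
    (fun s => F phi (P 0) + r%:C * ((sin s / mu)%:C * D 0 (P 0) + (cos s / mu)%:C * D 1 (P 0))).
    by apply/funext => s; rewrite rE (P0 s).
  rewrite fE; move: (F phi (P 0)) (D 0 (P 0)) (D 1 (P 0)) @dV1 => w u v /=.
  have H := is_deriveC_add (is_deriveC_cst w x) (is_deriveC_mul (is_deriveC_cst r%:C x) (is_deriveC_trig u v x)).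
  by apply: (is_deriveC_eq H); rewrite mul0r !add0r.
have HM : (2 * sg * nu)%:C * (r%:C * dV1) = r%:C * (2%:C * W 0).
  rewrite (_ : 2 * sg * nu = 2 * mu); last by rewrite mE mulrA.
  by rewrite mulrCA /dV1 cancel_mu.
have z0 : (0 ^+ 2 * qang c1 c2 m x)%:C = 0 :> R[i] by rewrite expr2 !mul0r.
have amE : (sg * nu)%:C * alpha = am by rewrite -mE.
rewrite amE; exact: (centre_algebra HM z0 (E 0) EG).
Qed.

End Fixed.

Theorem fourier_estimate : 0 < m -> c1 ^+ 2 + c2 ^+ 2 <= m ^+ 2 ->
  exists2 C : R, 0 <= C & forall c mu eta phi (K : R), 1 / 2 <= `|mu| -> test_function (unit_cube c) phi ->
  (forall p, normc (fourier c mu eta (Lt phi) p) <= K) ->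
  (forall k p, normc (fourier c mu eta (Xf k (Lt phi)) p) <= K) ->
  (forall k l p, normc (fourier c mu eta (Xf l (Xf k (Lt phi))) p) <= K) ->
  forall p, normc (fourier c mu eta phi p) <= C * (1 + (zeta mu eta 0 p ^+ 2 + zeta mu eta 1 p ^+ 2)) * K.
Proof.
move=> m0 cm; have [C C0 HC] := circle_bound alpha m0 cm.
exists (C * 64) => [|c mu eta phi K mg t H0 H1 H2 p]; first exact: mulr_ge0.
have mu0 : mu != 0 by rewrite -normr_gt0; lra.
have tL : test_function (unit_cube c) (Lt phi) := apply_fun_test (tr_smooth (perturbed_op_smooth c1 c2 m alpha)) t.
have sF := smooth_fourier c mu eta (smooth_test t).
have sG := smooth_fourier c mu eta (smooth_test tL).
have H1' k q : normc (partialC (ix k) (fourier c mu eta (Lt phi)) q) <= K by rewrite -(fourier_X mu eta k tL).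
have H2' k l q : normc (partialC (ix l) (partialC (ix k) (fourier c mu eta (Lt phi))) q) <= K.
  by rewrite -(fourier_X mu eta k tL) -(fourier_X mu eta l (Xf_test k tL)).
have [B B0 HB] : exists2 B, 0 <= B & forall k q, normc (partialC (ix k) (fourier c mu eta phi) q) <= B.
  have [B0 B00 HB0] := test_bounded (Xf_test 0 t); have [B1 B10 HB1] := test_bounded (Xf_test 1 t).
  exists (64 * (B0 + B1)) => [|k q]; first by rewrite mulr_ge0 ?addr_ge0.
  rewrite -(fourier_X mu eta k t); apply: (fourier_bound c mu eta q (smooth_test (Xf_test k t))) => s.
  elim/ord2_cases: k; [apply: le_trans (HB0 s) _|apply: le_trans (HB1 s) _]; lra.
have K0 : 0 <= K := le_trans (normc_ge0 _) (H0 p).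
pose sg : R := if 0 <= mu then 1 else -1.
have sg1 : sg = 1 \/ sg = -1 by rewrite /sg; case: ifP => _; [left|right].
have mE : mu = sg * `|mu|.
  by rewrite /sg; case: ifP => h; [rewrite mul1r ger0_norm|rewrite mulN1r ltr0_norm ?opprK // ltNge h].
have [r [x [r0 ra rb]]] := polar (zeta mu eta 0 p) (zeta mu eta 1 p).
have pE : p = pt p mu eta r x.
  apply/rowP => j; rewrite /pt !updE ra rb /zeta !(addrAC _ _ (- eta _)) !subrr !add0r !(mulrC mu) !mulfK //.
  by case: eqP => [->|_] //; case: eqP => [->|].
have E : zeta mu eta 0 p ^+ 2 + zeta mu eta 1 p ^+ 2 = r ^+ 2.
  by rewrite -ra -rb !exprMn -mulrDr addrC cos2Dsin2 mulr1.
rewrite E {1}pE.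
have -> : C * 64 * (1 + r ^+ 2) * K = C * (1 + r ^+ 2) * (64 * K) by ring.
pose V r x := fourier c mu eta phi (pt p mu eta r x).
pose G r x := fourier c mu eta (Lt phi) (pt p mu eta r x).
have P1 s : transport c1 c2 m alpha `|mu| sg s (V s) (G s) := transport_fourier eta mg p s mE t.
have P2 s y : V s (y - sg * (2 * pi)) = V s y := congr1 (fourier c mu eta phi) (pt_turn p mu eta s y sg1).
have P3 s s' y : normc (V s y - V s' y) <= 8 * B * `|s - s'| := radial_lip p eta mu0 mg sF HB s s' y.
have P4 s y : normc (G s y) <= 64 * K by apply: le_trans (H0 _) _; rewrite ler_peMl ?ler1n.
have P5 s s' y : normc (G s y - G s' y) <= 64 * K * `|s - s'|.
  apply: le_trans (radial_lip p eta mu0 mg sG H1' s s' y) _.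
  by rewrite ler_wpM2r // ler_wpM2r ?ler_nat.
have P6 s y : normc (G s y - (G 0 y + s%:C * radial1 p mu eta (fourier c mu eta (Lt phi)) y)) <= 64 * K * s ^+ 2
  := radial_taylor p eta mu0 mg sG H2' s y.
have P7 y : radial1 p mu eta (fourier c mu eta phi) (y - sg * (2 * pi)) = radial1 p mu eta (fourier c mu eta phi) y.
  have [sE cE] : sin (y - sg * (2 * pi)) = sin y /\ cos (y - sg * (2 * pi)) = cos y.
    have E2 (z : R) : sin (z + 2 * pi) = sin z /\ cos (z + 2 * pi) = cos z.
      by rewrite (mulr_natl pi 2) sinD2pi cosD2pi.
    case: sg1 => ->; rewrite ?mul1r ?mulN1r ?opprK //.
    by have := E2 (y - 2 * pi); rewrite subrK => -[-> ->].
  by rewrite radial1E radial1E sE cE.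
have P8 s := transport_centre eta mg p s mE t.
exact: (HC _ sg mg sg1 V G (64 * K) (8 * B) P1 P2 P3 P4 P5 (ex_intro _ _ (ex_intro _ _ (And3 P8 P7 P6))) r x r0).
Qed.

End CircleApplication.

(** * Summing the Fourier coefficients *)

Section Summation.
Variable R : realType.
Local Notation N5 := (2 + 2 + 1)%N.
Local Notation normc := Normc.normc.
Implicit Types (f g psi phi : 'rV[R]_N5 -> R[i]) (p q : 'rV[R]_N5).

(** x / (1 + |x|) is bounded and its unit increments dominate 1 / (1 + x^2), which
    allows summing the latter by telescoping. *)
Lemma increment_lower (x : R) :
  1 / (1 + x ^+ 2) <= 4 * ((x + 1) / (1 + `|x + 1|) - x / (1 + `|x|)).
Proof.
have x2 : 0 < 1 + x ^+ 2 by rewrite ltr_pwDl ?sqr_ge0.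
rewrite ler_pdivrMr //.
have [x0|x0] := leP 0 x.
  rewrite !ger0_norm //; last by rewrite addr_ge0.
  have h1 : 0 < 1 + x by rewrite ltr_pwDl.
  have h2 : 0 < 1 + (x + 1) by rewrite ltr_pwDl // addr_ge0.
  have -> : (x + 1) / (1 + (x + 1)) - x / (1 + x) = ((1 + x) * (1 + (x + 1)))^-1 by field; rewrite !gt_eqF.
  rewrite mulrAC ler_pdivlMr ?mulr_gt0 // mul1r; nra.
have [x1|x1] := leP 0 (x + 1).
  rewrite (ltr0_norm x0) (ger0_norm x1).
  have h1 : 0 < 1 - x by lra.
  have h2 : 0 < 1 + (x + 1) by lra.
  have a : (x + 1) / 2 <= (x + 1) / (1 + (x + 1)).
    by rewrite ler_wpM2l // lef_pV2 ?posrE //; lra.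
  have b : - x / 2 <= - (x / (1 - x)).
    by rewrite -mulNr ler_wpM2l ?lef_pV2 ?posrE //; lra.
  have : x ^+ 2 <= 1 by nra.
  move: a b; set u := _ / (1 + (x + 1)); set v := x / (1 - x) => a b c.
  have uv : 1 / 2 <= u - v by lra.
  nra.
rewrite (ltr0_norm x0) (ltr0_norm x1).
have h1 : 0 < 1 - x by lra.
have h2 : 0 < - x by lra.
have -> : (x + 1) / (1 - (x + 1)) - x / (1 - x) = ((- x) * (1 - x))^-1.
  have -> : 1 - (x + 1) = - x by ring.
  have xn : x != 0 by rewrite lt_eqF.
  have xn1 : 1 - x != 0 by rewrite gt_eqF.
  by field; rewrite ?xn ?xn1.
by rewrite mulrAC ler_pdivlMr ?mulr_gt0 // mul1r; nra.
Qed.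

Lemma window_sum (d : R) N j :
  \sum_(l < N) 1 / (1 + (((Posz l - Posz j)%:~R : R) + d) ^+ 2) <= 8.
Proof.
pose F (x : R) := x / (1 + `|x|).
have F1 x : `|F x| <= 1.
  have h : 0 < 1 + `|x| by rewrite ltr_pwDl.
  by rewrite normrM normfV (gtr0_norm h) ler_pdivrMr // mul1r lerDr.
pose x l := ((Posz l - Posz j)%:~R : R) + d.
have xS l : x l.+1 = x l + 1.
  by rewrite /x -addn1 PoszD addrAC intrD; ring.
have T : \sum_(l < N) 1 / (1 + x l ^+ 2) <= 4 * (F (x N) - F (x 0%N)).
  elim: N => [|N ih]; first by rewrite big_ord0 subrr mulr0.
  rewrite big_ord_recr /=; apply: le_trans (lerD ih (increment_lower (x N))) _.
  by rewrite -mulrDr ler_wpM2l // -xS /F addrC subrKA.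
apply: (le_trans T); have := F1 (x N); have := F1 (x 0%N); rewrite !ler_norml => /andP[a _] /andP[_ b]; lra.
Qed.

Variable c : 'rV[R]_N5.
Local Notation test := (test_function (unit_cube c)).

(** For |t - s| >= 1 the sup bound suffices; otherwise either both values vanish or
    the segment lies in a fixed compact set, where the derivative is bounded. *)
Lemma slice_lip f p j : smooth f -> vanish c j f ->
  exists L : R, forall s t, normc (f (upd p j t) - f (upd p j s)) <= L * `|t - s|.
Proof.
move=> sf v; set a := c ord0 j.
pose M := `|p| + (`|a - 2| + `|a + 2|).
have [B0 B00 HB0] := smooth_bounded M sf.
have [B1 B10 HB1] := smooth_bounded M (smooth_partial j sf).
have D t : is_deriveC (fun t => f (upd p j t)) t (partialC j f (upd p j t)).
  move/smoothE: sf => [s1 s2]; split.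
    exact: (is_derive_upd (smoothR_derivable s1)).
  exact: (is_derive_upd (smoothR_derivable s2)).
have a2 : a - 2 < a + 2 by lra.
have uM t : a - 2 <= t <= a + 2 -> `|upd p j t| <= M by exact: upd_norm.
have f0 t : 1 <= `|t - a| -> f (upd p j t) = 0 by move=> h; apply: v; rewrite updE eqxx.
have fB t : normc (f (upd p j t)) <= B0.
  have [h|h] := leP 1 `|t - a|; first by rewrite f0 // Normc.normc0.
  by apply/HB0/uM; move: h; rewrite ltr_norml => /andP[h1 h2]; apply/andP; split; lra.
exists (2 * B0 + 2 * B1) => s t.
have [h|h] := leP 1 `|t - s|.
  apply: (@le_trans _ _ (2 * B0)).
    by apply: le_trans (normc_distD _ _) _; rewrite mulr2n mulrDl mul1r; exact: lerD.
  have : 2 * B0 * 1 <= 2 * B0 * `|t - s| by rewrite ler_wpM2l // mulr_ge0.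
  by rewrite mulr1 [X in _ -> _ <= X]mulrDl => k; apply: (le_trans k); rewrite lerDl !mulr_ge0.
have [h1|h1] := leP 1 `|t - a|; have [h2|h2] := leP 1 `|s - a|.
  by rewrite !f0 // subrr Normc.normc0 mulr_ge0 // addr_ge0 ?mulr_ge0.
all: apply: (@le_trans _ _ (2 * B1 * `|t - s|));
  last by rewrite [leRHS]mulrDl lerDr !mulr_ge0.
all: apply: (mvt_between D) => z zz; apply/HB1/uM; move: zz h;
  rewrite ltr_norml => /andP[z1 z2] /andP[h3 h4];
  rewrite ?ltr_norml in h1 h2; move: h1 h2 => *;
  repeat match goal with H : is_true (_ && _) |- _ => case/andP: H => ? ? end.
all: have zs : Num.min s t <= z <= Num.max s t by rewrite z1 z2.
all: move: z1 z2; rewrite ge_min le_max => /orP[k1|k1] /orP[k2|k2]; apply/andP; split; lra.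
Qed.

Lemma stage_sup f j p (b : int -> R) (B : R) : smooth f -> vanish c j f ->
  (forall k : int, normc (J c j (fun q => phase (theta1 j k%:~R) q * f q) p) <= b k) ->
  (forall N i, \sum_(l < N) b (Posz l - Posz i) <= B) -> normc (f p) <= B.
Proof.
move=> sf v hb hB; have [L HL] := slice_lip p sf v.
rewrite -[p in f p](upd_id p j).
apply: (@fourier_sup _ (fun t => f (upd p j t)) (c ord0 j) L B b).
- exact: (slice_contC j p sf).
- move=> t tt; apply: v; rewrite updE eqxx; move: tt; apply: contraR; rewrite -ltNge => h.
  by move: h; rewrite ltr_norml => /andP[h1 h2]; apply/andP; split; lra.
- by [].
- move=> k; have := hb k; rewrite /J /JC.
  rewrite (_ : (fun t => f (upd p j t) * cis (- (k%:~R * t))) =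
    (fun t => phase (theta1 j k%:~R) (upd p j t) * f (upd p j t))) //.
  by apply/funext => t; rewrite mulrC /phase /theta1 updE eqxx.
- exact: hB.
Qed.

(** Half-integral frequencies in u are integral ones for f multiplied by
    e^(- i u / 2). *)
Lemma fourier_u_half (k : R) f p : smooth f ->
  normc (fourier_u c (k + 2^-1) f p) =
  normc (J c iu (fun q => phase (theta1 iu k) q * (phase (theta1 iu 2^-1) q * f q)) p).
Proof.
move=> sf; have s1 := smooth_phase (smoothR_theta1 iu k); have s2 := smooth_phase (smoothR_theta1 iu (2^-1 : R)).
pose w (q : 'rV[R]_N5) : R[i] := cis (- ((k + 2^-1) * (bilin q / 2))).
have E : (fun q => phase (theta3 (k + 2^-1)) q * f q) =
   (fun q => w q * (phase (theta1 iu k) q * (phase (theta1 iu 2^-1) q * f q))).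
  apply/funext => q; rewrite !mulrA; congr (_ * _).
  rewrite /w /phase -!cisD; congr cis; rewrite /theta3 /theta1; ring.
have wI q t : w (upd q iu t) = w q by rewrite /w /bilin !updE !ixE.
rewrite /fourier_u E (J_mul c (smooth_mul s1 (smooth_mul s2 sf)) wI).
by rewrite Normc.normcM normc_cis mul1r.
Qed.

Lemma fourier_u_sup f p (b : int -> R) (B : R) : smooth f -> vanish c iu f ->
  (forall k : int, normc (fourier_u c (k%:~R + 2^-1) f p) <= b k) ->
  (forall N i, \sum_(l < N) b (Posz l - Posz i) <= B) -> normc (f p) <= B.
Proof.
move=> sf v hb hB; have s2 := smooth_phase (smoothR_theta1 iu (2^-1 : R)).
have -> : normc (f p) = normc (phase (theta1 iu 2^-1) p * f p).
  by rewrite Normc.normcM normc_phase mul1r.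
apply: (@stage_sup (fun q => phase (theta1 iu 2^-1) q * f q) iu p b B (smooth_mul s2 sf) (vanish_mul _ v) _ hB).
by move=> k; rewrite -(fourier_u_half _ _ sf).
Qed.

Definition eta2 (e0 e1 : R) : 'I_2 -> R := fun k => if k == 0 then e0 else e1.

(** The Fourier series is summed one variable at a time.  Each summation uses up one
    factor of the weight and costs a factor 8 from [window_sum]. *)
Lemma inversion phi (T : R) : test phi ->
  (forall (k k0 k1 : int) p, normc (fourier c (k%:~R + 2^-1) (eta2 k0%:~R k1%:~R) phi p)
      * weight (k%:~R + 2^-1) (eta2 k0%:~R k1%:~R) <= T) ->
  forall p, normc (phi p) <= 512 * T.
Proof.
move=> t H p; have s := smooth_test t; have v j := test_vanish (j := j) t.
have pos (x : R) : 0 < 1 + x ^+ 2 by rewrite ltr_pwDl ?sqr_ge0.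
have sum (K : R) (d : R) N i : 0 <= K ->
  \sum_(l < N) K / (1 + (((Posz l - Posz i)%:~R : R) + d) ^+ 2) <= 8 * K.
  move=> K0; rewrite (eq_bigr (fun l : 'I_N => K * (1 / (1 + (((Posz l - Posz i)%:~R : R) + d) ^+ 2)))).
    by rewrite -mulr_sumr mulrC ler_wpM2r // window_sum.
  by move=> l _; rewrite mul1r.
have T0 : 0 <= T.
  apply: le_trans (H 0 0 0 p); rewrite mulr_ge0 ?normc_ge0 //.
  exact: le_trans ler01 (weight_ge1 _ _).
have A (k k1 : int) q : normc (fourier_y c 1 k1%:~R (fourier_u c (k%:~R + 2^-1) phi) q) <=
    8 * T / (1 + (k%:~R + 2^-1) ^+ 2) / (1 + (k1%:~R + 0) ^+ 2).
  set m := k%:~R + 2^-1; rewrite addr0.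
  have s3 := smooth_fourier_u c m s; have s1 := smooth_fourier_y c 1 k1%:~R s3.
  pose K := T / (1 + m ^+ 2) / (1 + k1%:~R ^+ 2).
  have K0 : 0 <= K by rewrite !divr_ge0 // ltW.
  have -> : 8 * T / (1 + m ^+ 2) / (1 + k1%:~R ^+ 2) = 8 * K by rewrite /K !mulrA.
  apply: (@stage_sup _ (iy 0) q (fun k0 => K / (1 + (k0%:~R + 0) ^+ 2)) _ s1).
  - apply: vanish_fourier_y; first by rewrite iy_eq.
    by apply: vanish_fourier_u; [rewrite iuy_eq|exact: v].
  - move=> k0; rewrite addr0 /K ler_pdivlMr // ler_pdivlMr // ler_pdivlMr //.
    apply: le_trans (H k k0 k1 q); rewrite /weight /eta2 /= -!mulrA ler_wpM2l ?normc_ge0 //.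
    by rewrite mulrA mulrC.
  by move=> N i; exact: sum.
have B (k : int) q : normc (fourier_u c (k%:~R + 2^-1) phi q) <= 64 * T / (1 + (k%:~R + 2^-1) ^+ 2).
  set m := k%:~R + 2^-1; have s3 := smooth_fourier_u c m s.
  pose K := 8 * T / (1 + m ^+ 2); have K0 : 0 <= K by rewrite divr_ge0 ?mulr_ge0 // ltW.
  have -> : 64 * T / (1 + m ^+ 2) = 8 * K by rewrite /K !mulrA; congr (_ * _ / _); ring.
  apply: (@stage_sup _ (iy 1) q (fun k1 => K / (1 + (k1%:~R + 0) ^+ 2)) _ s3).
  - by apply: vanish_fourier_u; [rewrite iuy_eq|exact: v].
  - by move=> k1; exact: A.
  by move=> N i; exact: sum.
apply: (@fourier_u_sup _ p (fun k => 64 * T / (1 + (k%:~R + 2^-1) ^+ 2)) _ s (v iu)).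
  by move=> k; exact: B.
move=> N i; have -> : 512 * T = 8 * (64 * T) by ring.
by apply: sum; rewrite mulr_ge0.
Qed.

End Summation.

(** * The a-priori estimate and local solvability *)

Section LocalSolvability.
Variable R : realType.
Local Notation N5 := (2 + 2 + 1)%N.
Local Notation normc := Normc.normc.
Implicit Types (f g psi phi : 'rV[R]_N5 -> R[i]) (p q : 'rV[R]_N5).

Lemma affine_sq (e mu x M : R) : 1 <= M -> `|x| <= M ->
  (e + mu * x) ^+ 2 <= 2 * M ^+ 2 * (e ^+ 2 + mu ^+ 2).
Proof.
move=> M1 xM; have x2 : x ^+ 2 <= M ^+ 2.
  by rewrite -[leLHS]real_normK ?num_real // ler_pXn2r ?nnegrE // (le_trans ler01).
have M2 : 1 <= M ^+ 2 by rewrite exprn_ege1.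
have a1 : mu ^+ 2 * x ^+ 2 <= mu ^+ 2 * M ^+ 2 by rewrite ler_wpM2l ?sqr_ge0.
have a2 : e ^+ 2 <= M ^+ 2 * e ^+ 2 by rewrite ler_peMl ?sqr_ge0.
have h := sqr_ge0 (e - mu * x).
have -> : (e + mu * x) ^+ 2 = 2 * (e ^+ 2 + mu ^+ 2 * x ^+ 2) - (e - mu * x) ^+ 2 by ring.
lra.
Qed.

Lemma sum_le_prod (a b d : R) : 0 <= a -> 0 <= b -> 0 <= d ->
  1 + 2 * (a + d) + 2 * (b + d) <= 9 * ((1 + d) * ((1 + a) * (1 + b))).
Proof.
move=> a0 b0 d0; have ab := mulr_ge0 a0 b0; have da := mulr_ge0 d0 a0.
have db := mulr_ge0 d0 b0; have dab := mulr_ge0 d0 ab.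
have -> : (1 + d) * ((1 + a) * (1 + b)) = 1 + a + b + a * b + d + d * a + d * b + d * (a * b) by ring.
lra.
Qed.

(** The growth in rho allowed by [circle_bound] is compensated by one factor of the
    weight. *)
Lemma zeta_weight mu eta (M : R) p : 1 <= M -> (forall k, `|p ord0 (ix k)| <= M) ->
  1 + (zeta mu eta 0 p ^+ 2 + zeta mu eta 1 p ^+ 2) <= 9 * M ^+ 2 * weight mu eta.
Proof.
move=> M1 HM; have M2 : 1 <= M ^+ 2 by rewrite exprn_ege1.
have s k := affine_sq (eta k) mu M1 (HM k).
rewrite /weight [9 * _]mulrC -mulrA.
apply: le_trans (ler_wpM2l (le_trans ler01 M2) (sum_le_prod (sqr_ge0 (eta 0)) (sqr_ge0 (eta 1)) (sqr_ge0 mu))).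
have := s 0; have := s 1; rewrite -/(zeta mu eta 0 p) -/(zeta mu eta 1 p); lra.
Qed.

Lemma unit_cube_norm (c p : 'rV[R]_N5) : unit_cube c p -> `|p| <= `|c| + 1.
Proof.
move=> h; apply: rV_norm_le => [|j]; first by rewrite addr_ge0.
rewrite -[p ord0 j](subrK (c ord0 j)) addrC (le_trans (ler_normD _ _)) // lerD ?rV_coord_norm //.
exact: ltW.
Qed.

Lemma unit_cube_center (c : 'rV[R]_N5) : unit_cube c c.
Proof. by move=> i; rewrite subrr normr0. Qed.

Lemma unit_cube_open (c : 'rV[R]_N5) : open (unit_cube c).
Proof.
rewrite openE => p hp; apply/nbhs_ballP.
(* distance of p to the complement of the cube, capped at 1 *)
pose d := \big[Num.min/1]_(i < N5) (1 - `|p ord0 i - c ord0 i|).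
have d0 : 0 < d.
  by rewrite /d; elim/big_rec: _ => // i x _ x0; rewrite lt_min x0 subr_gt0 hp.
have dle i : d <= 1 - `|p ord0 i - c ord0 i| by rewrite /d (bigD1 i) //= ge_min lexx.
exists d => //= q; rewrite -ball_normE /= => pq i.
have := le_lt_trans (rV_coord_norm (p - q) i) pq; rewrite !mxE => h.
have -> : q ord0 i - c ord0 i = (p ord0 i - c ord0 i) - (p ord0 i - q ord0 i) by ring.
apply: le_lt_trans (ler_normB _ _) _; have := dle i; lra.
Qed.

(** Apply the bound for F to opWeight^2 P psi. *)
Lemma fourier_decay (c : 'rV[R]_N5) (P : diffop R N5) : smooth_coefficients P ->
  exists N, exists2 C : R, 0 <= C & forall psi mu eta p, test_function (unit_cube c) psi ->
    normc (fourier c mu eta (apply_fun P psi) p) * weight mu eta ^+ 2 <= C * Ck_norm N psi.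
Proof.
move=> sP; have sL := opWeight_smooth R.
have sQ : smooth_coefficients (opWeight R * (opWeight R * P))%DO by split.
have [N [C C0 HC]] := Ck_norm_apply (@unit_cube_norm c) sQ 0.
exists N, (64 * C) => [|psi mu eta p t]; first exact: mulr_ge0.
have tP := apply_fun_test sP t; have tLP := apply_fun_test sL tP; have tLLP := apply_fun_test sL tLP.
have := fourier_bound c mu eta p (smooth_test tLLP) (fun q => Ck_norm_val 0 q tLLP).
rewrite (fourier_opWeight mu eta tLP) (fourier_opWeight mu eta tP) !Normc.normcM !normc_real.
rewrite (ger0_norm (le_trans ler01 (weight_ge1 mu eta))) => h.
rewrite expr2 mulrC -mulrA; apply: (le_trans h); rewrite -mulrA ler_wpM2l //; exact: HC.
Qed.

Lemma fourier_decay_family (c : 'rV[R]_N5) (I : finType) (P : I -> diffop R N5) :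
  (forall i, smooth_coefficients (P i)) ->
  exists N, exists2 C : R, 0 <= C & forall i psi mu eta p, test_function (unit_cube c) psi ->
    normc (fourier c mu eta (apply_fun (P i) psi) p) * weight mu eta ^+ 2 <= C * Ck_norm N psi.
Proof.
move=> sP; have H i : exists NC : nat * R, 0 <= NC.2 /\ forall psi mu eta p, test_function (unit_cube c) psi ->
    normc (fourier c mu eta (apply_fun (P i) psi) p) * weight mu eta ^+ 2 <= NC.2 * Ck_norm NC.1 psi.
  by have [N [C C0 HC]] := fourier_decay c (sP i); exists (N, C).
have /choice[g Hg] := H.
exists (\max_i (g i).1), (\sum_i (g i).2) => [|i psi mu eta p t].
  by apply: sumr_ge0 => i _; have [] := Hg i.
have [C0 HC] := Hg i; apply: le_trans (HC _ _ _ _ t) _.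
apply: ler_pM => //; first exact: (Ck_norm_ge0 _ t).
  by rewrite (bigD1 i) //= lerDl sumr_ge0 // => k _; have [] := Hg k.
by apply: (Ck_norm_mono t); exact: leq_bigmax.
Qed.

Variables (c1 c2 m : R) (alpha : R[i]).
Hypothesis m0 : 0 < m.
Hypothesis cm : c1 ^+ 2 + c2 ^+ 2 <= m ^+ 2.
Local Notation L := (perturbed_op c1 c2 m alpha).
Local Notation Lt := (apply_fun (tr L)).

Definition opXo (a : option 'I_2) : diffop R N5 :=
  if a is Some k then opX R k else OpMul (fun=> 1).

Lemma opXo_smooth a : smooth_coefficients (opXo a).
Proof. by case: a => [k|]; [exact: opX_smooth|exact: smooth_cst]. Qed.

Lemma one_apply f : apply_fun (opXo None) f = f.
Proof. by apply/funext => p /=; rewrite mul1r. Qed.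

(** [circle_bound] loses a factor 1 + rho^2, hence one weight, and [inversion] needs
    another one; two weights are available from [fourier_decay]. *)
Theorem apriori_estimate (c : 'rV[R]_N5) : exists N, exists2 C : R, 0 <= C &
  forall phi p, test_function (unit_cube c) phi -> normc (phi p) <= C * Ck_norm N (Lt phi).
Proof.
have [C1 C10 HC1] := fourier_estimate alpha m0 cm.
(* the operators 1, X_k and X_l X_k, whose values at L^t phi enter fourier_estimate *)
pose P (ab : option 'I_2 * option 'I_2) := (opXo ab.1 * opXo ab.2)%DO.
have sP ab : smooth_coefficients (P ab) by split; exact: opXo_smooth.
have [N [C2 C20 HC2]] := fourier_decay_family c sP.
pose M := `|c| + 1.
have M1 : 1 <= M by rewrite /M lerDr.
have M0 : 0 <= M := le_trans ler01 M1.
exists N, (512 * (C1 * (9 * M ^+ 2) * C2)) => [|phi p t].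
  exact: (mulr_ge0 (ler0n _ 512) (mulr_ge0 (mulr_ge0 C10 (mulr_ge0 (ler0n _ 9) (sqr_ge0 M))) C20)).
have tL := apply_fun_test (tr_smooth (perturbed_op_smooth c1 c2 m alpha)) t.
set S := Ck_norm N (Lt phi); have S0 : 0 <= S := Ck_norm_ge0 N tL.
rewrite -mulrA; apply: (inversion t) => k k0 k1 q.
set mu := k%:~R + 2^-1; set eta := eta2 _ _.
have [out|ins] := pselect (exists l, 1 <= `|q ord0 (ix l) - c ord0 (ix l)|).
  have [l hl] := out; rewrite (fourier_vanish mu eta t hl) Normc.normc0 mul0r.
  by rewrite !mulr_ge0.
have qM l : `|q ord0 (ix l)| <= M.
  have h : `|q ord0 (ix l) - c ord0 (ix l)| < 1 by rewrite ltNge; apply/negP => h; apply: ins; exists l.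
  rewrite -[q ord0 _](subrK (c ord0 (ix l))) addrC (le_trans (ler_normD _ _)) // lerD ?rV_coord_norm //.
  exact: ltW.
have lp : 0 < weight mu eta := lt_le_trans ltr01 (weight_ge1 mu eta).
pose K := C2 * S / weight mu eta ^+ 2.
have KE a b r : normc (fourier c mu eta (apply_fun (opXo a) (apply_fun (opXo b) (Lt phi))) r) <= K.
  by rewrite /K ler_pdivlMr ?exprn_gt0 //; exact: (HC2 (a, b) _ mu eta r tL).
have mu_ge : 1 / 2 <= `|mu|.
  rewrite /mu; case: (leP 0 k) => k_0.
    have kR : 0 <= k%:~R :> R by rewrite ler0z.
    by rewrite ger0_norm; lra.
  have kR : (k + 1)%:~R <= 0 :> R by rewrite lerz0 lezD1.
  rewrite intrD in kR.
  by rewrite ler0_norm; lra.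
have H0 r : normc (fourier c mu eta (Lt phi) r) <= K.
  by have := KE None None r; rewrite !one_apply.
have H1 l r : normc (fourier c mu eta (Xf l (Lt phi)) r) <= K.
  by have := KE (Some l) None r; rewrite one_apply.
have H2 l l' r : normc (fourier c mu eta (Xf l' (Xf l (Lt phi))) r) <= K.
  exact: (KE (Some l') (Some l) r).
have E := HC1 c mu eta phi K mu_ge t H0 H1 H2 q.
have Z := zeta_weight mu eta M1 qM.
have K0 : 0 <= K := le_trans (normc_ge0 _) (H0 q).
apply: (@le_trans _ _ (C1 * (9 * M ^+ 2 * weight mu eta) * K * weight mu eta)).
  rewrite ler_wpM2r ?(ltW lp) //; apply: (le_trans E).
  by rewrite ler_wpM2r // ler_wpM2l.
rewrite /K; move: (weight mu eta) lp => l lp; have ln : l != 0 by rewrite gt_eqF.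
by rewrite le_eqVlt; apply/orP; left; apply/eqP; field; rewrite ln.
Qed.

Theorem perturbed_op_solvable : locally_solvable L.
Proof.
move=> p; have sL := perturbed_op_smooth c1 c2 m alpha; split=> //.
exists (unit_cube p); split; [exact: unit_cube_open|exact: unit_cube_center|].
have [N [C C0 est]] := apriori_estimate p.
apply: (solvable_of_estimate sL _ (@unit_cube_norm p) C0 est).
by rewrite addr_ge0.
Qed.

End LocalSolvability.

(** * Uniqueness of the semisimple part *)

Section Semisimple.
Variables (F : fieldType) (n : nat).
Implicit Types (M D N E : 'M[F]_n.+1).

Lemma diag_exp (d : 'rV[F]_n.+1) k : (diag_mx d) ^+ k = diag_mx (\row_i d 0 i ^+ k).
Proof.
elim: k => [|k ih].
  by apply/matrixP => i j; rewrite !mxE; case: eqP.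
rewrite exprS ih -[LHS]/(_ *m _) mulmx_diag; congr diag_mx; apply/rowP => i; rewrite !mxE exprS.
by [].
Qed.

Lemma nilpotent_diag (d : 'rV[F]_n.+1) k : (diag_mx d) ^+ k = 0 -> d = 0.
Proof.
rewrite diag_exp => /matrixP H; apply/rowP => i; rewrite mxE.
by have := H i i; rewrite !mxE eqxx mulr1n => /eqP; rewrite expf_eq0 => /andP[_ /eqP].
Qed.

Lemma involution_diagonalizable D : 2%:R != 0 :> F -> D * D = 1 -> diagonalizable D.
Proof.
move=> n2 DD; apply/diagonalizableP; exists [:: 1; -1].
  by rewrite /= inE andbT -subr_eq0 opprK.
apply: mxminpoly_min; rewrite big_cons big_seq1 rmorphM !rmorphB /= !horner_mx_X !horner_mx_C.
rewrite mulrBl mulrBr DD; rewrite (_ : (-1)%:M = -1 :> 'M_n.+1); last by rewrite raddfN.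
by rewrite mulrN1 opprK -[1%:M]/(1 : 'M[F]_n.+1) mul1r opprK addrC [1 + D]addrC addNr.
Qed.

(** In a basis of eigenvectors, D D - 1 is diagonal, and a nilpotent diagonal matrix
    is 0. *)
Lemma diagonalizable_involution D k : diagonalizable D -> (D * D - 1) ^+ k = 0 -> D * D = 1.
Proof.
move=> [P Pu /diagonalizable_forPex[d /(simmxP Pu)]] PDm nil.
have PD : P * D = diag_mx d * P := PDm.
pose e : 'rV[F]_n.+1 := \row_i (d 0 i * d 0 i - 1).
have PE : P * (D * D - 1) = diag_mx e * P.
  have -> : diag_mx e = diag_mx d * diag_mx d - 1.
    by apply/matrixP => i j; rewrite -[diag_mx d * _]/(_ *m _) mulmx_diag !mxE; case: eqP; rewrite ?subrr.
  by rewrite mulrBr mulrBl mulr1 mul1r mulrA PD -mulrA PD mulrA.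
have PEk j : P * (D * D - 1) ^+ j = diag_mx e ^+ j * P.
  elim: j => [|j ih]; first by rewrite mulr1 mul1r.
  by rewrite exprSr mulrA ih -mulrA PE mulrA -exprSr.
have Pu' : P \is a GRing.unit by [].
have e0 : e = 0.
  apply: (@nilpotent_diag _ k); have := PEk k; rewrite nil mulr0 => /esym/eqP.
  by move=> /eqP h; rewrite -[LHS](mulrK Pu') h mul0r.
have : P * (D * D - 1) = 0 by rewrite PE e0 raddf0 mul0r.
by move=> h; apply/eqP; rewrite -subr_eq0 -[_ - _](mulKr Pu') h mulr0.
Qed.

Lemma nilpotent_sub (A B : 'M[F]_n.+1) k : GRing.comm A B -> A ^+ k = 0 -> B * B = 0 -> (A - B) ^+ k.+1 = 0.
Proof.
move=> AB Ak BB; rewrite exprBn_comm // big1 // => i _.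
case: i => [[|[|i]] ik] /=.
- by rewrite subn0 exprS Ak mulr0 !mulr0 mul0r mul0rn.
- by rewrite subSS subn0 Ak mulr0 mul0r mul0rn.
by rewrite (exprS B) (exprS B) mulrA BB mul0r mulr0 mul0rn.
Qed.

(** From S^2 = 1 + 2 D N and S^3 = D + 3 N, N is a polynomial in S, so D' commutes
    with D and N, and E = D - D' = N' - N is nilpotent.  Then D' D' - 1 is nilpotent
    as well, so D' D' = 1 and 2 E = D E E, which forces E = 0. *)
Lemma semisimple_unique D N D' N' k : 2%:R != 0 :> F ->
  D * D = 1 -> N * N = 0 -> D * N = N * D ->
  diagonalizable D' -> N' ^+ k = 0 -> D' * N' = N' * D' -> D + N = D' + N' -> D = D'.
Proof.
move=> n2 DD NN DN dD' N'k D'N' SE.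
have sq : (D + N) * (D + N) = 1 + 2%:R *: (D * N).
  by rewrite mulrDl !mulrDr DD NN addr0 -DN -addrA scaler_nat mulr2n.
have cube : (D + N) * ((D + N) * (D + N)) = D + 3%:R *: N.
  rewrite sq mulrDr mulr1 -scalerAr mulrDl mulrA DD mul1r.
  rewrite (_ : N * (D * N) = 0); last by rewrite mulrA -DN -mulrA NN mulr0.
  by rewrite addr0 -addrA; congr (_ + _); rewrite -[X in X + _]scale1r -scalerDl; congr (_ *: _); rewrite -(natrD _ 1 2).
have NE : 2%:R *: N = (D + N) * ((D + N) * (D + N)) - (D + N).
  by rewrite cube opprD addrACA subrr add0r -[X in _ - X]scale1r -scalerBl -(@natrB _ 3 1).
have D'S : D' * (D + N) = (D + N) * D' by rewrite SE mulrDr mulrDl D'N'.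
have N'S : N' * (D + N) = (D + N) * N' by rewrite SE mulrDr mulrDl D'N'.
have commN X : X * (D + N) = (D + N) * X -> X * N = N * X.
  move=> h; have H : 2%:R *: (X * N) = 2%:R *: (N * X).
    rewrite scalerAr scalerAl NE mulrBr mulrBl; congr (_ - _) => //.
    by rewrite !mulrA h -!mulrA; congr (_ * _); rewrite !mulrA h -!mulrA; congr (_ * _).
  by have := congr1 (fun Y => 2%:R^-1 *: Y) H; rewrite !scalerA mulVf // !scale1r.
have D'N := commN _ D'S; have N'N := commN _ N'S.
have D'D : D' * D = D * D'.
  by have := D'S; rewrite mulrDr mulrDl D'N => /addIr.
pose E := D - D'.
have EE : E = N' - N by apply/eqP; rewrite subr_eq addrAC eq_sym subr_eq addrC -SE addrC.
have Ek : E ^+ k.+1 = 0 by rewrite EE; apply: nilpotent_sub.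
have DE : D * E = E * D by rewrite mulrBr mulrBl D'D.
have D'E : D' = D - E by rewrite opprB addrC subrK.
have E0 : E = 0 -> D = D' by move/eqP; rewrite subr_eq0 => /eqP.
clearbody E.
(* D' D' - 1 is nilpotent and diagonalizable, hence 0 *)
have D'2 : D' * D' - 1 = E * (E - 2%:R *: D).
  rewrite D'E mulrBl !mulrBr DD DE -scalerAr scaler_nat mulr2n.
  rewrite opprB addrAC opprD; rewrite [1 - _ - 1]addrAC subrr sub0r.
  by rewrite addrCA addrC -!addrA.
have cE : GRing.comm E (E - 2%:R *: D).
  by rewrite /GRing.comm mulrBr mulrBl -scalerAr -scalerAl DE.
have D'D' : D' * D' = 1.
  by apply: (@diagonalizable_involution _ k.+1) => //; rewrite D'2 exprMn_comm // Ek mul0r.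
have E2 : 2%:R *: E = D * (E * E).
  have : E * (E - 2%:R *: D) = 0 by rewrite -D'2 D'D' subrr.
  rewrite mulrBr -scalerAr => /eqP; rewrite subr_eq0 => /eqP ->.
  by rewrite -DE -scalerAr mulrA DD mul1r.
(* iterating E = (D E / 2) E exhausts the nilpotent E *)
have F1 : E = (2%:R^-1 *: (D * E)) * E.
  by rewrite -scalerAl -mulrA -E2 scalerA mulVf // scale1r.
have Fj j : E = (2%:R^-1 *: (D * E)) ^+ j * E.
  by elim: j => [|j ih]; [rewrite mul1r|rewrite exprSr -mulrA -F1 -ih].
by apply: E0; rewrite (Fj k.+1) exprZn exprMn_comm // Ek mulr0 scaler0 mul0r.
Qed.

End Semisimple.

(** * The matrices of the example *)

Section Example.
Variable R : realType.
Local Notation C := R[i].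
Variables (c1 c2 m : R).

Definition mx2 (T : Type) (a b c d : T) : 'M[T]_2 :=
  \matrix_(i, j) if i == 0 then (if j == 0 then a else b) else (if j == 0 then c else d).

Lemma mx2P (T : Type) (A B : 'M[T]_2) : A 0 0 = B 0 0 -> A 0 1 = B 0 1 -> A 1 0 = B 1 0 -> A 1 1 = B 1 1 -> A = B.
Proof. by move=> h1 h2 h3 h4; apply/matrixP => i j; elim/ord2_cases: i; elim/ord2_cases: j. Qed.

Lemma mx2M (T : pzRingType) (a b c d a' b' c' d' : T) : mx2 a b c d *m mx2 a' b' c' d' =
  mx2 (a * a' + b * c') (a * b' + b * d') (c * a' + d * c') (c * b' + d * d').
Proof. by apply: mx2P; rewrite !mxE big_ord_recl big_ord1 !mxE. Qed.
Lemma mx2D (T : zmodType) (a b c d a' b' c' d' : T) : mx2 a b c d + mx2 a' b' c' d' =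
  mx2 (a + a') (b + b') (c + c') (d + d').
Proof. by apply: mx2P; rewrite !mxE. Qed.
Lemma mx2N (T : zmodType) (a b c d : T) : - mx2 a b c d = mx2 (- a) (- b) (- c) (- d).
Proof. by apply: mx2P; rewrite !mxE. Qed.
Lemma mx2_tr (T : Type) (a b c d : T) : (mx2 a b c d)^T = mx2 a c b d.
Proof. by apply: mx2P; rewrite !mxE. Qed.
Lemma mx2_scalar (T : pzRingType) (a : T) : a%:M = mx2 a 0 0 a.
Proof. by apply: mx2P; rewrite !mxE. Qed.
Lemma mx2_0 (T : zmodType) : 0 = mx2 0 0 0 0 :> 'M[T]_2.
Proof. by apply: mx2P; rewrite !mxE. Qed.
Lemma mx2_map (T T' : Type) (f : T -> T') (a b c d : T) : map_mx f (mx2 a b c d) = mx2 (f a) (f b) (f c) (f d).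
Proof. by apply: mx2P; rewrite !mxE. Qed.

Definition exW : 'M[C]_2 := mx2 0 'i%C (- 'i%C) 0.
Definition exQ : 'M[C]_2 := mx2 (m + c1)%:C c2%:C c2%:C (m - c1)%:C.
(** Trace-free part of the block Q; it anticommutes with W ([exWC]). *)
Definition exC : 'M[C]_2 := mx2 c1%:C c2%:C c2%:C (- c1)%:C.
Definition exA : 'M[C]_(2 + 2) := block_mx 0 exW (- exW) exQ.
Definition exS : 'M[C]_(2 + 2) := block_mx exW 0 exQ exW.
Definition exD : 'M[C]_(2 + 2) := block_mx exW 0 exC exW.
Definition exN : 'M[C]_(2 + 2) := block_mx 0 0 (m%:C)%:M 0.

Lemma exA_sym : exA^T = exA.
Proof.
rewrite /exA tr_block_mx trmx0 linearN /= !mx2_tr /exW mx2N opprK oppr0.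
by rewrite mx2N opprK oppr0.
Qed.

Lemma exS_A : exS = - (exA *m matJ R).
Proof.
rewrite /exA /matJ mulmx_block !mul0mx !mulmx0 !mulmx1 !mulmxN !mulmx1 !add0r !addr0 opp_block_mx.
by rewrite !opprK oppr0.
Qed.

Lemma i_sq : 'i%C * 'i%C = -1 :> C.
Proof. by rewrite -expr2 sqr_i. Qed.

Lemma exW2 : exW *m exW = 1%:M.
Proof.
rewrite /exW mx2M mx2_scalar !mul0r !mulr0 !addr0 !add0r mulrN mulNr i_sq opprK.
by [].
Qed.

Lemma exWC : exC *m exW + exW *m exC = 0.
Proof.
rewrite /exW /exC !mx2M mx2D mx2_0 !mul0r !mulr0 !addr0 !add0r.
have -> : (- c1)%:C = - c1%:C :> C by apply: complexP; rewrite ?cReN ?cImN /= ?oppr0.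
by congr mx2; ring.
Qed.

Lemma exD2 : exD *m exD = 1%:M.
Proof.
rewrite /exD mulmx_block !mul0mx !mulmx0 !addr0 !add0r exW2 exWC.
by rewrite -scalar_mx_block.
Qed.

Lemma exN2 : exN *m exN = 0.
Proof.
by rewrite /exN mulmx_block !mul0mx !mulmx0 !addr0 block_mx0.
Qed.

Lemma exDN : exD *m exN = exN *m exD.
Proof.
rewrite /exN /exD !mulmx_block !mul0mx !mulmx0 !addr0 !add0r.
by rewrite scalar_mxC.
Qed.

Lemma exSE : exS = exD + exN.
Proof.
rewrite /exS /exD /exN add_block_mx !addr0 mx2_scalar /exQ /exC mx2D !addr0.
by congr block_mx; congr mx2; apply: complexP; rewrite ?cReD ?cImD /= ?addr0; ring.
Qed.

Lemma exD_unique : unique (semisimple_part (exS : 'M[C]_4)) (exD : 'M[C]_4).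
Proof.
have n2 : 2%:R != 0 :> C by rewrite pnatr_eq0.
split.
  exists (exN : 'M[C]_4); split; [exact: exSE|exact: (involution_diagonalizable n2 exD2)| |exact: exDN].
  by exists 2%N; exact: exN2.
move=> D' [N' [SE dD' [k N'k] D'N']].
by apply: (semisimple_unique n2 exD2 exN2 exDN dD' N'k D'N'); rewrite -SE -exSE.
Qed.

Lemma exD_noncommuting : 0 < c1 ^+ 2 + c2 ^+ 2 ->
  Re_mx (exD : 'M[C]_4) *m Im_mx (exD : 'M[C]_4) - Im_mx (exD : 'M[C]_4) *m Re_mx (exD : 'M[C]_4) <> 0.
Proof.
move=> c0.
have ReD : map_mx (@complex.Re R) exD = block_mx 0 0 (mx2 c1 c2 c2 (- c1)) 0.
  by rewrite /exD map_block_mx !mx2_map map_mx0 //= oppr0 -!mx2_0.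
have ImD : map_mx (@complex.Im R) exD = block_mx (mx2 0 1 (- 1) 0) 0 0 (mx2 0 1 (-1) 0).
  by rewrite /exD map_block_mx !mx2_map map_mx0 //= -!mx2_0.
suff H : map_mx (@complex.Re R) exD *m map_mx (@complex.Im R) exD
   - map_mx (@complex.Im R) exD *m map_mx (@complex.Re R) exD <> 0 by exact: H.
rewrite ReD ImD !mulmx_block !mul0mx !mulmx0 !addr0 !add0r opp_block_mx add_block_mx.
rewrite !mx2M mx2N mx2D => /(congr1 (@dlsubmx _ 2 2 2 2)).
rewrite block_mxKdl => H.
have e00 := congr1 (fun M : 'M[R]_2 => M 0 0) H; have e01 := congr1 (fun M : 'M[R]_2 => M 0 1) H.
move: e00 e01 c0; rewrite !mxE /= => e00 e01.
have -> : c2 = 0 by lra.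
have -> : c1 = 0 by lra.
by rewrite expr2 mul0r addr0 ltxx.
Qed.

End Example.

(** * Symmetry of mixed partial derivatives *)

Section Schwarz.
Variables (R : realType) (n : nat).
Implicit Types (g : 'rV[R]_n -> R) (f : 'rV[R]_n -> R[i]) (p q : 'rV[R]_n) (i j : 'I_n).

(** The second difference quotient is a mixed derivative at an intermediate point;
    its left-hand side is symmetric in i and j. *)
Lemma second_difference g p i j (h : R) : smoothR g -> i != j ->
  exists2 q, `|q - p| <= `|h| &
   g (upd (upd p j (p ord0 j + h)) i (p ord0 i + h)) - g (upd p i (p ord0 i + h))
   - (g (upd p j (p ord0 j + h)) - g p) = pd j (pd i g) q * h * h.
Proof.
move=> sg ij; set pj := upd p j (p ord0 j + h).
have sig := smoothR_pd i sg.
have D (t : R) : is_derive t 1 (fun t : R => g (upd pj i t) - g (upd p i t))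
    (pd i g (upd pj i t) - pd i g (upd p i t)).
  exact: (is_deriveB (is_derive_upd (smoothR_derivable sg)) (is_derive_upd (smoothR_derivable sg))).
have [a ab Ea] := MVT_any (p ord0 i) (p ord0 i + h) D.
have D2 (t : R) : is_derive t 1 (fun t : R => pd i g (upd (upd p i a) j t)) (pd j (pd i g) (upd (upd p i a) j t)).
  exact: (is_derive_upd (smoothR_derivable sig)).
have [b bb Eb] := MVT_any (p ord0 j) (p ord0 j + h) D2.
exists (upd (upd p i a) j b).
  apply: rV_norm_le => // k; rewrite !mxE; case: eqP => [->|_].
    by have := between_dist bb; rewrite addrAC subrr add0r.
  case: eqP => [->|_]; last by rewrite subrr normr0.
  by have := between_dist ab; rewrite addrAC subrr add0r.
have pji : upd pj i (p ord0 i) = pj.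
  by have := upd_id pj i; rewrite /pj updE (negbTE ij).
move: Ea; rewrite pji upd_id => ->.
have ja : upd (upd p i a) j (p ord0 j) = upd p i a.
  by have := upd_id (upd p i a) j; rewrite updE eq_sym (negbTE ij).
move: Eb; rewrite ja (upd_comm _ _ _ ij) -/pj => ->.
by rewrite ![_ + h - _]addrAC !subrr !add0r.
Qed.

Lemma pd_comm g i j : smoothR g -> pd i (pd j g) = pd j (pd i g).
Proof.
move=> sg; have [->//|ij] := eqVneq i j; apply/funext => p.
have [B1 B10 H1] := smoothR_lip (`|p| + 1) (smoothR_pd i (smoothR_pd j sg)).
have [B2 B20 H2] := smoothR_lip (`|p| + 1) (smoothR_pd j (smoothR_pd i sg)).
apply/eqP; rewrite -subr_eq0 -normr_eq0 eq_le normr_ge0 andbT.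
apply: (@le_limit _ _ _ (B1 + B2)) => e e0 e1; rewrite add0r.
have [q1 q1p E1] := second_difference p e sg ij.
have ji : j != i by rewrite eq_sym.
have [q2 q2p E2] := second_difference p e sg ji.
rewrite (gtr0_norm e0) in q1p q2p.
have E : pd j (pd i g) q1 = pd i (pd j g) q2.
  move: E1 E2; rewrite (upd_comm _ _ _ ij).
  move: (pd j (pd i g) q1) (pd i (pd j g) q2) (g (upd (upd _ _ _) _ _)) (g (upd p i _)) (g (upd p j _)) (g p).
  move=> A B x y z w E1 E2; have H : A * (e * e) = B * (e * e) by rewrite !mulrA -E1 -E2; ring.
  by apply: mulIf H; rewrite mulf_neq0 // gt_eqF.
have pM : `|p| <= `|p| + 1 by rewrite lerDl.
have qM q : `|q - p| <= e -> `|q| <= `|p| + 1.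
  move=> qp; rewrite (_ : q = p + (q - p)); last by rewrite addrC subrK.
  apply: le_trans (ler_normD _ _) _; rewrite lerD2l.
  exact: le_trans qp e1.
have L1 := H1 p q2 pM (qM _ q2p); have L2 := H2 p q1 pM (qM _ q1p).
rewrite distrC in L1.
rewrite mulrDr; apply: le_trans (ler_distD (pd i (pd j g) q2) _ _) _; rewrite -[X in _ + `|X - _|]E.
rewrite ![e * _]mulrC; apply: lerD.
  by apply: le_trans L1 _; rewrite ler_wpM2l.
by apply: le_trans L2 _; rewrite ler_wpM2l.
Qed.

Lemma partialC_comm f i j : smooth f -> partialC i (partialC j f) = partialC j (partialC i f).
Proof.
move=> /smoothE[s1 s2]; apply/funext => p; apply: complexP.
  exact: (congr1 (fun G => G p) (pd_comm i j s1)).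
exact: (congr1 (fun G => G p) (pd_comm i j s2)).
Qed.

End Schwarz.

(** * The matrix associated with a second-order operator *)

Section AssociatedMatrix.
Variable R : realType.
Local Notation N5 := (2 + 2 + 1)%N.
Implicit Types (f a b : 'rV[R]_N5 -> R[i]) (p q : 'rV[R]_N5).

Definition vfield i a : diffop R N5 := (OpPartial i + OpMul a * OpPartial iu)%DO.

Lemma vfield2 i j a b f p : smooth b -> partialC iu b = (fun=> 0) -> smooth f ->
  apply_fun (vfield i a) (apply_fun (vfield j b) f) p =
  partialC i (partialC j f) p + partialC i b p * partialC iu f p + b p * partialC i (partialC iu f) p
  + a p * partialC iu (partialC j f) p + a p * b p * partialC iu (partialC iu f) p.
Proof.
move=> sb ub sf.
have sj := smooth_partial j sf; have su := smooth_partial iu sf; have sbu := smooth_mul sb su.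
have E k : partialC k (apply_fun (vfield j b) f) = fun p => partialC k (partialC j f) p
   + (partialC k b p * partialC iu f p + b p * partialC k (partialC iu f) p).
  by rewrite -[apply_fun _ _]/(fun p => partialC j f p + b p * partialC iu f p)
    (partialC_add k sj sbu) (partialC_mul k sb su).
rewrite -[LHS]/(partialC i (apply_fun (vfield j b) f) p + a p * partialC iu (apply_fun (vfield j b) f) p).
rewrite (E i) (E iu) ub mul0r add0r.
by rewrite mulrDr !mulrA !addrA.
Qed.

Lemma vfield_comm i j a b f : smooth a -> smooth b -> partialC iu a = (fun=> 0) -> partialC iu b = (fun=> 0) ->
  partialC i b = (fun=> 0) -> partialC j a = (fun=> 0) -> smooth f ->
  apply_fun (vfield i a) (apply_fun (vfield j b) f) = apply_fun (vfield j b) (apply_fun (vfield i a) f).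
Proof.
move=> sa sb ua ub ib ja sf; apply/funext => p.
rewrite (vfield2 i j a p sb ub sf) (vfield2 j i b p sa ua sf) ib ja.
rewrite (partialC_comm j i sf) (partialC_comm iu j sf) (partialC_comm iu i sf).
move: (partialC i (partialC j f) p) (partialC iu f p) (partialC i (partialC iu f) p) (partialC j (partialC iu f) p) (partialC iu (partialC iu f) p) => A B C D E.
ring.
Qed.

Definition cX (k : 'I_2) : 'rV[R]_N5 -> R[i] := fun p => (- (p ord0 (iy k) / 2))%:C.
Definition cY (k : 'I_2) : 'rV[R]_N5 -> R[i] := fun p => (p ord0 (ix k) / 2)%:C.

Lemma cX_smooth k : smooth (cX k). Proof. by case: (opX_smooth R k) => _ []. Qed.
Lemma cY_smooth k : smooth (cY k). Proof. by case: (opY_smooth R k) => _ []. Qed.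

Lemma cX_partial j k : j != iy k -> partialC j (cX k) = fun=> 0.
Proof.
move=> h; rewrite -(partialC_coef (-1) h); congr partialC; apply/funext => p.
by rewrite /cX mulN1r.
Qed.
Lemma cY_partial j k : j != ix k -> partialC j (cY k) = fun=> 0.
Proof.
move=> h; rewrite -(partialC_coef 1 h); congr partialC; apply/funext => p.
by rewrite /cY mul1r.
Qed.

Lemma YY_comm k l f : smooth f -> Yf k (Yf l f) = Yf l (Yf k f).
Proof.
by apply: (vfield_comm (cY_smooth k) (cY_smooth l)); apply: cY_partial; rewrite ?iux_eq ?iyx_eq.
Qed.

(** X_l and Y_k commute for k <> l, and all the Y_k commute; this is why the
    non-symmetrized products of the example have a symmetric matrix. *)
Lemma XY_comm k l f : k != l -> smooth f -> Yf k (Xf l f) = Xf l (Yf k f).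
Proof.
move=> kl; apply: (vfield_comm (cY_smooth k) (cX_smooth l)).
- by apply: cY_partial; rewrite iux_eq.
- by apply: cX_partial; rewrite iuy_eq.
- by apply: cX_partial; rewrite iy_eq.
by apply: cY_partial; rewrite ix_eq eq_sym.
Qed.

(** The coefficient of d/du in V_k. *)
Definition coef (k : 'I_(2 + 2)) : 'rV[R]_N5 -> R[i] :=
  match fintype.split k with inl j => cX j | inr j => cY j end.

Lemma opVE k : opV R k = vfield (lshift 1 k) (coef k).
Proof.
rewrite /opV /coef -[k in lshift 1 k]splitK.
by case: (fintype.split k) => j.
Qed.

Lemma coef_smooth k : smooth (coef k).
Proof. by rewrite /coef; case: (fintype.split k) => j; [exact: cX_smooth|exact: cY_smooth]. Qed.
Lemma coef_u k : partialC iu (coef k) = fun=> 0.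
Proof.
by rewrite /coef; case: (fintype.split k) => j; [apply: cX_partial; rewrite iuy_eq|apply: cY_partial; rewrite iux_eq].
Qed.
Lemma coef0 k : coef k 0 = 0.
Proof.
by rewrite /coef; case: (fintype.split k) => j; rewrite /cX /cY mxE mul0r ?oppr0.
Qed.

Lemma apply_quadratic (A : 'M[R[i]]_(2 + 2)) f p :
  apply_fun (quadratic_op A) f p =
  \sum_j \sum_k A j k * apply_fun (opV R j) (apply_fun (opV R k) f) p.
Proof.
pose ev (P : diffop R N5) := apply_fun P f p.
have evD : {morph ev : P Q / OpAdd P Q >-> P + Q} by [].
have ev0 : ev (OpMul (fun=> 0)) = 0 by rewrite /ev /= mul0r.
rewrite -/(ev _) /quadratic_op (big_morph ev evD ev0); apply: eq_bigr => j _.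
rewrite (big_morph ev evD ev0); apply: eq_bigr => k _.
rewrite /ev -[LHS]/(apply_fun (OpMul (fun=> A j k)) (apply_fun (opV R j) (apply_fun (opV R k) f)) p).
by [].
Qed.

Lemma opVl j : opV R (lshift 2 j) = opX R j.
Proof. by rewrite /opV (unsplitK (inl j)). Qed.
Lemma opVr j : opV R (rshift 2 j) = opY R j.
Proof. by rewrite /opV (unsplitK (inr j)). Qed.

Variables (c1 c2 m : R).

Lemma apply_example f p : apply_fun (example_op c1 c2 m) f p =
  (m + c1)%:C * Yf 0 (Yf 0 f) p + (m - c1)%:C * Yf 1 (Yf 1 f) p
  + (2 * c2)%:C * Yf 0 (Yf 1 f) p
  + 2 * 'i%C * (Xf 0 (Yf 1 f) p + -1 * Xf 1 (Yf 0 f) p).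
Proof. by []. Qed.

Lemma sum4 (h : 'I_(2 + 2) -> R[i]) :
  \sum_j h j = h (lshift 2 0) + h (lshift 2 1) + (h (rshift 2 0) + h (rshift 2 1)).
Proof.
have two (g : 'I_2 -> R[i]) : \sum_j g j = g 0 + g 1.
  by rewrite big_ord_recl big_ord1; congr (_ + g _); exact: val_inj.
by rewrite big_split_ord !two.
Qed.

#[local] Opaque Xf Yf.
Lemma example_quadratic : same_operator (example_op c1 c2 m) (quadratic_op (exA c1 c2 m)).
Proof.
move=> f sf; apply/funext => p; rewrite apply_quadratic apply_example.
rewrite !sum4 !opVl !opVr -![apply_fun (opX R _) _]/(Xf _ _) -![apply_fun (opY R _) _]/(Yf _ _).
rewrite /exA !block_mxEul !block_mxEur !block_mxEdl !block_mxEdr !mxE /=.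
rewrite (YY_comm 1 0 sf) (XY_comm (k := 1) (l := 0) isT sf) (XY_comm (k := 0) (l := 1) isT sf).
have -> : (2 * c2)%:C = 2 * c2%:C :> R[i] by apply: complexP; rewrite ?cReM ?cImM /=; ring.
move: (Xf 0 (Xf 0 f) p) (Xf 0 (Xf 1 f) p) (Xf 1 (Xf 0 f) p) (Xf 1 (Xf 1 f) p)
  (Xf 0 (Yf 0 f) p) (Xf 1 (Yf 1 f) p) (Yf 0 (Xf 0 f) p) (Yf 1 (Xf 1 f) p)
  (Yf 0 (Yf 0 f) p) (Yf 1 (Yf 1 f) p) (Yf 0 (Yf 1 f) p) (Xf 0 (Yf 1 f) p) (Xf 1 (Yf 0 f) p).
move=> x00 x01 x10 x11 xy0 xy1 yx0 yx1 y00 y11 y01 x0 x1; ring.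
Qed.

(** Quadratic monomials in the non-central coordinates: V_j V_k applied to them at 0
    sees only the second derivatives, since they do not depend on u and the
    coefficients of d/du vanish at 0. *)
Definition mono (a b : 'I_(2 + 2)) : 'rV[R]_N5 -> R[i] :=
  fun p => (p ord0 (lshift 1 a) * p ord0 (lshift 1 b))%:C.

Lemma mono_smooth (a b : 'I_(2 + 2)) : smooth (mono a b).
Proof.
apply: smooth_real; apply: smoothR_alg.
have c i := alg_smooth (@coord_smoothR R N5 i).
exact: (alg_mul (c _) (c _)).
Qed.

Lemma partial_mono j (a b : 'I_(2 + 2)) : partialC j (mono a b) =
  fun p => (p ord0 (lshift 1 a) * (lshift 1 b == j)%:R + p ord0 (lshift 1 b) * (lshift 1 a == j)%:R)%:C.
Proof.
apply/funext => p; rewrite partialC_real; congr (_%:C); apply: pd_derive.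
have C i := is_derive_coord p 'e_j i.
have D := is_deriveM (C (lshift 1 a)) (C (lshift 1 b)).
by apply: (is_derive_eq D); rewrite !mxE eqxx.
Qed.

Lemma partial2_mono i j (a b : 'I_(2 + 2)) : partialC i (partialC j (mono a b)) =
  fun p => ((lshift 1 a == i)%:R * (lshift 1 b == j)%:R + (lshift 1 b == i)%:R * (lshift 1 a == j)%:R)%:C.
Proof.
rewrite partial_mono; apply/funext => p; rewrite partialC_real; congr (_%:C); apply: pd_derive.
have C k := is_derive_coord p 'e_i k.
have D := is_deriveD (is_deriveZ ((lshift 1 b == j)%:R : R) (C (lshift 1 a))) (is_deriveZ ((lshift 1 a == j)%:R : R) (C (lshift 1 b))).
rewrite (_ : (fun p => _) = ((lshift 1 b == j)%:R : R) \*: (fun p : 'rV[R]_N5 => p ord0 (lshift 1 a))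
   + ((lshift 1 a == j)%:R : R) \*: (fun p : 'rV[R]_N5 => p ord0 (lshift 1 b))).
  by apply: (is_derive_eq D); rewrite !mxE eqxx /= /GRing.scale /= ![(_ == j)%:R * _]mulrC.
by apply/funext => q; rewrite /= ![q _ _ * _]mulrC.
Qed.

(** Hence a symmetric coefficient matrix can be read off the operator. *)
Lemma quadratic_mono (A : 'M[R[i]]_(2 + 2)) (a b : 'I_(2 + 2)) :
  apply_fun (quadratic_op A) (mono a b) 0 = A a b + A b a.
Proof.
rewrite apply_quadratic.
have E j k : apply_fun (opV R j) (apply_fun (opV R k) (mono a b)) 0 =
    (a == j)%:R * (b == k)%:R + (b == j)%:R * (a == k)%:R.
  rewrite !opVE (vfield2 _ _ _ _ (coef_smooth k) (coef_u k) (mono_smooth a b)) !coef0.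
  rewrite partial2_mono partial_mono !mxE !mul0r !addr0 mulr0 addr0 !eq_lshift.
  by apply: complexP; rewrite !(cReD, cImD, cReM, cImM); case: (a == j); case: (b == k); case: (b == j); case: (a == k); rewrite /= ?mulr0 ?mul0r ?subr0 ?addr0 ?add0r ?mulr1.
rewrite (eq_bigr (fun j => (a == j)%:R * A j b + (b == j)%:R * A j a)).
  rewrite big_split /=; congr (_ + _).
    by rewrite (bigD1 a) //= eqxx mul1r big1 ?addr0 // => j; rewrite eq_sym => /negbTE ->; rewrite mul0r.
  by rewrite (bigD1 b) //= eqxx mul1r big1 ?addr0 // => j; rewrite eq_sym => /negbTE ->; rewrite mul0r.
move=> j _; rewrite (eq_bigr (fun k => (b == k)%:R * ((a == j)%:R * A j k) + (a == k)%:R * ((b == j)%:R * A j k))).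
  rewrite big_split /=; congr (_ + _).
    by rewrite (bigD1 b) //= eqxx mul1r big1 ?addr0 // => k; rewrite eq_sym => /negbTE ->; rewrite mul0r.
  by rewrite (bigD1 a) //= eqxx mul1r big1 ?addr0 // => k; rewrite eq_sym => /negbTE ->; rewrite mul0r.
by move=> k _; rewrite E; ring.
Qed.

Lemma associated_unique (L : diffop R N5) S S' : associated_matrix L S -> associated_matrix L S' -> S = S'.
Proof.
move=> [A [At AL ->]] [B [Bt BL ->]]; congr (- (_ *m _)).
apply/matrixP => a b.
have HA : apply_fun L (mono a b) 0 = A a b *+ 2.
  by rewrite (AL _ (mono_smooth a b)) quadratic_mono -{2}At mxE.
have HB : apply_fun L (mono a b) 0 = B a b *+ 2.
  by rewrite (BL _ (mono_smooth a b)) quadratic_mono -{2}Bt mxE.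
have n2 : 2%:R != 0 :> R[i] by rewrite pnatr_eq0.
by apply: (mulfI n2); rewrite !mulr_natl -HA -HB.
Qed.

Lemma exS_unique : unique (associated_matrix (example_op c1 c2 m)) (exS c1 c2 m : 'M[R[i]]_4).
Proof.
have H : associated_matrix (example_op c1 c2 m) (exS c1 c2 m).
  by exists (exA c1 c2 m); split; [exact: exA_sym|exact: example_quadratic|exact: exS_A].
by split => // S'; exact: associated_unique.
Qed.

End AssociatedMatrix.

Theorem proposition7p3 (R : realType) (c1 c2 m : R)
    (hc : 0 < Num.sqrt (c1 ^+ 2 + c2 ^+ 2))
    (hm : Num.sqrt (c1 ^+ 2 + c2 ^+ 2) <= m) :
  (forall alpha : R[i],
     locally_solvable
       (example_op c1 c2 m + ('i%C * alpha)%R *: opU R)%DO) /\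
  (exists S D : 'M[R[i]]_4,
     [/\ unique (associated_matrix (example_op c1 c2 m)) S,
         unique (semisimple_part S) D &
         Re_mx D *m Im_mx D - Im_mx D *m Re_mx D <> 0]).
Proof.
have c0 : 0 < c1 ^+ 2 + c2 ^+ 2 by rewrite -sqrtr_gt0.
have m0 : 0 < m := lt_le_trans hc hm.
have cm : c1 ^+ 2 + c2 ^+ 2 <= m ^+ 2.
  rewrite -(sqr_sqrtr (ltW c0)) ler_pXn2r // nnegrE; exact: ltW.
split=> [alpha|]; first exact: perturbed_op_solvable.
exists (exS c1 c2 m), (exD c1 c2).
split; [exact: exS_unique|exact: exD_unique|exact: exD_noncommuting].
Qed.
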